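(* There is a $2$-approximation algorithm for \textsc{Densest $k$-Subgraph} running in time $O\big(2^{\mathrm{tc}(G)/2}((k^3+\mathrm{tc}(G))n+m)\big)$, where $G$ is the input graph with $n$ vertices and $m$ edges and $\mathrm{tc}(G)$ is its twin cover number.
   Context: All graphs are finite, simple and undirected. \textsc{Densest $k$-Subgraph}: given a graph $G=(V,E)$ and an integer $k$, find $S\subseteq V$ with $|S|=k$ maximizing the number of edges of $G[S]$. A $2$-approximation algorithm outputs a set $S$ with $|S|=k$ such that $G[S]$ has at least half as many edges as an optimal solution. A twin cover of $G$ is a set $X\subseteq V$ such that every edge $\{u,v\}$ satisfies $u\in X$ or $v\in X$ or $N[u]=N[v]$ (closed neighborhoods); the twin cover number $\mathrm{tc}(G)$ is the minimum size of a twin cover. *)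

(* Defs.v *)
From mathcomp Require Import all_boot.

Set Implicit Arguments.
Unset Strict Implicit.
Unset Printing Implicit Defensive.

(** * Graphs
    A finite simple graph on [T] is a symmetric irreflexive [e : rel T]; both
    properties are hypotheses wherever they matter. *)

Section Graphs.
Variables (T : finType) (e : rel T).

(* Edges are unordered pairs, so each edge is counted once. *)
Definition edges : {set {set T}} :=
  [set A | [exists u, exists v, e u v && (A == [set u; v])]].

Definition nb_edges_in (S : {set T}) : nat :=
  #|[set A in edges | A \subset S]|.

Definition closed_nbhd (u : T) : {set T} := [set v | (v == u) || e u v].

Definition twin_cover (X : {set T}) : bool :=
  [forall u, forall v, e u v ==>
     [|| u \in X, v \in X | closed_nbhd u == closed_nbhd v]].

(* The default [setT] of the arg min is always a twin cover. *)
Definition twin_cover_number : nat :=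
  #|[arg min_(X < setT | twin_cover X) #|X| ]|.

Definition densest_opt (k : nat) : nat :=
  \max_(S : {set T} | #|S| == k) nb_edges_in S.

End Graphs.

(** * Word RAM
    Algorithms are imperative programs over finitely many word variables and
    finitely many word arrays with random access (a program mentions only
    finitely many of the names [nat]).  There are no procedures and no
    allocation.  Words have [w] bits: every computed value is reduced modulo
    [2 ^ w], so in particular only [2 ^ w] cells of each array are addressable.
    Every expression node and every executed command costs one unit of time. *)

Inductive binop := Add | Sub | Mul | Div | Mod | Eq | Lt.

Inductive expr :=
  | Const of nat
  | Var of nat
  | Get of nat & expr                 (* array name, index *)
  | Bin of binop & expr & expr.

Inductive cmd :=
  | Skip
  | Assign of nat & expr
  | Put of nat & expr & expr         (* array name, index, value *)
  | Seq of cmd & cmd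
  | If of expr & cmd & cmd
  | While of expr & cmd.

Record state := State {
  var : nat -> nat;
  arr : nat -> nat -> nat
}.

(* As on [nat], subtraction is truncated and division by 0 is total. *)
Definition binop_sem (o : binop) (x y : nat) : nat :=
  match o with
  | Add => x + y
  | Sub => x - y
  | Mul => x * y
  | Div => x %/ y
  | Mod => x %% y
  | Eq => x == y
  | Lt => x < y
  end.

Fixpoint eval (w : nat) (s : state) (a : expr) : nat :=
  match a with
  | Const x => x %% 2 ^ w
  | Var x => var s x
  | Get A i => arr s A (eval w s i)
  | Bin o a1 a2 => binop_sem o (eval w s a1) (eval w s a2) %% 2 ^ w
  end.

Fixpoint cost (a : expr) : nat :=
  match a with
  | Const _ | Var _ => 1
  | Get _ i => (cost i).+1
  | Bin _ a1 a2 => (cost a1 + cost a2).+1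
  end.

Definition set_var (s : state) (x v : nat) : state :=
  State (fun y => if y == x then v else var s y) (arr s).

Definition set_arr (s : state) (A i v : nat) : state :=
  State (var s)
    (fun B j => if (B == A) && (j == i) then v else arr s B j).

(* [exec w p s t s']: with [w]-bit words, [p] started in [s] halts in [s']
   after exactly [t] steps; a diverging run has no derivation. *)
Inductive exec (w : nat) : cmd -> state -> nat -> state -> Prop :=
  | exec_skip s : exec w Skip s 1 s
  | exec_assign s x a :
      exec w (Assign x a) s (cost a).+1 (set_var s x (eval w s a))
  | exec_put s A i a :
      exec w (Put A i a) s (cost i + cost a).+1
        (set_arr s A (eval w s i) (eval w s a))
  | exec_seq p1 p2 s1 s2 s3 t1 t2 :
      exec w p1 s1 t1 s2 -> exec w p2 s2 t2 s3 ->
      exec w (Seq p1 p2) s1 (t1 + t2).+1 s3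
  | exec_if a p1 p2 s1 s2 t :
      exec w (if eval w s1 a != 0 then p1 else p2) s1 t s2 ->
      exec w (If a p1 p2) s1 (cost a + t).+1 s2
  | exec_while_stop a p s :
      eval w s a = 0 -> exec w (While a p) s (cost a).+1 s
  | exec_while_step a p s1 s2 s3 t1 t2 :
      eval w s1 a != 0 ->
      exec w p s1 t1 s2 -> exec w (While a p) s2 t2 s3 ->
      exec w (While a p) s1 (cost a + t1 + t2).+1 s3.

(* Runs are deterministic, so "the running time" is meaningful. *)
Lemma exec_det w p s t1 s1 t2 s2 :
  exec w p s t1 s1 -> exec w p s t2 s2 -> t1 = t2 /\ s1 = s2.
Proof.
move=> H; elim: H t2 s2 => {p s t1 s1} [s|s x a|s A i a|p1 p2 s1 s2 s3 t1 t2
  _ IH1 _ IH2|a p1 p2 s1 s2 t _ IH|a p s E|a p s1 s2 s3 t1 t2 E _ IH1 _ IH2] t' s' H;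
  inversion H; subst; try done;
  try (by match goal with
    | E1 : is_true (eval ?w ?s ?a != 0), E2 : eval ?w ?s ?a = 0 |- _ =>
        rewrite E2 in E1
    end);
  repeat match goal with
  | IH : forall t s, exec w ?p ?s0 t s -> _, H : exec w ?p ?s0 _ _ |- _ =>
      let E1 := fresh in let E2 := fresh in
      have [E1 E2] := IH _ _ H; subst; clear H
  end; done.
Qed.

(** * Input and output
    The input graph, on vertices [0, ..., n-1], is given by adjacency lists, each
    in arbitrary order, packed in one array. *)

Definition adjacency_lists (n : nat) (e : rel 'I_n)
    (adj : 'I_n -> seq 'I_n) : Prop :=
  forall u, uniq (adj u) /\ adj u =i e u.

(* [n+1] entries: the list of [u] occupies positions
   [offsets u, ..., offsets u.+1 - 1] of [neighbours]; the last entry is [2m]. *)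
Definition offsets (n : nat) (adj : 'I_n -> seq 'I_n) : seq nat :=
  [seq \sum_(u < n | u < i) size (adj u) | i <- iota 0 n.+1].

Definition neighbours (n : nat) (adj : 'I_n -> seq 'I_n) : seq nat :=
  flatten [seq [seq val v | v <- adj u] | u <- enum 'I_n].

(* Variables 0 and 1 hold [n] and [k]; arrays 0 and 1 hold the graph; everything
   else is zero. *)
Definition input (n k : nat) (adj : 'I_n -> seq 'I_n) : state :=
  State (fun x => nth 0 [:: n; k] x)
        (fun A i => nth 0 (nth [::] [:: offsets adj; neighbours adj] A) i).

(* Array 2 holds the characteristic vector of the answer. *)
Definition output (n : nat) (s : state) : {set 'I_n} :=
  [set v : 'I_n | arr s 2 v != 0].

(* Words have at least [(c+2) log2 (n+2)] bits; the offset 2 ensures that the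
   input, whose entries are at most [n ^ 2], always fits. *)
Definition word_size_ok (c n w : nat) : Prop := n.+2 ^ c.+2 <= 2 ^ w.

(* Main.v *)
(* Let X be a minimum twin cover, split into halves X1 and X2.  Outside X the graph is a
   disjoint union of cliques of twins, so every edge is incident to X1, incident to X2, or
   inside one of these cliques.  For either half Z, the subgraph formed by the edges incident
   to Z or inside a clique is solved exactly: guess the intersection Y of the solution with
   Z; a vertex outside Z then contributes its degree into Y plus the number of vertices of
   its own clique chosen before it, and a knapsack over the cliques finds the best k-set.
   The edges of an optimal set are covered by the two subgraphs, so the better of the two
   results has at least half as many edges.

   A twin cover is a vertex cover of the graph of edges between non-twins.  A minimum one is
   found by branching: on a vertex of degree at most 2 one takes either its neighbourhood or
   the second neighbourhood, otherwise, at maximum degree, a vertex or its neighbourhood.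
   Branching at degree 3 only happens in a cubic graph and leaves vertices of degree 2 in one
   branch, which keeps the branching number below the square root of 2. *)

(* Finding the cover must itself fit into [2 ^ (tc / 2)], so a unit of budget may multiply the
   search tree by at most s, the square root of 2. Plain branching at degree 3 fails, because 1/s +
   1/s^3 exceeds 1. Subtrees with a vertex of degree 1 or 2 therefore get the smaller bound
   [low_size]. Its ratio 15/17 to [general_size] leaves room both for low branching, 1/s^2 + 1/s^3
   <= 15/17, and for the cubic case, (15/17)/s + 1/s^3 <= 1. The knapsack values are squeezed
   between two graphs. An entry is at least the count of [edge_at] pairs of every candidate set, and
   at most the count of pairs of the full graph [e] on a set that is stored with it. This is all the
   approximation argument uses. Counts are over ordered pairs, hence doubled, and are shifted by one
   so that 0 can mean undefined. The machine has no procedures, and a word may be too short for a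
   bit mask. So the search keeps its own stack in an array, and the subsets of a half are counted in
   an array of bits. *)
Require Import Defs.
From mathcomp Require Import all_boot all_order all_algebra.
From mathcomp Require Import reals exp.
From mathcomp Require Import zify.

Set Implicit Arguments.
Unset Strict Implicit.
Unset Printing Implicit Defensive.

(** * Program logic *)

Ltac prune := repeat match goal with
 | H : ?T |- _ => lazymatch T with
    | is_true (leq _ _) => fail | is_true (~~ (_ == _)) => fail | @eq nat _ _ => fail | @eq bool
      _ _ => fail | is_true (_ && _) => fail | is_true (_ != _) => fail
    | _ => clear H end end.
Ltac slia := prune; lia.

Definition cap (w : nat) : nat := 2 ^ w.

(** Total correctness with a time bound: [exec] has derivations only for halting runs, so this
    includes termination. *)
Definition runs w p s T (Q : state -> Prop) :=
  exists t s', [/\ exec w p s t s', t <= T & Q s'].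

Fixpoint wvars (p : cmd) : seq nat :=
  match p with
  | Skip | Put _ _ _ => [::]
  | Assign x _ => [:: x]
  | Seq p q | If _ p q => wvars p ++ wvars q
  | While _ p => wvars p
  end.

Fixpoint warrs (p : cmd) : seq nat :=
  match p with
  | Skip | Assign _ _ => [::]
  | Put A _ _ => [:: A]
  | Seq p q | If _ p q => warrs p ++ warrs q
  | While _ p => warrs p
  end.

(** Frame condition. The footprints [wvars] and [warrs] of a concrete program are closed lists, so
    non-membership holds by computation. Hence the frame facts [k.1 x isT] and [k.2 A isT]
    throughout. *)
Definition keep (vs As : seq nat) (s s' : state) :=
  (forall x, x \notin vs -> var s' x = var s x) /\
  (forall A, A \notin As -> arr s' A = arr s A).

Lemma keep_refl vs As s : keep vs As s s.
Proof. by []. Qed.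

Lemma keep_trans vs As s1 s2 s3 :
  keep vs As s1 s2 -> keep vs As s2 s3 -> keep vs As s1 s3.
Proof.
move=> [v1 a1] [v2 a2]; split=> x Hx; first by rewrite v2 ?v1.
by rewrite a2 ?a1.
Qed.

Lemma keep_sub vs As vs' As' s s' :
  {subset vs <= vs'} -> {subset As <= As'} ->
  keep vs As s s' -> keep vs' As' s s'.
Proof.
move=> sv sa [kv ka]; split=> x Hx; first by apply/kv/(contra (sv x)).
by apply/ka/(contra (sa x)).
Qed.

Lemma keep_set_var vs As s x v : x \in vs -> keep vs As s (set_var s x v).
Proof.
move=> xv; split=> //= y yv; case: eqP => // yx.
by rewrite yx xv in yv.
Qed.

Lemma keep_set_arr vs As s A i v : A \in As -> keep vs As s (set_arr s A i v).
Proof.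
move=> AA; split=> //= B BB; have -> : (B == A) = false; last by [].
by apply: contraNF BB => /eqP ->.
Qed.

Lemma keep_varS vs As s s1 x v :
  x \in vs -> keep vs As s s1 -> keep vs As s (set_var s1 x v).
Proof. by move=> xv k; apply: (keep_trans k (keep_set_var _ _ _ xv)). Qed.

Lemma exec_keep w p s t s' : exec w p s t s' -> keep (wvars p) (warrs p) s s'.
Proof.
elim=> {p s t s'}.
- by move=> s; apply: keep_refl.
- by move=> s x a /=; apply: keep_set_var; rewrite inE.
- by move=> s A i a /=; apply: keep_set_arr; rewrite inE.
- move=> p1 p2 s1 s2 s3 t1 t2 _ IH1 _ IH2 /=; apply: keep_trans.
    by apply: keep_sub IH1 => x; rewrite mem_cat => ->.
  by apply: keep_sub IH2 => x; rewrite mem_cat => ->; rewrite orbT.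
- move=> a p1 p2 s1 s2 t _ IH /=; move: IH; case: ifP => _; apply: keep_sub => x;
  by rewrite mem_cat => ->; rewrite ?orbT.
- by move=> a p s _ /=; apply: keep_refl.
by move=> a p s1 s2 s3 t1 t2 _ _ IH1 _ IH2 /=; apply: keep_trans IH1 IH2.
Qed.

Lemma runs_keep w p s T Q :
  runs w p s T Q -> runs w p s T (fun s' => Q s' /\ keep (wvars p) (warrs p) s s').
Proof.
by case=> t [s' [E tT q]]; exists t, s'; split=> //; split=> //; apply: exec_keep E.
Qed.

Lemma runs_mono w p s T T' (Q Q' : state -> Prop) :
  runs w p s T Q -> T <= T' ->
  (forall s', keep (wvars p) (warrs p) s s' -> Q s' -> Q' s') -> runs w p s T' Q'.
Proof.
move=> /runs_keep [t [s' [E tT [q k]]]] TT qq.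
by exists t, s'; split=> //; [apply: leq_trans TT | apply: qq].
Qed.

(** The intermediate assertion receives the frame of [p], so it need only mention what [p]
    changes. *)
Lemma runs_seq w p q s T1 T2 T (Q : state -> Prop) :
  runs w p s T1
    (fun s' => keep (wvars p) (warrs p) s s' -> runs w q s' T2 Q) ->
  (T1 + T2).+1 <= T -> runs w (Seq p q) s T Q.
Proof.
move=> /runs_keep [t1 [s1 [E1 l1 [R k1]]]] lT.
have [t2 [s2 [E2 l2 q2]]] := R k1.
exists (t1 + t2).+1, s2; split=> //; first exact: exec_seq E1 E2.
by apply: leq_trans lT; rewrite ltnS leq_add.
Qed.

(** * Overflow-free evaluation and symbolic execution of loop-free code *)

Fixpoint ev (s : state) (a : expr) : nat :=
  match a with
  | Const x => x
  | Var x => var s x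
  | Get A i => arr s A (ev s i)
  | Bin o a1 a2 => binop_sem o (ev s a1) (ev s a2)
  end.

(** No intermediate value of [ev] reaches the modulus. Comparisons carry no bound of their own,
    since 0 and 1 fit as soon as [1 < W]. *)
Fixpoint fits (W : nat) (s : state) (a : expr) : bool :=
  match a with
  | Const x => x < W
  | Var _ => true
  | Get _ i => fits W s i
  | Bin Eq a1 a2 | Bin Lt a1 a2 => fits W s a1 && fits W s a2
  | Bin o a1 a2 =>
      [&& fits W s a1, fits W s a2 & binop_sem o (ev s a1) (ev s a2) < W]
  end.

Lemma evalE w s a : 1 < cap w -> fits (cap w) s a -> eval w s a = ev s a.
Proof.
rewrite /cap => w1; elim: a => [x|x|A i IH|o a1 IH1 a2 IH2] //=.
- by move=> ?; rewrite modn_small.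
- by move=> /IH ->.
have b2 (b : bool) : (b : nat) < 2 ^ w by case: b => //; apply: ltnW.
by case: o => /=;
  (try by case/and3P=> /IH1 -> /IH2 -> ?; rewrite modn_small);
  case/andP=> /IH1 -> /IH2 ->; rewrite modn_small.
Qed.

Fixpoint simple (p : cmd) : bool :=
  match p with
  | Seq p q | If _ p q => simple p && simple q
  | While _ _ => false
  | _ => true
  end.

Fixpoint run (p : cmd) (s : state) : state :=
  match p with
  | Skip => s
  | Assign x a => set_var s x (ev s a)
  | Put A i a => set_arr s A (ev s i) (ev s a)
  | Seq p q => run q (run p s)
  | If a p q => if ev s a != 0 then run p s else run q s
  | While _ _ => s
  end.

Fixpoint fitsp (W : nat) (p : cmd) (s : state) : bool :=
  match p with
  | Skip => true
  | Assign x a => fits W s a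
  | Put A i a => fits W s i && fits W s a
  | Seq p q => fitsp W p s && fitsp W q (run p s)
  | If a p q => fits W s a && (if ev s a != 0 then fitsp W p s else fitsp W q s)
  | While _ _ => false
  end.

Fixpoint maxtime (p : cmd) : nat :=
  match p with
  | Skip => 1
  | Assign x a => (cost a).+1
  | Put A i a => (cost i + cost a).+1
  | Seq p q => (maxtime p + maxtime q).+1
  | If a p q => (cost a + maxn (maxtime p) (maxtime q)).+1
  | While _ _ => 0
  end.

(** For concrete loop-free code, [run] and [fitsp] compute to an explicit final state and explicit
    overflow conditions, while [maxtime] charges the costlier branch of each conditional. *)
Lemma runs_simple w p s T (Q : state -> Prop) :
  1 < cap w -> simple p -> fitsp (cap w) p s -> maxtime p <= T ->
  Q (run p s) -> runs w p s T Q.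
Proof.
move=> w1 sp fp lT qr.
suff [t [E l]] : exists t, exec w p s t (run p s) /\ t <= maxtime p.
  by exists t, (run p s); split=> //; apply: leq_trans lT.
elim: p s sp fp {T lT Q qr} => //=.
- by move=> s _ _; exists 1; split=> //; constructor.
- move=> x a s _ fa; exists (cost a).+1; split=> //.
  by rewrite -(evalE w1 fa); constructor.
- move=> A i a s _ /andP[fi fa]; exists (cost i + cost a).+1; split=> //.
  by rewrite -(evalE w1 fi) -(evalE w1 fa); constructor.
- move=> p IHp q IHq s /andP[sp sq] /andP[fp fq].
  have [t1 [E1 l1]] := IHp s sp fp; have [t2 [E2 l2]] := IHq _ sq fq.
  exists (t1 + t2).+1; split; first exact: exec_seq E1 E2.
  by rewrite ltnS leq_add.
- move=> a p IHp q IHq s /andP[sp sq] /andP[fa]; rewrite -(evalE w1 fa).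
  case: ifP => ca f.
    have [t [E l]] := IHp s sp f; exists (cost a + t).+1; split.
      by apply: exec_if; rewrite ca.
    by rewrite ltnS leq_add2l (leq_trans l) // leq_maxl.
  have [t [E l]] := IHq s sq f; exists (cost a + t).+1; split.
    by apply: exec_if; rewrite ca.
  by rewrite ltnS leq_add2l (leq_trans l) // leq_maxr.
Qed.

Ltac simple_run := apply: runs_simple; [done | done | | by vm_compute | ].

Lemma runs_if w a p q s T1 T (Q : state -> Prop) :
  1 < cap w -> fits (cap w) s a ->
  (ev s a != 0 -> runs w p s T1 Q) -> (ev s a = 0 -> runs w q s T1 Q) ->
  (cost a + T1).+1 <= T -> runs w (If a p q) s T Q.
Proof.
move=> w1 fa rp rq lT.
have [t [s' [E l qs]]] : runs w (if eval w s a != 0 then p else q) s T1 Q.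
  rewrite (evalE w1 fa); case: ifPn => [|/negbNE/eqP]; [exact: rp|exact: rq].
exists (cost a + t).+1, s'; split=> //; first exact: exec_if.
by apply: leq_trans lT; rewrite ltnS leq_add2l.
Qed.

(* [G] is a type of ghost states and [Phi] bounds the remaining time. *)
Lemma runs_while w a p s (G : Type) (I : G -> state -> Prop) (Phi : G -> nat) g T :
  1 < cap w -> I g s ->
  (forall g s, I g s -> fits (cap w) s a) ->
  (forall g s, I g s -> ev s a != 0 -> exists2 T1, T1 + (cost a).+1 <= Phi g &
     runs w p s T1 (fun s' => keep (wvars p) (warrs p) s s' ->
       exists2 g', T1 + (cost a).+1 + Phi g' <= Phi g & I g' s')) ->
  Phi g + (cost a).+1 <= T ->
  runs w (While a p) s T (fun s' => ev s' a = 0 /\ exists g', I g' s').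
Proof.
move=> w1 Is fI step lT.
suff [t [s' [E l q]]] : runs w (While a p) s (Phi g + (cost a).+1)
    (fun s' => ev s' a = 0 /\ exists g', I g' s').
  by exists t, s'; split=> //; apply: leq_trans lT.
have [m] := ubnP (Phi g); elim: m g s Is {lT T} => // m IH g s Is; rewrite ltnS => lm.
have [z|nz] := eqVneq (ev s a) 0.
  exists (cost a).+1, s; split; first by apply: exec_while_stop; rewrite evalE ?(fI g).
    by rewrite leq_addl.
  by split=> //; exists g.
have [T1 lT1 /runs_keep[t1 [s1 [E1 l1 [H k1]]]]] := step g s Is nz.
have [g' lg' Ig'] := H k1.
have lt : Phi g' < m by slia.
have [t2 [s2 [E2 l2 q2]]] := IH g' s1 Ig' lt.
exists (cost a + t1 + t2).+1, s2; split=> //; last by slia.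
by apply: exec_while_step E1 E2; rewrite evalE ?(fI g).
Qed.

(** * Counting loops *)

Definition For (x hi : nat) (body : cmd) : cmd :=
  Seq (Assign x (Const 0))
    (While (Bin Lt (Var x) (Var hi))
       (Seq body (Assign x (Bin Add (Var x) (Const 1))))).

(** The bound [B] may vary with the iteration, so that loops over all adjacency lists cost a
    multiple of n + m rather than n times the largest degree. The 10 per round covers the test and
    the increment. *)
Lemma runs_for w x hi N body s (I : nat -> state -> Prop) (B : 'I_N -> nat) T
    (k := keep (x :: wvars body) (warrs body)) :
  1 < cap w -> N < cap w -> var s hi = N ->
  x \notin wvars body -> hi \notin x :: wvars body ->
  I 0 (set_var s x 0) ->
  (forall (i : 'I_N) s', k s s' -> var s' x = i -> I i s' ->
     runs w body s' (B i) (fun s'' => keep (wvars body) (warrs body) s' s'' ->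
       I i.+1 (set_var s'' x i.+1))) ->
  \sum_(i < N) (B i + 10) + 10 <= T ->
  runs w (For x hi body) s T (fun s' => I N s' /\ k s s').
Proof.
move=> w1 Nw sh xb hx I0 step lT.
pose J (i : nat) s' := [/\ k s s', var s' x = i, i <= N & I i s'].
pose Phi i := \sum_(j < N | i <= j) (B j + 10).
have J0 : J 0 (set_var s x 0).
  by split=> //=; rewrite ?eqxx //; apply: keep_set_var; rewrite inE eqxx.
have hiE i s' : J i s' -> var s' hi = N by case=> [[kv _] _ _ _]; rewrite kv.
have w0 : 0 < cap w by apply: ltnW.
apply: (@runs_seq _ _ _ _ 2 (Phi 0 + 4)); last first.
  have -> : Phi 0 = \sum_(i < N) (B i + 10) by apply: eq_bigl.
  by slia.
apply: runs_simple => //= _.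
apply: (@runs_mono _ _ _ (Phi 0 + 4) (Phi 0 + 4) (fun s' => ev s' (Bin Lt (Var x) (Var hi)) = 0
   /\ exists g', J g' s')) => //; last first.
  move=> s' _ [/= + [g Jg]]; have [ks xg gN Ig] := Jg.
  rewrite (hiE _ _ Jg) xg; case: ltnP => // Ng _; split=> //.
  by have -> : N = g by apply/eqP; rewrite eqn_leq Ng gN.
apply: (@runs_while _ _ _ _ nat J Phi 0) => //.
move=> g s' Jg; have [ks xg gN Ig] := Jg; rewrite /= (hiE _ _ Jg) xg.
case: ltnP => //= lg _.
have PhiE : Phi g = B (Ordinal lg) + 10 + Phi g.+1.
  rewrite /Phi (bigD1 (Ordinal lg)) //=; congr (_ + _); apply: eq_bigl => j.
  rewrite andbC; have -> : (j != Ordinal lg) = (j != g :> nat) by [].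
  by rewrite ltn_neqAle eq_sym.
exists (B (Ordinal lg) + 5); first by rewrite PhiE; slia.
apply: (@runs_seq _ _ _ _ (B (Ordinal lg)) 4); last by slia.
apply: runs_mono (step (Ordinal lg) s' ks xg Ig) _ _ => // s2 k2 I2 _.
have x2 : var s2 x = g by case: k2 => kv _; rewrite kv.
apply: runs_simple => //=.
  by rewrite x2 w1 /=; slia.
move=> _; exists g.+1; first by rewrite PhiE /=; slia.
rewrite x2 addn1; split=> //; last exact: I2.
  apply: keep_trans ks _; apply: keep_trans (keep_set_var _ _ _ _).
    by apply: keep_sub k2 => // z zb; rewrite inE zb orbT.
  by rewrite inE eqxx.
by rewrite /= eqxx.
Qed.

(** * Scanning adjacency lists *)

Notation vN := 0 (only parsing).
Notation vK := 1 (only parsing).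
Notation vU := 2 (only parsing).
Notation vI := 3 (only parsing).
Notation vE := 4 (only parsing).
Notation vV := 5 (only parsing).
Notation vF := 6 (only parsing).
Notation aOff := 0 (only parsing).
Notation aNbr := 1 (only parsing).
Notation aOut := 2 (only parsing).

Coercion Const : nat >-> expr.
Declare Scope expr_scope.
Delimit Scope expr_scope with X.
Arguments Bin _ _%_X _%_X.
Arguments Get _ _%_X.
Arguments Put _ _%_X _%_X.
Arguments If _%_X _ _.
Arguments While _%_X _.
Notation "$ x" := (Var x) (at level 2, x at level 1, format "$ x").
Notation "a + b" := (Bin Add a b) : expr_scope.
Notation "a - b" := (Bin Defs.Sub a b) : expr_scope.
Notation "a * b" := (Bin Mul a b) : expr_scope.
Notation "a / b" := (Bin Div a b) : expr_scope.
Notation "a == b" := (Bin Eq a b) : expr_scope.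
Notation "a < b" := (Bin Lt a b) : expr_scope.
Notation "x ::= a" := (Assign x a%X) (at level 89, no associativity).
Notation "p ;; q" := (Seq p q) (at level 90, right associativity).

Definition ForAdj (body : cmd) : cmd :=
  vI ::= Get aOff $vU ;;
  vE ::= Get aOff ($vU + 1)%X ;;
  While ($vI < $vE)%X (vV ::= Get aNbr $vI ;; body ;; vI ::= $vI + 1).

Definition SumAdj (a : expr) : cmd :=
  vF ::= 0 ;; ForAdj (vF ::= $vF + a).

Arguments SumAdj _%_X.

Definition off n (adj : 'I_n -> seq 'I_n) (i : nat) :=
  \sum_(u < n | u < i) size (adj u).

Lemma nth_flatten_sum (T : Type) (x0 : T) (ss : seq (seq T)) i j :
  i < size ss -> j < size (nth [::] ss i) ->
  nth x0 (flatten ss) (\sum_(s <- take i ss) size s + j) = nth x0 (nth [::] ss i) j.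
Proof.
elim: ss i => [|s ss IH] [|i] //=.
  by move=> _ ls; rewrite big_nil nth_cat ls.
rewrite ltnS => li lj; rewrite big_cons -addnA nth_cat ifN ?addKn; first exact: IH.
by rewrite -leqNgt leq_addr.
Qed.

Section Adjacency.
Variables (n k : nat) (e : rel 'I_n) (adj : 'I_n -> seq 'I_n) (w : nat).
Hypothesis adjP : adjacency_lists e adj.
Hypothesis w_ok : word_size_ok 6 n w.

Definition has_input (s : state) :=
  [/\ var s vN = n, var s vK = k,
      forall i, i <= n -> arr s aOff i = off adj i
    & forall (u : 'I_n) j, j < size (adj u) ->
        arr s aNbr (off adj u + j) = nth u (adj u) j].

Lemma has_input0 : has_input (input k adj).
Proof.
split=> //= [i li|u j lj].
  by rewrite (nth_map 0) ?size_iota ?ltnS // nth_iota ?ltnS.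
have -> : off adj u = \sum_(s <- take u [seq [seq val v | v <- adj u] | u <- enum 'I_n]) size s.
  rewrite -map_take big_map /off.
  under [RHS]eq_bigr do rewrite size_map.
  have e1 : take u (enum 'I_n) = [seq v <- enum 'I_n | val v < u].
    apply: (inj_map val_inj); rewrite map_take val_enum_ord.
    rewrite -(filter_map val (fun v => v < u)) val_enum_ord take_iota.
    have -> : minn u n = u by apply/minn_idPl/ltnW.
    have -> : iota 0 n = iota 0 (u + (n - u)) by rewrite subnKC // ltnW.
    rewrite iotaD filter_cat (_ : filter _ (iota 0 u) = iota 0 u).
      rewrite [X in _ = _ ++ X](_ : _ = [::]) ?cats0 //.
      apply/eqP; rewrite -(negbK (_ == _)) -has_filter; apply/hasPn => v.
      by rewrite mem_iota add0n -leqNgt => /andP[].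
    by apply/all_filterP/allP => v; rewrite mem_iota.
  by rewrite e1 big_filter big_enum_cond /=; apply: eq_bigl.
have lu : u < size (enum 'I_n) by rewrite size_enum_ord.
have nthE : nth [::] [seq [seq val v | v <- adj x] | x <- enum 'I_n] u = [seq val v | v <- adj u].
  by rewrite (nth_map u) // nth_ord_enum.
rewrite /neighbours nth_flatten_sum ?nthE ?size_map //.
  exact: (nth_map u).
by rewrite -enumT.
Qed.

Lemma has_input_keep vs As s s' :
  keep vs As s s' -> 0 \notin vs -> 1 \notin vs -> 0 \notin As -> 1 \notin As ->
  has_input s -> has_input s'.
Proof.
by move=> [kv ka] v0 v1 a0 a1 [s0 s1 h0 h1]; split; rewrite ?kv ?ka.
Qed.

Lemma big_adj (u : 'I_n) (g : 'I_n -> nat) :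
  \sum_(v <- adj u) g v = \sum_(v | e u v) g v.
Proof. by have [un m] := adjP u; rewrite big_uniq //; apply: eq_bigl. Qed.

Lemma size_adj_le u : size (adj u) <= n.
Proof. by have [un _] := adjP u; rewrite -(card_uniqP un) -[n in _ <= n]card_ord max_card. Qed.

Lemma off_le i : off adj i <= n * n.
Proof.
apply: (@leq_trans (\sum_(u < n) n)); last by rewrite sum_nat_const card_ord.
by rewrite /off [leqRHS](bigID (fun u : 'I_n => u < i)) /=; apply/leq_trans/leq_addr;
  apply: leq_sum => u _; apply: size_adj_le.
Qed.

Lemma offS (u : 'I_n) : off adj u.+1 = off adj u + size (adj u).
Proof.
rewrite /off (bigD1 u) //= addnC; congr (_ + _); apply: eq_bigl => v.
by rewrite ltnS ltn_neqAle andbC.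
Qed.

Lemma sum_deg c d : \sum_(i < n) (c * size (adj i) + d) = c * off adj n + d * n.
Proof.
rewrite big_split /= -big_distrr /= sum_nat_const card_ord [n * d]mulnC.
by congr (_ * _ + _); apply: eq_bigl => i; rewrite ltn_ord.
Qed.

Lemma word_gt1 : 1 < cap w.
Proof. rewrite /cap; apply: leq_trans w_ok; rewrite !expnS; nia. Qed.

Lemma word_ge3 : n.+2 * n.+2 * n.+2 * n.+2 <= cap w.
Proof.
rewrite /cap; apply: leq_trans w_ok; rewrite -!mulnA -[X in _ * (_ * (_ * X))]expn1 -!expnS.
by rewrite leq_pexp2l.
Qed.

(** The largest values that occur are stack and list addresses, at most n^2 + 2n, and shifted table
    entries, at most n^2 + 4n + 1. All lie below (n + 2)^2. *)
Lemma word_gt2 : n.+2 * n.+2 < cap w.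
Proof. apply: leq_trans word_ge3; nia. Qed.

Lemma word_gtn : n.+2 < cap w.
Proof. apply: leq_trans word_gt2; nia. Qed.

Lemma runs_adj body s (u : 'I_n) (I : seq 'I_n -> state -> Prop) B T
    (kk := keep [:: vI, vE, vV & wvars body] (warrs body)) :
  has_input s -> var s vU = u ->
  all (fun x => x \notin wvars body) [:: vN; vK; vU; vI; vE; vV] ->
  all (fun A => A \notin warrs body) [:: aOff; aNbr] ->
  (forall i z, I [::] (set_var (set_var s vI i) vE z)) ->
  (forall l v r s1, adj u = l ++ v :: r -> kk s s1 -> I l s1 ->
     let s2 := set_var s1 vV v in
     runs w body s2 B (fun s3 => keep (wvars body) (warrs body) s2 s3 ->
       I (rcons l v) (set_var s3 vI (var s3 vI).+1))) ->
  (B + 20) * size (adj u) + 20 <= T ->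
  runs w (ForAdj body) s T (fun s' => I (adj u) s' /\ kk s s').
Proof.
move=> hs su /and5P[b0 b1 bu bi /and3P[be bv _]] /and3P[ba0 ba1 _] I0 step lT.
have w1 := word_gt1; have wn := word_gtn; have wn2 := word_gt2.
have [_ _ hoff hnb] := hs; have lun := ltn_ord u.
have oS := offS u; have ole := off_le u.+1.
have oS1 : arr s aOff u = off adj u by rewrite hoff // ltnW.
have oS2 : arr s aOff u.+1 = off adj u.+1 by rewrite hoff.
apply: (@runs_seq _ _ _ _ 3 (T - 4)); last by slia.
apply: runs_simple => //= _; rewrite su oS1.
apply: (@runs_seq _ _ _ _ 5 (T - 10)); last by slia.
apply: runs_simple => //=; first by rewrite su w1; slia.
move=> _; rewrite su addn1 oS2.
set s0 := set_var _ _ _.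
have k0 : kk s s0.
  by do 2![apply: keep_varS; rewrite ?inE //]; apply: keep_refl.
pose J l s1 := [/\ kk s s1, exists r, adj u = l ++ r, var s1 vI = off adj u + size l,
   var s1 vE = off adj u.+1 & I l s1].
pose Phi (l : seq 'I_n) := (B + 15) * (size (adj u) - size l).
have J0 : J [::] s0 by split=> //=; [exists (adj u) | rewrite addn0 | apply: I0].
apply: (@runs_mono _ _ _ (Phi [::] + 4) _ (fun s' => ev s' ($vI < $vE)%X = 0
   /\ exists g', J g' s')) => //.
- apply: (@runs_while _ _ _ _ (seq 'I_n) J Phi [::]) => //.
  move=> l s1 [k1 [r adjE] i1 e1 I1] /=; rewrite i1 e1 oS adjE size_cat => ne0.
  case: r adjE ne0 => [|v r] adjE ne0; first by rewrite addn0 ltnn in ne0.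
  have sl : size (adj u) - size l = (size (adj u) - (size l).+1).+1.
    by rewrite adjE size_cat /=; slia.
  exists (B + 10); first by rewrite /Phi sl mulnS /=; move: (_ * _) => z; slia.
  have [in0 _ _ hnb1] : has_input s1.
    by apply: has_input_keep k1 _ _ _ _ hs => //; rewrite !inE !negb_or //=.
  have vE1 : arr s1 aNbr (off adj u + size l) = v.
    rewrite hnb1 ?adjE ?size_cat /=; last by slia.
    by rewrite nth_cat ltnn subnn.
  apply: (@runs_seq _ _ _ _ 3 (B + 6)); last by slia.
  apply: runs_simple => //= _; rewrite i1 vE1.
  apply: (@runs_seq _ _ _ _ B 5); last by slia.
  apply: runs_mono (step l v r s1 adjE k1 I1) _ _ => // s3 k3 I3 _.
  have i3 : var s3 vI = off adj u + size l by case: k3 => kv _; rewrite kv.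
  have e3 : var s3 vE = off adj u.+1 by case: k3 => kv _; rewrite kv.
  have bnd : off adj u + size l < off adj u.+1.
    by rewrite oS adjE size_cat /=; slia.
  apply: runs_simple => //=; first by rewrite i3 w1 /=; slia.
  move=> _; exists (rcons l v).
    by rewrite /Phi size_rcons sl mulnS /=; move: (_ * _) => z; slia.
  split=> //=.
  + apply: keep_varS; first by rewrite !inE.
    apply: (@keep_trans _ _ _ (set_var s1 vV v)); first by apply: keep_varS; rewrite ?inE.
    by apply: keep_sub k3 => // x xb; rewrite !inE xb !orbT.
  + by exists r; rewrite adjE cat_rcons.
  + by rewrite size_rcons i3; slia.
  + by rewrite addn1; apply: I3.
- by rewrite /Phi subn0 /=; slia.
move=> s' _ [/= + [l [k1 [r adjE] i1 e1 I1]]]; rewrite i1 e1 oS adjE size_cat.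
case: r adjE => [|v r] adjE; last by rewrite ltn_add2l addnS ltnS leq_addr.
by rewrite cats0.
Qed.

(** Summands 0 and 1 keep each partial sum below the length of the list, hence at most n, so the
    accumulator does not overflow. *)
Lemma runs_sum a s (u : 'I_n) (g : 'I_n -> nat) T :
  has_input s -> var s vU = u ->
  (forall s', keep [:: vI; vE; vV; vF] [::] s s' -> forall v : 'I_n, var s' vV = v ->
     [/\ fits (cap w) s' a, ev s' a = g v & g v <= 1]) ->
  (cost a + 25) * size (adj u) + 30 <= T ->
  runs w (SumAdj a) s T (fun s' => var s' vF = \sum_(v | e u v) g v).
Proof.
move=> hs su ga lT; have w1 := word_gt1; have w0 := ltnW w1; have wn := word_gtn.
apply: (@runs_seq _ _ _ _ 2 (T - 5)); last by slia.
apply: runs_simple => //= _.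
set s0 := set_var _ _ _.
have hs0 : has_input s0 by [].
pose I l s1 := var s1 vF = \sum_(v <- l) g v.
apply: (runs_mono (runs_adj (I := I) (B := cost a + 4) hs0 su _ _ _ _ (leqnn _))) => //.
- by move=> i z; rewrite /I big_nil.
- move=> l v r s1 adjE k1 I1 /=.
  have k2 x : keep [:: vI; vE; vV; vF] [::] s (set_var s1 vV x).
    apply: keep_varS => //; have k1' : keep [:: vI; vE; vV; vF] [::] s0 s1 := k1.
    by apply: keep_trans k1'; apply: keep_set_var; rewrite !inE.
  have [fa ea g1]  := ga _ (k2 v) v (erefl _).
  have lb : \sum_(v <- l) g v <= n.
    apply: (@leq_trans (size l)); last first.
      by apply: leq_trans (size_adj_le u); rewrite adjE size_cat leq_addr.
    elim: l {adjE I1} => [|x l IH]; first by rewrite big_nil.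
    rewrite big_cons /= -add1n leq_add //.
    by have [_ _] := ga _ (k2 x) x (erefl _).
  apply: runs_simple => //=.
  + by rewrite fa ea /= /I in I1 *; rewrite I1; slia.
  + by rewrite /=; slia.
  + by move=> _; rewrite /I /= -cats1 big_cat big_seq1 -ea -I1.
- by rewrite /=; slia.
by move=> s' _ [-> _]; rewrite big_adj.
Qed.

End Adjacency.

(** * Twin classes by partition refinement *)

Notation vNext := 7 (only parsing).
Notation vLab := 8 (only parsing).
Notation aCls := 3 (only parsing).
Notation aStamp := 4 (only parsing).
Notation aNew := 5 (only parsing).

(* A label not yet seen in the round of [u] gets a fresh successor label, which is then
   shared by all closed neighbours of [u] carrying the old label. *)
Definition Relabel : cmd :=
  vLab ::= Get aCls $vV ;;
  If (Get aStamp $vLab == $vU + 1)%X Skip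
    (Put aStamp $vLab ($vU + 1)%X ;; Put aNew $vLab $vNext ;; vNext ::= $vNext + 1) ;;
  Put aCls $vV (Get aNew $vLab).

Definition Refine : cmd :=
  vNext ::= 1 ;; For vU vN (vV ::= $vU ;; Relabel ;; ForAdj Relabel).

Section Refine.
Variables (n k : nat) (e : rel 'I_n) (adj : 'I_n -> seq 'I_n) (w : nat).
Hypothesis e_sym : symmetric e.
Hypothesis e_irr : irreflexive e.
Hypothesis adjP : adjacency_lists e adj.
Hypothesis w_ok : word_size_ok 6 n w.

(* State in the middle of the refinement by [closed_nbhd e u]: the vertices of
   [P] have been relabelled, [c0] is the old labelling. *)
Definition refining (c0 : nat -> nat) x0 (u : nat) (P : {set 'I_n}) (s : state) :=
  [/\ forall a, a \in P -> arr s aStamp (c0 a) = u.+1 /\ arr s aCls a = arr s aNew (c0 a),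
      forall a : 'I_n, a \notin P -> arr s aCls a = c0 a,
      forall L, arr s aStamp L = u.+1 -> x0 <= arr s aNew L < var s vNext,
      forall L L', arr s aStamp L = u.+1 -> arr s aStamp L' = u.+1 ->
        arr s aNew L = arr s aNew L' -> L = L'
    & [/\ forall L, arr s aStamp L <= u.+1, x0 <= var s vNext &
        var s vNext <= x0 + #|P|]].

Lemma runs_relabel c0 x0 (u : nat) (P : {set 'I_n}) (a : 'I_n) s :
  u < n -> x0 + n < cap w -> a \notin P -> var s vU = u -> var s vV = a ->
  refining c0 x0 u P s ->
  runs w Relabel s 40 (refining c0 x0 u (a |: P)).
Proof.
move=> un xw aP su sv [inP outP rng inj [stl x0n nx]].
have w1 := word_gt1 w_ok; have w0 := ltnW w1; have wn := word_gtn w_ok.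
have cA : #|a |: P| = #|P|.+1 by rewrite cardsU1 aP.
have cP : #|P|.+1 <= n by rewrite -cA -[n in _ <= n]card_ord max_card.
have u1 : u.+1 < cap w by slia.
have nw : (var s vNext).+1 < cap w by slia.
rewrite /Relabel; simple_run; rewrite /= su sv outP // !addn1.
  by rewrite w1 u1 /=; case: (_ =P u.+1) => /= _; rewrite ?su ?addn1 ?u1 ?w1 ?nw.
case: (arr s aStamp (c0 a) =P u.+1) => /= E; rewrite sv.
- have neq b : b != a -> (b : nat) == a = false by move=> h; apply/negbTE.
  split=> //=.
  + move=> b; rewrite !inE; case: (eqVneq b a) => [-> _|ba /= bP].
      by rewrite eqxx.
    by rewrite neq //; apply: inP.
  + move=> b; rewrite !inE negb_or => /andP[ba bP]; rewrite neq //; exact: outP.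
  + by split=> //; rewrite cA; slia.
have neq b : b != a -> (b : nat) == a = false by move=> h; apply/negbTE.
have cE b : b \in P -> c0 b == c0 a = false.
  by move=> bP; apply/eqP => cc; case: E; rewrite -cc; case: (inP b bP).
split=> //=.
+ move=> b; rewrite !inE; case: (eqVneq b a) => [-> _|ba /= bP].
    by rewrite !eqxx.
  by rewrite neq //= cE //=; apply: inP.
+ move=> b; rewrite !inE negb_or => /andP[ba bP]; rewrite neq //; exact: outP.
+ move=> L; case: (L =P c0 a) => [_ _|_] /=; first by rewrite x0n ltnSn.
  by move=> /rng /andP[-> /= h]; apply: leqW.
+ move=> L L'; case: (L =P c0 a) => [->|nL]; case: (L' =P c0 a) => [->|nL'] //=; last exact: inj.
    by move=> _ /rng + h; rewrite -h ltnn andbF.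
  by move=> /rng + _ h; rewrite h ltnn andbF.
split=> [L||]; last by rewrite cA; slia.
  by case: ifP.
by apply: leqW.
Qed.

(** Labels are never reused. The round of [u] creates at most deg u + 1 of them, one per element of
    its closed neighbourhood, which is why they stay within a word without renumbering. *)
Definition refined (u : nat) (s : state) :=
  [/\ forall a b : 'I_n, (arr s aCls a == arr s aCls b) =
        [forall x : 'I_n, (x < u) ==> ((a \in closed_nbhd e x) == (b \in closed_nbhd e x))],
      forall a : 'I_n, arr s aCls a < var s vNext,
      forall L, arr s aStamp L <= u
    & var s vNext <= 1 + u + off adj u].

Lemma refining0 (u : nat) s : refined u s ->
  refining (arr s aCls) (var s vNext) u set0 s.
Proof.
move=> [_ cn st _]; split=> //.
- by move=> a; rewrite inE.
- by move=> L E; have := st L; rewrite E ltnn.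
- by move=> L L' E; have := st L; rewrite E ltnn.
by split; rewrite ?leq_addr // => L; apply: leqW.
Qed.

(** Relabelled vertices have labels from the old [vNext] upwards, all others stay below it. So
    labels separate the two sides of the split by [closed_nbhd e u], and within a side equality of
    labels is inherited. *)
Lemma refinedS (u : 'I_n) s s' : refined u s ->
  refining (arr s aCls) (var s vNext) u (closed_nbhd e u) s' -> refined u.+1 s'.
Proof.
move=> [cE cn st nx] [inP outP rng inj [stl x0n nx']]; split=> //.
- move=> a b; have -> : [forall x : 'I_n, (x < u.+1) ==>
      ((a \in closed_nbhd e x) == (b \in closed_nbhd e x))] =
      ((a \in closed_nbhd e u) == (b \in closed_nbhd e u)) && (arr s aCls a == arr s aCls b).
    rewrite cE; apply/forallP/andP => [H|[H1 /forallP H2] x].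
      split; first by have := H u; rewrite ltnSn.
      by apply/forallP => x; apply/implyP => xu; have := H x; rewrite ltnS ltnW.
    apply/implyP; rewrite ltnS leq_eqVlt => /orP[/eqP/val_inj ->//|xu].
    by have := H2 x; rewrite xu.
  have diff x y : x \in closed_nbhd e u -> y \notin closed_nbhd e u ->
      (arr s' aCls x == arr s' aCls y) = false.
    move=> xP yP; have [sx ->] := inP x xP; rewrite outP //.
    apply/eqP => h; have /andP[+ _] := rng _ sx; rewrite h.
    by have := cn y; case: ltngtP.
  case aP: (a \in _); case bP: (b \in _) => /=.
  + have [sa ->] := inP a aP; have [sb ->] := inP b bP.
    by apply/eqP/eqP => [/inj->//|->].
  + by rewrite diff ?bP.
  + by rewrite eq_sym diff ?aP.
  by rewrite !outP ?aP ?bP.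
- move=> a; case: (boolP (a \in closed_nbhd e u)) => aP.
    by have [sa ->] := inP a aP; have /andP[] := rng _ sa.
  by rewrite outP //; apply: leq_trans x0n; apply: cn.
rewrite offS; have -> : size (adj u) = #|closed_nbhd e u|.-1; last first.
  have : 0 < #|closed_nbhd e u| by apply/card_gt0P; exists u; rewrite inE eqxx.
  by move: nx' nx; set z := #|_|; clear; slia.
have [un m] := adjP u.
rewrite -(card_uniqP un) (cardD1 u) inE eqxx /=.
apply: eq_card => x; rewrite !inE m.
by case: eqP => //= ->; rewrite -topredE /= e_irr.
Qed.

(** By symmetry of [e], two vertices lie in the same closed neighbourhoods exactly when their own
    closed neighbourhoods are equal. *)
Lemma runs_refine s :
  has_input k adj s -> (forall i, arr s aCls i = 0) -> (forall i, arr s aStamp i = 0) ->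
  runs w Refine s (100 * (n + off adj n) + 100)
    (fun s' => forall a b : 'I_n, (arr s' aCls a == arr s' aCls b) =
        (closed_nbhd e a == closed_nbhd e b)).
Proof.
move=> hs c0 st0; have w1 := word_gt1 w_ok; have w0 := ltnW w1.
have wn := word_gtn w_ok; have wn2 := word_gt2 w_ok.
apply: (@runs_seq _ _ _ _ 2 (100 * (n + off adj n) + 50)); last by slia.
apply: runs_simple => //= _; set s0 := set_var _ _ _.
have hs0 : has_input k adj s0 by apply: hs.
have sumE : \sum_(i < n) ((60 * size (adj i) + 80) + 10) = 60 * off adj n + 90 * n.
  by under eq_bigr do rewrite -addnA; rewrite sum_deg.
apply: (runs_mono (runs_for (N := n) (I := refined)
   (B := fun i => 60 * size (adj i) + 80) w1 _ _ _ _ _ _ (leqnn _))) => //.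
- by slia.
- by case: hs.
- split=> //= a; rewrite ?c0 ?st0 //.
  + by move=> b; rewrite !c0 eqxx; apply/esym/forallP => x.
- move=> u s1 k1 u1 r1.
  have hs1 : has_input k adj s1 by apply: has_input_keep k1 _ _ _ _ hs0.
  have lun := ltn_ord u; have ole := off_le adjP u; have [_ _ _ nx] := r1.
  have xw : var s1 vNext + n < cap w.
    by move: wn2 ole nx lun; clear; nia.
  apply: (@runs_seq _ _ _ _ 2 (60 * size (adj u) + 76)); last by slia.
  apply: runs_simple => //= _; rewrite u1; set s2 := set_var _ _ _.
  apply: (@runs_seq _ _ _ _ 40 (60 * size (adj u) + 30)); last by slia.
  have r2 : refining (arr s1 aCls) (var s1 vNext) u set0 s2 by apply: refining0 r1.
  apply: runs_mono (runs_relabel (a := u) _ _ _ _ _ r2) _ _; rewrite ?inE //.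
  move=> s3 k3 r3 k3'.
  have u3 : var s3 vU = u by case: k3 => kv _; rewrite kv.
  have hs3 : has_input k adj s3 by apply: has_input_keep k3 _ _ _ _ _.
  apply: (runs_mono (runs_adj (I := fun l => refining (arr s1 aCls) (var s1 vNext) u [set x in u
    :: l])
    (B := 40) adjP w_ok hs3 u3 _ _ _ _ (leqnn _))) => //.
  + move=> i z; rewrite (_ : [set x in [:: u]] = u |: set0); first exact: r3.
    by apply/setP => x; rewrite !inE orbF.
  + move=> l v r s4 adjE k4 r4 /=.
    have [un m] := adjP u.
    (* Relabelling a vertex twice in one round would destroy its old label; the list of [u] has no
       repetition and does not contain [u]. *)
    have vl : v \notin [set x in u :: l].
      rewrite !inE negb_or; apply/andP; split.
        apply/eqP => vu; have : v \in adj u by rewrite adjE mem_cat inE eqxx orbT.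
        by rewrite m -topredE /= vu e_irr.
      by move: un; rewrite adjE cat_uniq => /and3P[_ + _]; apply: contra => vl; rewrite /= vl.
    have u4 : var s4 vU = u by case: k4 => kv _; rewrite kv.
    have r4' : refining (arr s1 aCls) (var s1 vNext) u [set x in u :: l] (set_var s4 vV v) by
      exact: r4.
    apply: runs_mono (runs_relabel (a := v) _ _ vl _ _ r4') _ _ => // s5 k5 r5 _.
    rewrite (_ : [set x in u :: rcons l v] = v |: [set x in u :: l]); first exact: r5.
    by apply/setP => x; rewrite !inE mem_rcons inE orbCA.
  + by slia.
  move=> s4 k4 [r4 _] k4'.
  have r5 : refining (arr s1 aCls) (var s1 vNext) u (closed_nbhd e u) s4.
    rewrite (_ : closed_nbhd e u = [set x in u :: adj u]) //.
    by apply/setP => x; have [_ m] := adjP u; rewrite !inE m.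
  exact: (refinedS r1 r5).
- by rewrite sumE; slia.
move=> s' _ [[cE _ _ _] _] a b; rewrite cE.
apply/forallP/eqP => [H|H x].
  apply/setP => x; have := H x; rewrite ltn_ord !inE => /eqP.
  by rewrite ![_ == x]eq_sym ![e x _]e_sym.
have := congr1 (fun A : {set 'I_n} => x \in A) H; rewrite !inE => E.
by rewrite ltn_ord ![_ == x]eq_sym ![e x _]e_sym E eqxx.
Qed.
End Refine.

(** * Branching for minimum vertex covers *)

(* Integer substitutes for [68 * sqrt 2 ^ x] and [60 * sqrt 2 ^ x], as 24/17 and 21/15 are
   close to the square root of 2.  They bound the size of a search tree with remaining
   budget [x - 4], the second one when some vertex has degree 1 or 2. *)
Definition general_size (x : nat) := 4 * (if odd x then 24 else 17) * 2 ^ x./2.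
Definition low_size (x : nat) := 4 * (if odd x then 21 else 15) * 2 ^ x./2.

Lemma general_size_mono x y : x <= y -> general_size x <= general_size y.
Proof.
move=> /subnK <-; elim: (y - x) => // i; rewrite addSn => IH; apply: leq_trans IH _.
rewrite /general_size; move: (_ + _) => z; rewrite /= uphalf_half.
by case: (odd z); rewrite /= ?add0n ?add1n ?expnS; slia.
Qed.

Lemma low_general x : low_size x <= general_size x.
Proof. by rewrite /low_size /general_size; case: odd; slia. Qed.

(** With x = b + 2(j + 2), the halved exponents of x - 1, ..., x - 4 all reduce to multiples of
    [2 ^ j], which leaves linear inequalities. *)
Lemma halves x : 4 <= x -> exists (j : nat) (b : bool), x = b + (j.+2).*2.
Proof.
move=> x4; exists (x./2 - 2), (odd x).
have := odd_double_half x; slia.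
Qed.

Ltac size_bound :=
  let j := fresh "j" in let b := fresh "b" in let z := fresh "z" in
  move=> /halves [j [b ->]]; rewrite /low_size /general_size; case: b;
  rewrite /= ?add0n ?add1n ?add2n ?subSS ?subn0 /= ?odd_double ?doubleK ?uphalf_double
     /= ?odd_double ?doubleK ?uphalf_double /= ?expnS;
  have := expn_gt0 2 j; move: (2 ^ j) => z; slia.

(** Recurrences of the search tree, with 1 for the node itself: a single child; a low pivot whose
    children add two and at least three vertices; a pivot of degree at least 4; a pivot of degree 3
    in a cubic residual graph, whose child adding one vertex is charged [low_size]. *)
Lemma size_single x : 4 <= x -> 1 + general_size (x - 1) <= low_size x.
Proof. size_bound. Qed.

Lemma size_low x : 4 <= x -> 1 + general_size (x - 2) + general_size (x - 3) <= low_size x.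
Proof. size_bound. Qed.

Lemma size_high x : 4 <= x -> 1 + general_size (x - 1) + general_size (x - 4) <= general_size x.
Proof. size_bound. Qed.

Lemma size_cubic x : 4 <= x -> 1 + low_size (x - 1) + general_size (x - 3) <= general_size x.
Proof. size_bound. Qed.

(** The growth ratio is about the square root of 2, and 1 / (1 - 1/sqrt 2) < 4. Restarting the
    search for each budget thus costs a constant factor only. *)
Lemma sum_general_size x : \sum_(i < x.+1) general_size i <= 4 * general_size x.
Proof.
elim: x => [|x IH]; first by rewrite big_ord_recr big_ord0.
rewrite big_ord_recr /=; apply: leq_trans (_ : 4 * general_size x + general_size x.+1 <= _).
  by rewrite leq_add2r.
rewrite /general_size /= uphalf_half.
by case: (odd x); rewrite /= ?add0n ?add1n ?expnS; move: (2 ^ _) => z; slia.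
Qed.

(** * Pivot branching in the residual graph *)

Section VertexCover.
Variables (T : finType) (h : rel T).
Hypothesis h_sym : symmetric h.
Hypothesis h_irr : irreflexive h.

Definition vcover (D : {set T}) : bool :=
  [forall u, forall v, h u v ==> ((u \in D) || (v \in D))].

Lemma vcoverP (D : {set T}) :
  reflect (forall u v, h u v -> (u \in D) || (v \in D)) (vcover D).
Proof.
apply: (iffP forallP) => [H u v|H u]; first by have /forallP/(_ v)/implyP := H u.
by apply/forallP => v; apply/implyP/H.
Qed.

(** Neighbourhood of [A] in the residual graph, where the partial cover [C] has been deleted. *)
Definition resnb (C A : {set T}) : {set T} :=
  [set u | (u \notin C) && [exists a in A, h a u]].

Lemma resnbP (C A : {set T}) u :
  reflect (u \notin C /\ exists2 a, a \in A & h a u) (u \in resnb C A).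
Proof.
rewrite inE; apply: (iffP andP) => -[uC H]; split=> //.
  by have /existsP[a /andP[aA ha]] := H; exists a.
by have [a aA ha] := H; apply/existsP; exists a; rewrite aA.
Qed.

Definition rdeg (C : {set T}) v := if v \in C then 0 else #|resnb C [set v]|.

Lemma resnb1 (C : {set T}) u v : (u \in resnb C [set v]) = (u \notin C) && h v u.
Proof.
apply/resnbP/andP => -[uC]; first by case=> a; rewrite inE => /eqP ->.
by move=> huv; split=> //; exists v; rewrite ?inE.
Qed.

Lemma rdeg_gt0 (C : {set T}) v : 0 < rdeg C v -> v \notin C.
Proof. by rewrite /rdeg; case: ifP. Qed.

Lemma rdegE (C : {set T}) v : v \notin C -> rdeg C v = #|resnb C [set v]|.
Proof. by rewrite /rdeg => /negbTE ->. Qed.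

Lemma vcover_rdeg0 (C : {set T}) : (forall v, rdeg C v = 0) -> vcover C.
Proof.
move=> H; apply/vcoverP => u v huv; apply/orP.
case: (boolP (u \in C)) => uC; [by left|right]; apply/negPn/negP => vC.
have := H u; rewrite rdegE // => /eqP; rewrite cards_eq0 => /eqP/setP/(_ v).
by rewrite resnb1 vC huv inE.
Qed.

Definition ext B (C : {set T}) := exists D, [/\ vcover D, C \subset D & #|D| <= B].

Definition low C := [exists v, 0 < rdeg C v < 3].

(** The offset 4 keeps the argument at least 4 while [C] is within the budget, so the subtractions
    in the recurrences do not truncate. Children over the budget still have positive weight. *)
Definition weight B (C : {set T}) :=
  if low C then low_size (B + 4 - #|C|) else general_size (B + 4 - #|C|).

Lemma weight_le B (C : {set T}) x : B + 4 - #|C| <= x -> weight B C <= general_size x.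
Proof.
move=> l; apply: leq_trans (general_size_mono l); rewrite /weight.
by case: ifP => // _; apply: low_general.
Qed.

(** If [p] has degree 2, a cover that contains one of its neighbours can be made to contain both, so
    one branches between both neighbours and neither. In the latter case [p] itself belongs to
    [pivB]. *)
Definition pivA (C : {set T}) p := if rdeg C p == 2 then resnb C [set p] else [set p].
Definition pivB (C : {set T}) p := resnb C (pivA C p).

Section Pivot.
Variables (C : {set T}) (p : T).
Hypothesis p_pos : 0 < rdeg C p.

Let pC : p \notin C := rdeg_gt0 p_pos.
Let N := resnb C [set p].

Lemma card_resnb : #|N| = rdeg C p.
Proof. by rewrite rdegE. Qed.

Lemma pivAC : [disjoint pivA C p & C].
Proof.
rewrite disjoint_subset; apply/subsetP => x; rewrite /pivA; case: ifP => _.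
  by move=> /resnbP[xC _]; rewrite inE.
by rewrite !inE => /eqP ->.
Qed.

Lemma pivBC : [disjoint pivB C p & C].
Proof. by rewrite disjoint_subset; apply/subsetP => x /resnbP[xC _]; rewrite inE. Qed.

Lemma card_pivA : #|C :|: pivA C p| = #|C| + (if rdeg C p == 2 then 2 else 1).
Proof.
have := pivAC; rewrite disjoint_sym -setI_eq0 => /eqP d.
rewrite cardsU d cards0 subn0; congr (_ + _); rewrite /pivA.
by case: eqP => [<-|_]; rewrite ?cards1 ?card_resnb.
Qed.

Lemma card_pivB : #|C :|: pivB C p| = #|C| + #|pivB C p|.
Proof.
have := pivBC; rewrite disjoint_sym -setI_eq0 => /eqP d.
by rewrite cardsU d cards0 subn0.
Qed.

Lemma pivB_gt0 : 0 < #|pivB C p|.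
Proof.
have : 0 < #|N| by rewrite card_resnb.
case/card_gt0P => a aN; apply/card_gt0P.
move: (aN); rewrite resnb1 => /andP[aC ha].
rewrite /pivB /pivA; case: ifP => _; last by exists a.
by exists p; apply/resnbP; split=> //; exists a; rewrite // h_sym.
Qed.

Lemma pivB_high : 2 < rdeg C p -> #|pivB C p| = rdeg C p.
Proof. by move=> d; rewrite /pivB /pivA ifN ?card_resnb //; apply/eqP; slia. Qed.

(** Edges leaving the missed set [A] force their other ends into the cover. *)
Lemma ext_meet (A : {set T}) B D :
  [disjoint A & C] -> vcover D -> C \subset D -> #|D| <= B ->
  A :&: D = set0 -> ext B (C :|: resnb C A).
Proof.
move=> AC /vcoverP cD CD lD d; exists D; split=> //; first exact/vcoverP.
rewrite subUset CD; apply/subsetP => u /resnbP[uC [a aA ha]].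
have := cD _ _ ha; case: (boolP (a \in D)) => // aD.
by have := in_set0 a; rewrite -d inE aA aD.
Qed.

(* If [D] misses exactly one neighbour of [p], it contains [p], and [p] can be exchanged
   for that neighbour. *)
Lemma ext_swap B D : vcover D -> C \subset D -> #|D| <= B ->
  #|N :\: D| <= 1 -> ext B (C :|: N).
Proof.
move=> /vcoverP cD CD lD d1.
case: (set_0Vmem (N :\: D)) => [/eqP|[a aN]].
  by rewrite setD_eq0 => ND; exists D; split=> //; [apply/vcoverP|rewrite subUset CD].
have [aD aN'] : a \notin D /\ a \in N by move: aN; rewrite inE => /andP[].
have pD : p \in D.
  by move: aN'; rewrite resnb1 => /andP[_ /cD]; rewrite (negbTE aD) orbF.
exists ((D :\ p) :|: N); split.
- apply/vcoverP => u v huv; rewrite !inE.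
  have key x y : h x y -> x \in D -> (x != p) || (y \in D :\ p) || (y \in N).
    move=> hxy xD; case: eqP => //= xp; rewrite xp in hxy.
    case: (boolP (y \in C)) => yC; last by rewrite resnb1 yC hxy orbT.
    rewrite !inE (subsetP CD _ yC) andbT; have -> // : y != p.
    by apply: contraTneq hxy => ->; rewrite h_irr.
  case/orP: (cD _ _ huv) => xD.
    have := key _ _ huv xD; rewrite xD !inE -!orbA.
    by case: (u != p) => //= /orP[->|->]; rewrite ?orbT.
  have := key v u; rewrite h_sym huv xD => /(_ isT isT); rewrite !inE -!orbA.
  by case: (v != p) => /=; rewrite ?orbT //; case/orP => ->; rewrite ?orbT.
- apply/subsetP => x; rewrite !inE => /orP[xC|->]; last by rewrite orbT.
  by rewrite (subsetP CD) // andbT; have -> // : x != p by apply: contraTneq xC => ->.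
(* Removing [p] pays for the at most one neighbour outside [D]. *)
have -> : (D :\ p) :|: N = (D :\ p) :|: (N :\: D).
  have pN : p \notin N by rewrite resnb1 h_irr andbF.
  apply/setP => x; rewrite !(in_setU, in_setD, in_set1); case: (x =P p) => [->|_] /=.
    by rewrite (negbTE pN) andbF.
  by case: (x \in D).
by rewrite cardsU; move: (cardsD1 p D); rewrite pD; slia.
Qed.

(* A cover missing all of [pivA] contains [pivB]; when [p] has two neighbours and [pivB] at
   most two elements, [pivA] can be exchanged for [pivB] in any cover. *)
Lemma branch_ext B :
  ext B C -> ext B (C :|: pivB C p) \/ 2 < #|pivB C p| /\ ext B (C :|: pivA C p).
Proof.
move=> [D [cD CD lD]]; have dA := pivAC.
have cN := card_resnb.
have [d2|d2] := eqVneq (rdeg C p) 2; last first.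
  have Apiv : pivA C p = [set p] by rewrite /pivA (negbTE d2).
  have [pD|pD] := boolP (p \in D); last first.
    left; apply: (ext_meet dA cD CD lD); apply/eqP; rewrite setI_eq0 Apiv.
    by rewrite disjoints1.
  have [lt|gt] := leqP (rdeg C p) 2.
    have d1 : rdeg C p = 1 by slia.
    left; rewrite /pivB Apiv; apply: (ext_swap cD CD lD).
    by apply: leq_trans (subset_leq_card (subsetDl _ _)) _; rewrite cN d1.
  right; rewrite pivB_high //; split=> //; exists D; split=> //.
  by rewrite Apiv subUset CD sub1set.
have Apiv : pivA C p = N by rewrite /pivA d2.
case: (set_0Vmem (N :&: D)) => [d0|[a aND]].
  by left; apply: (ext_meet dA cD CD lD); rewrite Apiv.
have extN : ext B (C :|: N).
  apply: (ext_swap cD CD lD); have := cardsID D N; rewrite cN d2.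
  have : 0 < #|N :&: D| by apply/card_gt0P; exists a.
  by slia.
have [lt|gt] := ltnP 2 #|pivB C p|; first by right; rewrite Apiv.
left; have [E [/vcoverP cE CNE lE]] := extN.
move: CNE; rewrite subUset => /andP[CE NE].
have Bdef : pivB C p = resnb C N by rewrite /pivB Apiv.
(* Edges at [N] end in [C] or in [pivB]. The size does not grow: [N] has two elements, [pivB] at
   most two. *)
exists ((E :\: N) :|: pivB C p); split.
- apply/vcoverP => u v huv.
  have key x y : h x y -> x \in E -> (x \in (E :\: N) :|: pivB C p) || (y \in (E :\: N) :|: pivB
    C p).
    move=> hxy xE; case: (boolP (x \in N)) => xN; last by rewrite in_setU in_setD xE xN.
    case: (boolP (y \in C)) => yC.
      have yN : y \notin N by rewrite resnb1 yC.
      by apply/orP; right; rewrite in_setU in_setD yN (subsetP CE).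
    apply/orP; right; rewrite in_setU; apply/orP; right; rewrite Bdef.
    by apply/resnbP; split=> //; exists x.
  by case/orP: (cE _ _ huv) => xE; [apply: key|rewrite orbC; apply: key; rewrite // h_sym].
- rewrite subUset subsetUr andbT; apply/subsetP => x xC; rewrite in_setU in_setD (subsetP CE) //.
  by rewrite resnb1 xC.
rewrite cardsU cardsD (setIidPr NE) cN d2; apply: leq_trans (leq_subr _ _) _.
have := subset_leq_card NE; rewrite cN d2; slia.
Qed.

(** With no residual degree 1 or 2 and maximum 3, all non-isolated vertices have degree 3. Deleting
    [p] lowers its neighbours to degree 2. *)
Lemma low_setU1 : ~~ low C -> (forall u, rdeg C u <= rdeg C p) -> rdeg C p = 3 ->
  low (C :|: [set p]).
Proof.
move=> nl mx d3; have : 0 < #|N| by rewrite card_resnb d3.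
case/card_gt0P => a aN; move: (aN); rewrite resnb1 => /andP[aC ha].
have ap : a != p by apply: contraTneq ha => ->; rewrite h_irr.
apply/existsP; exists a.
have pa : p \in resnb C [set a] by rewrite resnb1 pC h_sym.
have da : rdeg C a = 3.
  apply/eqP; rewrite eqn_leq -{1}d3 mx /= ltnNge; apply/negP => le2.
  move/negP: nl; apply; apply/existsP; exists a; rewrite ltnS le2 andbT.
  by rewrite rdegE //; apply/card_gt0P; exists p.
rewrite rdegE ?inE ?negb_or ?aC //.
have -> : resnb (C :|: [set p]) [set a] = resnb C [set a] :\ p.
  by apply/setP => x; rewrite in_setD1 !resnb1 !inE negb_or; case: (x \in C); case: (x == p).
by move: (cardsD1 p (resnb C [set a])); rewrite pa -rdegE // da; slia.
Qed.

(** This inequality makes the total weight of the stack a potential: replacing a node by its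
    children releases at least one unit. The recurrence used depends on whether the pivot is low and
    whether the second child survives. *)
Lemma branch_weight B : #|C| <= B -> (low C -> rdeg C p < 3) ->
  (~~ low C -> forall u, rdeg C u <= rdeg C p) ->
  1 + weight B (C :|: pivB C p) + (2 < #|pivB C p|) * weight B (C :|: pivA C p)
    <= weight B C.
Proof.
move=> CB lp hp; set x := B + 4 - #|C|.
have x4 : 4 <= x by rewrite /x; slia.
have wB i : i <= #|pivB C p| -> weight B (C :|: pivB C p) <= general_size (x - i).
  by move=> li; apply: weight_le; rewrite card_pivB /x; slia.
have wA : weight B (C :|: pivA C p) <= general_size (x - (if rdeg C p == 2 then 2 else 1)).
  by apply: weight_le; rewrite card_pivA /x; slia.
have b0 := pivB_gt0.
have [lC|nlC] := boolP (low C).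
  have wC : weight B C = low_size x by rewrite /weight lC.
  have d3 := lp lC; rewrite wC.
  have [le2|gt2] := leqP #|pivB C p| 2.
    by rewrite mul0n addn0; apply: leq_trans (size_single x4); rewrite leq_add2l; apply: wB.
  (* Two children at a low pivot mean degree 2, as for degree 1 [pivB] is a single vertex. *)
  have d2 : rdeg C p = 2.
    case: (eqVneq (rdeg C p) 2) => // d2; move: gt2.
    by rewrite /pivB /pivA (negbTE d2) card_resnb; slia.
  move: wA; rewrite d2 eqxx mul1n => wA; have w3 := wB 3 gt2.
  by apply: leq_trans (size_low x4); slia.
have wC : weight B C = general_size x by rewrite /weight (negbTE nlC).
have d3 : 2 < rdeg C p.
  rewrite ltnNge; apply/negP => le2; move/negP: nlC; apply; apply/existsP; exists p.
  by rewrite p_pos ltnS.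
have bE := pivB_high d3; rewrite wC bE d3 mul1n.
have d2 : (rdeg C p == 2) = false by apply/eqP; slia.
rewrite d2 in wA; have [d4|d4] := ltnP 3 (rdeg C p).
  have := wB 4; rewrite bE => /(_ d4) w4; apply: leq_trans (size_high x4); slia.
have e3 : rdeg C p = 3 by slia.
have := wB 3; rewrite bE => /(_ d3) w3.
have lA := low_setU1 nlC (hp nlC) e3.
have -> : weight B (C :|: pivA C p) = low_size (x - 1).
  rewrite /weight /pivA d2 lA /x; congr low_size.
  by have := card_pivA; rewrite /pivA d2 => ->; slia.
by apply: leq_trans (size_cubic x4); slia.
Qed.

End Pivot.
End VertexCover.

(** * Searching for a minimum twin cover *)

Notation vB := 9 (only parsing).
Notation vSp := 10 (only parsing).
Notation vFound := 11 (only parsing).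
Notation vBase := 12 (only parsing).
Notation vCnt := 13 (only parsing).
Notation vSc := 14 (only parsing).
Notation vPiv := 15 (only parsing).
Notation vPd := 16 (only parsing).
Notation vG := 17 (only parsing).
Notation vNb := 18 (only parsing).
Notation vBase' := 19 (only parsing).
Notation aStk := 6 (only parsing).
Notation aMA := 7 (only parsing).
Notation aMB := 8 (only parsing).

Definition NonTwin : expr := ((Get aCls $vU == Get aCls $vV) == 0)%X.

(* Adding [n] to degrees 1 and 2 gives them priority over all larger degrees. *)
Definition Scan : cmd :=
  vCnt ::= 0 ;; vSc ::= 0 ;;
  For vU vN (
    SumAdj ((Get aStk ($vBase + $vV) == 0) * NonTwin) ;;
    If (Get aStk ($vBase + $vU)%X) (vF ::= 0 ;; vCnt ::= $vCnt + 1) Skip ;;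
    vG ::= $vF ;;
    If ((0 < $vF) * ($vF < 3))%X (vG ::= $vF + $vN) Skip ;;
    If ($vSc < $vG)%X (vSc ::= $vG ;; vPiv ::= $vU ;; vPd ::= $vF) Skip).

Definition Nbr : cmd :=
  vNb ::= 0 ;;
  For vU vN (
    SumAdj (Get aMA $vV * NonTwin) ;;
    Put aMB $vU ((0 < $vF) * (Get aStk ($vBase + $vU) == 0))%X ;;
    vNb ::= $vNb + Get aMB $vU).

(* The stack is a two-dimensional array with rows of length [n], one per pending partial
   cover; the second child is dropped when its sibling adds at most two vertices. *)
Definition Branch : cmd :=
  For vU vN (Put aMA $vU ($vU == $vPiv)%X) ;; Nbr ;;
  If ($vPd == 2)%X (For vU vN (Put aMA $vU (Get aMB $vU)) ;; Nbr) Skip ;;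
  vBase' ::= $vBase + $vN ;;
  For vU vN (
    Put aStk ($vBase' + $vU)%X (Get aStk ($vBase + $vU) + Get aMA $vU)%X ;;
    Put aStk ($vBase + $vU)%X (Get aStk ($vBase + $vU) + Get aMB $vU)%X) ;;
  vSp ::= $vSp + 1 + (2 < $vNb).

Definition Step : cmd :=
  If $vSp
    (vSp ::= $vSp - 1 ;; vBase ::= $vSp * $vN ;; Scan ;;
     If ($vB < $vCnt)%X Skip (If $vSc Branch (vFound ::= 1)))
    (vB ::= $vB + 1 ;; vSp ::= 1 ;; For vU vN (Put aStk $vU 0)).

Definition Search : cmd :=
  vB ::= 0 ;; vSp ::= 1 ;; vFound ::= 0 ;; While ($vFound == 0)%X Step.

Definition nontwin (T : finType) (e : rel T) : rel T :=
  fun u v => e u v && (closed_nbhd e u != closed_nbhd e v).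

Section Search.
Variables (n k : nat) (e : rel 'I_n) (adj : 'I_n -> seq 'I_n) (w : nat).
Hypothesis e_sym : symmetric e.
Hypothesis e_irr : irreflexive e.
Hypothesis adjP : adjacency_lists e adj.
Hypothesis w_ok : word_size_ok 6 n w.

Let h := nontwin e.
Let M := off adj n.

Lemma nontwin_sym : symmetric h.
Proof. by move=> u v; rewrite /h /nontwin e_sym eq_sym. Qed.

Lemma nontwin_irr : irreflexive h.
Proof. by move=> u; rewrite /h /nontwin e_irr. Qed.

Definition has_classes (s : state) :=
  forall a b : 'I_n, (arr s aCls a == arr s aCls b) = (closed_nbhd e a == closed_nbhd e b).

Definition stores (f : nat -> nat) (b : nat) (C : {set 'I_n}) :=
  forall v : 'I_n, f (b + v) = (v \in C).

Definition score (C : {set 'I_n}) u := rdeg h C u + (0 < rdeg h C u < 3) * n.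

Lemma card_prefixS (R : {set 'I_n}) (u : 'I_n) :
  #|[set v in R | v < u.+1]| = #|[set v in R | v < u]| + (u \in R).
Proof.
rewrite (cardsD1 u) !inE ltnSn andbT addnC; congr (_ + _); apply: eq_card => v.
rewrite !inE ltnS leq_eqVlt (inj_eq val_inj); case: eqP => //= ->.
by rewrite ltnn andbF.
Qed.

Lemma runs_scan s b (C : {set 'I_n}) :
  has_input k adj s -> has_classes s -> var s vBase = b -> b <= n * n ->
  stores (arr s aStk) b C ->
  runs w Scan s (100 * (n + M) + 30) (fun s' =>
    [/\ var s' vCnt = #|C|, forall u, score C u <= var s' vSc
      & var s' vSc != 0 -> exists p : 'I_n,
          [/\ var s' vPiv = p, score C p = var s' vSc & var s' vPd = rdeg h C p]]).
Proof.
move=> hs cl sb lb st; have w1 := word_gt1 w_ok; have w0 := ltnW w1.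
have wn := word_gtn w_ok; have wn2 := word_gt2 w_ok.
have w3 : 3 < cap w by slia.
have bw u : u < n -> b + u < cap w by move=> un; move: wn2 lb un; clear; nia.
apply: (@runs_seq _ _ _ _ 2 (100 * (n + M) + 26)); last by slia.
simple_run; rewrite //= => _.
apply: (@runs_seq _ _ _ _ 2 (100 * (n + M) + 23)); last by slia.
simple_run; rewrite //= => _.
set s0 := set_var _ _ _.
pose I (u : nat) s' := [/\ var s' vCnt = #|[set v in C | v < u]|,
  forall v : 'I_n, v < u -> score C v <= var s' vSc
  & var s' vSc != 0 -> exists p : 'I_n,
     [/\ var s' vPiv = p, score C p = var s' vSc & var s' vPd = rdeg h C p]].
apply: (runs_mono (runs_for (N := n) (I := I)
   (B := fun i => 45 * size (adj i) + 80) w1 _ _ _ _ _ _ (leqnn _))) => //.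
- by slia.
- by case: hs.
- split=> //=; symmetry; apply/eqP; rewrite cards_eq0; apply/eqP/setP => v.
  by rewrite !inE andbF.
- move=> u s1 k1 u1 [c1 m1 p1].
  have hs1 : has_input k adj s1 by apply: has_input_keep k1 _ _ _ _ _.
  have cl1 : has_classes s1 by move=> a a'; rewrite (k1.2 aCls isT); apply: cl.
  have b1 : var s1 vBase = b by rewrite (k1.1 vBase isT).
  have st1 : stores (arr s1 aStk) b C by move=> v; rewrite (k1.2 aStk isT); apply: st.
  have lun := ltn_ord u.
  apply: (@runs_seq _ _ _ _ (45 * size (adj u) + 30) 49); last by slia.
  apply: (runs_mono (runs_sum (T := 45 * size (adj u) + 30) (g := fun v => (v \notin C) &&
    (closed_nbhd e u != closed_nbhd e v)) adjP w_ok hs1 u1 _ _)) => //.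
    move=> s2 k2 v sv /=; rewrite (k2.1 vBase isT) sv (k2.1 vU isT) u1 b1 (k2.2 aStk isT) st1
      (k2.2 aCls isT).
    have := cl1 u v => ->; rewrite bw ?w0 //= leq_b1 !eqb0 mulnb; split=> //.
    by case: (_ && _).
    by apply: leq_add => //; apply: leq_mul.
  move=> s2 k2 F2 _.
  have FE : var s2 vF = #|resnb h C [set u]|.
    rewrite F2 -sum1_card big_mkcond [RHS]big_mkcond; apply: eq_bigr => v _.
    rewrite resnb1 /h /nontwin; case: (e u v); rewrite ?andbF //=.
  have FE' : (if u \in C then 0 else var s2 vF) = rdeg h C u by rewrite /rdeg FE.
  have Fle : var s2 vF <= n by rewrite FE -[n in _ <= n]card_ord max_card.
  have cle : #|[set v in C | v < u]| < n.+1.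
    by rewrite ltnS -[n in _ <= n]card_ord max_card.
  have u2 : var s2 vU = u by rewrite (k2.1 vU isT).
  have n2 : var s2 vN = n by rewrite (k2.1 vN isT); case: hs1.
  have c2 : var s2 vCnt = #|[set v in C | v < u]| by rewrite (k2.1 vCnt isT).
  have s2E : arr s2 aStk (var s2 vBase + var s2 vU) = (u \in C).
    by rewrite (k2.2 aStk isT) (k2.1 vBase isT) b1 u2 st1.
  rewrite -(k2.1 vSc isT) -(k2.1 vPiv isT) -(k2.1 vPd isT) in m1 p1.
  have bu := bw u lun; have b2 : var s2 vBase = b by rewrite (k2.1 vBase isT).
  pose g := score C u.
  (* The conditionals before the last test are summarised by one state [s3], so the update of the
     maximum is analysed once for all their paths. *)
  suff : fitsp (cap w) (If (Get aStk ($vBase + $vU)) (vF ::= 0 ;; vCnt ::= $vCnt + 1) Skip ;;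
    vG ::= $vF ;;
    If ((0 < $vF) * ($vF < 3)) (vG ::= $vF + $vN) Skip ;;
    If ($vSc < $vG) (vSc ::= $vG ;; vPiv ::= $vU ;; vPd ::= $vF) Skip) s2 /\
    exists s3, run (If (Get aStk ($vBase + $vU)) (vF ::= 0 ;; vCnt ::= $vCnt + 1) Skip ;;
    vG ::= $vF ;;
    If ((0 < $vF) * ($vF < 3)) (vG ::= $vF + $vN) Skip ;;
    If ($vSc < $vG) (vSc ::= $vG ;; vPiv ::= $vU ;; vPd ::= $vF) Skip) s2 =
      (if var s2 vSc < g then
        set_var (set_var (set_var s3 vSc g) vPiv u) vPd (rdeg h C u) else s3) /\
      keep [:: vF; vCnt; vG] [::] s2 s3 /\ var s3 vCnt = var s2 vCnt + (u \in C).
    move=> [fp [s3 [rE [k3 c3]]]]; simple_run => // k4; rewrite rE /I card_prefixS -c2.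
    have m3 : forall v : 'I_n, v < u -> score C v <= maxn (var s2 vSc) g.
      by move=> v vu; rewrite leq_max m1.
    case: ltnP => lg /=; split=> //=.
    + move=> v; rewrite ltnS leq_eqVlt => /orP[/eqP/val_inj -> //|vu].
      by apply: leq_trans (m1 v vu) (ltnW lg).
    + by move=> _; exists u.
    + rewrite (k3.1 vSc isT) => v; rewrite ltnS leq_eqVlt => /orP[/eqP/val_inj -> //|vu].
      by apply: m1.
    + by rewrite (k3.1 vSc isT) (k3.1 vPiv isT) (k3.1 vPd isT).
  rewrite /g /score -FE'; move: s2E.
  have f2 : var s2 vF + n < cap w by move: wn2 Fle; clear; nia.
  have c2' : var s2 vCnt + 1 < cap w by slia.
  have b2' : var s2 vBase + u < cap w by rewrite b2.
  case uC: (u \in C) => s2E.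
    rewrite /= s2E /= u2 b2' !w0 w3 c2' /=.
    split; first by rewrite w1.
    by eexists; split; [reflexivity|split; first do !apply: keep_varS => //].
  rewrite /= s2E /= n2 u2 b2' !w0 w3 /= mulnb f2 (leq_ltn_trans (leq_b1 _) w1) /= eqb0 negbK.
  case: (0 < var s2 vF < 3); rewrite /= ?mul1n ?mul0n ?addn0 ?n2 eqb0 negbK u2.
    split; first by case: (_ < _).
    by eexists; split; [case: (_ < _); reflexivity|split; first do !apply: keep_varS => //].
  split; first by case: (_ < _).
  by eexists; split; [case: (_ < _); reflexivity|split; first do !apply: keep_varS => //].
- under eq_bigr do rewrite -addnA; rewrite sum_deg /M; slia.
move=> s' _ [[c1 m1 p1] _]; split=> //; last by move=> u; apply: m1.
by rewrite c1; apply: eq_card => v; rewrite inE ltn_ord andbT.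
Qed.

Lemma runs_nbr s b (C A : {set 'I_n}) :
  has_input k adj s -> has_classes s -> var s vBase = b -> b <= n * n ->
  stores (arr s aStk) b C -> stores (arr s aMA) 0 A ->
  runs w Nbr s (100 * (n + M) + 30) (fun s' =>
    stores (arr s' aMB) 0 (resnb h C A) /\ var s' vNb = #|resnb h C A|).
Proof.
move=> hs cl sb lb st sA; have w1 := word_gt1 w_ok; have w0 := ltnW w1.
have wn := word_gtn w_ok; have wn2 := word_gt2 w_ok.
have bw u : u < n -> b + u < cap w by move=> un; move: wn2 lb un; clear; nia.
apply: (@runs_seq _ _ _ _ 2 (100 * (n + M) + 26)); last by slia.
simple_run; rewrite //= => _; set s0 := set_var _ _ _.
pose I (u : nat) s' := var s' vNb = #|[set v in resnb h C A | v < u]| /\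
  forall v : 'I_n, v < u -> arr s' aMB v = (v \in resnb h C A).
apply: (runs_mono (runs_for (N := n) (I := I)
   (B := fun i => 45 * size (adj i) + 60) w1 _ _ _ _ _ _ (leqnn _))) => //.
- by slia.
- by case: hs.
- split=> //=; symmetry; apply/eqP; rewrite cards_eq0; apply/eqP/setP => v.
  by rewrite in_set !in_set0 andbF.
- move=> u s1 k1 u1 [c1 m1].
  have hs1 : has_input k adj s1 by apply: has_input_keep k1 _ _ _ _ _.
  have cl1 : has_classes s1 by move=> a a'; rewrite (k1.2 aCls isT); apply: cl.
  have b1 : var s1 vBase = b by rewrite (k1.1 vBase isT).
  have st1 : stores (arr s1 aStk) b C by move=> v; rewrite (k1.2 aStk isT); apply: st.
  have sA1 : stores (arr s1 aMA) 0 A by move=> v; rewrite (k1.2 aMA isT); apply: sA.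
  have lun := ltn_ord u.
  apply: (@runs_seq _ _ _ _ (45 * size (adj u) + 30) 29); last by slia.
  apply: (runs_mono (runs_sum (T := 45 * size (adj u) + 30) (g := fun v => (v \in A) &&
    (closed_nbhd e u != closed_nbhd e v)) adjP w_ok hs1 u1 _ _)) => //.
    move=> s2 k2 v sv /=; rewrite sv (k2.1 vU isT) u1 (k2.2 aMA isT) (sA1 v) (k2.2 aCls isT).
    have := cl1 u v => ->; rewrite ?w0 //= leq_b1 !eqb0 mulnb; split=> //.
    by case: (_ && _).
    by apply: leq_add => //; apply: leq_mul.
  move=> s2 k2 F2 _.
  have FE : (0 < var s2 vF) && (u \notin C) = (u \in resnb h C A).
    rewrite F2 lt0n sum_nat_eq0 negb_forall; apply/andP/resnbP => -[].
      move=> /existsP[v]; rewrite negb_imply eqb0 negbK => /andP[euv /andP[vA cc]] uC.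
      by split=> //; exists v; rewrite // nontwin_sym /h /nontwin euv.
    move=> uC [v vA]; rewrite nontwin_sym /h /nontwin => /andP[euv cc].
    by split=> //; apply/existsP; exists v; rewrite euv vA cc.
  have cle : #|[set v in resnb h C A | v < u]| < n.+1.
    by rewrite ltnS -[n in _ <= n]card_ord max_card.
  have u2 : var s2 vU = u by rewrite (k2.1 vU isT).
  have c2 : var s2 vNb = #|[set v in resnb h C A | v < u]| by rewrite (k2.1 vNb isT).
  have s2E : arr s2 aStk (var s2 vBase + u) = (u \in C).
    by rewrite (k2.2 aStk isT) (k2.1 vBase isT) b1 st1.
  have bu := bw u lun; have b2 : var s2 vBase = b by rewrite (k2.1 vBase isT).
  simple_run; rewrite /= u2 s2E eqb0 mulnb FE ?eqxx /=.
    rewrite b2 bu w0 c2 /= (leq_ltn_trans (leq_b1 _) w1) /=.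
    by apply: leq_ltn_trans (leq_add (ltnSE cle) (leq_b1 _)) _; slia.
  move=> _; split=> /=; first by rewrite c2 card_prefixS.
  move=> v; case: (v =P u :> nat) => [/val_inj -> //|/eqP vu].
  by rewrite ltnS leq_eqVlt (negbTE vu) (k2.2 aMB isT) /=; apply: m1.
- under eq_bigr do rewrite -addnA; rewrite sum_deg /M; slia.
move=> s' _ [[c1 m1] _]; split=> //; last first.
  by rewrite c1; apply: eq_card => v; rewrite in_set ltn_ord andbT.
by move=> v; apply: m1.
Qed.

Lemma runs_branch s b sp (C : {set 'I_n}) (p : 'I_n) :
  has_input k adj s -> has_classes s -> var s vBase = b -> b <= n * n ->
  stores (arr s aStk) b C -> 0 < rdeg h C p ->
  var s vPiv = p -> var s vPd = rdeg h C p -> var s vSp = sp -> sp <= n ->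
  runs w Branch s (400 * (n + M) + 300) (fun s' =>
    [/\ stores (arr s' aStk) b (C :|: pivB h C p),
        stores (arr s' aStk) (b + n) (C :|: pivA h C p),
        forall j, j < b -> arr s' aStk j = arr s aStk j
      & var s' vSp = sp + 1 + (2 < #|pivB h C p|)]).
Proof.
move=> hs cl sb lb st dp pE dE spE spn; have w1 := word_gt1 w_ok; have w0 := ltnW w1.
have wn := word_gtn w_ok; have wn2 := word_gt2 w_ok.
have w3 : 2 < cap w by slia.
have bw u : u < n -> b + n + u < cap w by move=> un; move: wn2 lb un; clear; nia.
have bw' u : u < n -> b + u < cap w by move=> un; move: wn2 lb un; clear; nia.
have lbn : b + n < cap w by move: wn2 lb; clear; nia.
apply: (@runs_seq _ _ _ _ (20 * n + 10) (400 * (n + M) + 280 - 20 * n)); last by slia.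
apply: (runs_mono (runs_for (N := n) (B := fun=> 10)
   (I := fun u s' => forall v : 'I_n, v < u -> arr s' aMA v = (v == p)) w1 _ _ _ _ _ _ (leqnn
     _))) => //.
- by slia.
- by case: hs.
- move=> u s1 k1 u1 I1; simple_run; rewrite /= ?u1 ?(k1.1 vPiv isT) ?pE //= => _ v.
  rewrite ltnS leq_eqVlt (inj_eq val_inj); case: (eqVneq v u) => [->|vu /= ltu].
    by [].
  by apply: I1.
- by rewrite sum_nat_const card_ord; slia.
move=> s1 k1 [A1 _] _.
have hs1 : has_input k adj s1 by apply: has_input_keep k1 _ _ _ _ _.
have cl1 : has_classes s1 by move=> a a'; rewrite (k1.2 aCls isT); apply: cl.
have b1 : var s1 vBase = b by rewrite (k1.1 vBase isT).
have st1 : stores (arr s1 aStk) b C by move=> v; rewrite (k1.2 aStk isT); apply: st.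
have A1' : stores (arr s1 aMA) 0 [set p] by move=> v; rewrite A1 ?inE.
apply: (@runs_seq _ _ _ _ (100 * (n + M) + 30) (300 * (n + M) + 240 - 20 * n)); last by slia.
apply: (runs_mono (runs_nbr hs1 cl1 b1 lb st1 A1')) => // s2 k2 [B2 nb2] _.
have pd2 : var s2 vPd = rdeg h C p by rewrite (k2.1 vPd isT) (k1.1 vPd isT).
apply: (@runs_seq _ _ _ _ (100 * (n + M) + 20 * n + 60) (200 * (n + M) + 170 - 40 * n)); last by
  slia.
apply: (@runs_mono _ _ _ (100 * (n + M) + 20 * n + 60) _ (fun s3 => [/\ stores (arr s3 aMA) 0
  (pivA h C p),
   stores (arr s3 aMB) 0 (pivB h C p) & var s3 vNb = #|pivB h C p|])) => //.
- have hs2 : has_input k adj s2 by apply: has_input_keep k2 _ _ _ _ _.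
  have cl2 : has_classes s2 by move=> a a'; rewrite (k2.2 aCls isT); apply: cl1.
  have b2 : var s2 vBase = b by rewrite (k2.1 vBase isT).
  have st2 : stores (arr s2 aStk) b C by move=> v; rewrite (k2.2 aStk isT); apply: st1.
  apply: (@runs_if _ _ _ _ _ (100 * (n + M) + 20 * n + 50)) => //=.
  + rewrite pd2 => d2.
    apply: (@runs_seq _ _ _ _ (20 * n + 10) (100 * (n + M) + 30)); last by slia.
    apply: (runs_mono (runs_for (N := n) (B := fun=> 10)
       (I := fun u s' => forall v : 'I_n, v < u -> arr s' aMA v = arr s2 aMB v) w1 _ _ _ _ _ _
         (leqnn _))) => //.
    * by slia.
    * by case: hs2.
    * move=> u s3 k3 u3 I3; simple_run; rewrite /= ?u3 // => _ v.
      rewrite (k3.2 aMB isT) ltnS leq_eqVlt; case: (eqVneq (v : nat) u) => [->|vu /= ltu] //.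
      exact: I3.
    * by rewrite sum_nat_const card_ord; slia.
    move=> s3 k3 [A3 _] _.
    have dE2 : rdeg h C p == 2 by move: d2; case: (_ == 2).
    have pA : pivA h C p = resnb h C [set p] by rewrite /pivA dE2.
    have hs3 : has_input k adj s3 by apply: has_input_keep k3 _ _ _ _ _.
    have cl3 : has_classes s3 by move=> a a'; rewrite (k3.2 aCls isT); apply: cl2.
    have b3 : var s3 vBase = b by rewrite (k3.1 vBase isT).
    have st3 : stores (arr s3 aStk) b C by move=> v; rewrite (k3.2 aStk isT); apply: st2.
    have A3' : stores (arr s3 aMA) 0 (pivA h C p) by move=> v; rewrite A3 ?pA //; apply: B2.
    apply: (runs_mono (runs_nbr hs3 cl3 b3 lb st3 A3')) => // s4 k4 [B4 nb4].
    by split=> //; move=> v; rewrite (k4.2 aMA isT).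
  + rewrite pd2 => /eqP; rewrite eqb0 => d2.
    have pA : pivA h C p = [set p] by rewrite /pivA (negbTE d2).
    apply: runs_simple => //=; first by slia.
    rewrite /pivB pA; split=> //.
    by move=> v; rewrite (k2.2 aMA isT).
  by slia.
move=> s3 k3 [A3 B3 nb3] _.
have b3 : var s3 vBase = b by rewrite (k3.1 vBase isT) (k2.1 vBase isT).
have n3 : var s3 vN = n by rewrite (k3.1 vN isT) (k2.1 vN isT); case: hs1.
have st3 : arr s3 aStk = arr s aStk by rewrite (k3.2 aStk isT) (k2.2 aStk isT) (k1.2 aStk isT).
apply: (@runs_seq _ _ _ _ 4 (200 * (n + M) + 160 - 40 * n)); last by slia.
simple_run; rewrite /= b3 n3 // => _; set s4 := set_var _ _ _.
apply: (@runs_seq _ _ _ _ (50 * n + 10) 20); last by slia.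
pose I (u : nat) s' := [/\
   forall v : 'I_n, v < u -> arr s' aStk (b + v) = (v \in C :|: pivB h C p),
   forall v : 'I_n, v < u -> arr s' aStk (b + n + v) = (v \in C :|: pivA h C p),
   forall v : 'I_n, u <= v -> arr s' aStk (b + v) = (v \in C)
   & forall j, j < b -> arr s' aStk j = arr s aStk j].
apply: (runs_mono (runs_for (N := n) (B := fun=> 40)
       (I := I) w1 _ _ _ _ _ _ (leqnn _))) => //.
- by slia.
- by split=> // [v _|j _]; rewrite /= st3 //; apply: st.
- move=> u s5 k5 u5 [B5 A5 C5 O5].
  have b5 : var s5 vBase = b by rewrite (k5.1 vBase isT).
  have b5' : var s5 vBase' = b + n by rewrite (k5.1 vBase' isT).
  have mA : arr s5 aMA u = (u \in pivA h C p) by rewrite (k5.2 aMA isT) /=; apply: A3.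
  have mB : arr s5 aMB u = (u \in pivB h C p) by rewrite (k5.2 aMB isT) /=; apply: B3.
  (* Stack rows are characteristic vectors. The added set is disjoint from [C], so addition computes
     the union. *)
  have dA : (u \in C) + (u \in pivA h C p) = (u \in C :|: pivA h C p).
    rewrite in_setU; case: (boolP (u \in C)) => uC //=.
    by rewrite (disjointFl (pivAC dp) uC).
  have dB : (u \in C) + (u \in pivB h C p) = (u \in C :|: pivB h C p).
    rewrite in_setU; case: (boolP (u \in C)) => uC //=.
    by rewrite (disjointFl (pivBC h C p) uC).
  have nE : b + u == b + n + u = false by have := ltn_ord u; slia.
  have bt (x : bool) : x < cap w by case: x.
  simple_run; rewrite /= u5 b5 b5' C5 // mA mB nE dA dB.
    by rewrite bw // bw' // !bt.
  move=> _; split=> /=.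
  + move=> v; rewrite ltnS leq_eqVlt (inj_eq val_inj); case: (eqVneq v u) => [->|vu /= ltu].
      by rewrite eqxx.
    rewrite eqn_add2l (inj_eq val_inj) (negbTE vu).
    have -> : (b + v == b + n + u) = false by have := ltn_ord v; slia.
    exact: B5.
  + move=> v; have -> : (b + n + v == b + u) = false by have := ltn_ord u; slia.
    rewrite ltnS leq_eqVlt eqn_add2l (inj_eq val_inj).
    by case: (eqVneq v u) => [->|vu /= ltu] //; apply: A5.
  + move=> v ltu; have -> : (b + v == b + u) = false by slia.
    have -> : (b + v == b + n + u) = false by have := ltn_ord v; slia.
    by apply: C5; apply: ltnW.
  + move=> j jb; have -> : (j == b + u) = false by slia.
    have -> : (j == b + n + u) = false by slia.
    exact: O5.
- by rewrite sum_nat_const card_ord; slia.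
move=> s5 k5 [[B5 A5 _ O5] _] _.
have sp5 : var s5 vSp = sp by rewrite (k5.1 vSp isT) /= (k3.1 vSp isT) (k2.1 vSp isT) (k1.1 vSp
  isT).
have nb5 : var s5 vNb = #|pivB h C p| by rewrite (k5.1 vNb isT).
have spw : sp + 1 + (2 < #|pivB h C p|) < cap w by case: (2 < _); slia.
simple_run; rewrite /= sp5 nb5.
  by rewrite w1 w3 spw /= andbT; slia.
by split=> //=; [move=> v; apply: B5 | move=> v; apply: A5].
Qed.


End Search.

Section Search.
Variables (n k : nat) (e : rel 'I_n) (adj : 'I_n -> seq 'I_n) (w : nat).
Hypothesis e_sym : symmetric e.
Hypothesis e_irr : irreflexive e.
Hypothesis adjP : adjacency_lists e adj.
Hypothesis w_ok : word_size_ok 6 n w.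

Local Notation h := (nontwin e).
Local Notation M := (off adj n).
(** Residual degrees are strictly below n, so the bonus n is decisive: a vertex of degree 1 or 2
    scores above n, every other one only its degree. *)
Lemma score_max (C : {set 'I_n}) p : (forall u, score e C u <= score e C p) -> score e C p != 0 ->
  [/\ 0 < rdeg h C p, low h C -> rdeg h C p < 3
    & ~~ low h C -> forall u, rdeg h C u <= rdeg h C p].
Proof.
move=> mx p0.
have dn u : rdeg h C u < n.
  rewrite /rdeg; case: ifP => _; first by apply: leq_ltn_trans (ltn_ord p).
  rewrite -[n in _ < n]card_ord; apply: proper_card; apply/properP; split; first exact:
    subset_predT.
  by exists u => //; rewrite resnb1 (nontwin_irr e_irr) andbF.
split.
- by move: p0; rewrite /score; case: (rdeg h C p).
- case/existsP => u lu; rewrite ltnNge; apply/negP => ge3.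
  have := mx u; rewrite /score lu [(0 < _ < 3)]andbC ltnNge ge3 mul1n mul0n addn0.
  by have := dn p; slia.
move=> nl u; have s0 v : score e C v = rdeg h C v.
  rewrite /score; case lv: (_ < _ < _); rewrite ?addn0 //.
  by case/negP: nl; apply/existsP; exists v.
by rewrite -!s0.
Qed.

Lemma twin_coverE X : twin_cover e X = vcover h X.
Proof.
apply: eq_forallb => u; apply: eq_forallb => v; rewrite /nontwin.
by case: (e u v) => //=; case: (_ == _); rewrite ?orbT ?orbF.
Qed.

Lemma tc_min X : vcover h X -> twin_cover_number e <= #|X|.
Proof.
rewrite -twin_coverE /twin_cover_number; case: arg_minnP => [|Y _ mY /mY //].
by apply/forallP => u; apply/forallP => v; rewrite inE implybT.
Qed.

Lemma tc_ext : ext h (twin_cover_number e) set0.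
Proof.
rewrite /twin_cover_number; case: arg_minnP => [|Y].
  by apply/forallP => u; apply/forallP => v; rewrite inE implybT.
by rewrite twin_coverE => cY _; exists Y; split=> //; apply: sub0set.
Qed.

Lemma tc_le_n : twin_cover_number e <= n.
Proof. by rewrite -[n in _ <= n]card_ord max_card. Qed.

Local Notation tc := (twin_cover_number e).
Local Notation step_time := (600 * (n + M) + 600).

Lemma weight_gt0 B (C : {set 'I_n}) : 0 < weight h B C.
Proof.
rewrite /weight /low_size /general_size; do 2!case: ifP => _; by rewrite muln_gt0 expn_gt0.
Qed.

(* The top of the stack [st] is its last element. *)
Definition searching (B : nat) (st : seq {set 'I_n}) (s : state) :=
  [/\ var s vB = B, var s vSp = size st, var s vFound = 0,
      (forall i, i < size st -> stores (arr s aStk) (i * n) (nth set0 st i))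
    & [/\ forall i, i < size st -> i <= #|nth set0 st i|,
        ext h B set0 -> exists2 C, C \in st & ext h B C & B <= tc]].

Definition found (s : state) :=
  exists X : {set 'I_n}, [/\ vcover h X, #|X| = tc, var s vB = tc, var s vFound = 1
    & stores (arr s aStk) (var s vBase) X /\ var s vBase <= n * n].

(** The ghost [None] marks the end of the search; otherwise the ghost is the current budget with the
    stack. *)
Definition search_inv (s0 : state) (g : option (nat * seq {set 'I_n})) s :=
  keep (wvars Step) (warrs Step) s0 s /\
  if g is Some (B, st) then searching B st s else found s.

(* Bounds the number of nodes still to be visited, including those of later rounds with a
   larger budget. *)
Definition potential B (st : seq {set 'I_n}) :=
  \sum_(C <- st) weight h B C + \sum_(B.+1 <= i < tc.+1) (1 + weight h i set0).

Definition search_time (g : option (nat * seq {set 'I_n})) :=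
  if g is Some (B, st) then (step_time + 4) * potential B st else 0.

Lemma ext_le B B' (C : {set 'I_n}) : B <= B' -> ext h B C -> ext h B' C.
Proof. by move=> BB [D [cD CD lD]]; exists D; split=> //; apply: leq_trans BB. Qed.

Lemma runs_root s0 B s :
  has_input k adj s0 -> search_inv s0 (Some (B, [::])) s ->
  runs w (vB ::= $vB + 1 ;; vSp ::= 1 ;; For vU vN (Put aStk $vU 0)) s (20 * n + 30)
   (fun s' => keep (wvars Step) (warrs Step) s s' ->
    search_inv s0 (Some (B.+1, [:: set0])) s' /\
    (potential B.+1 [:: set0]).+1 <= potential B [::]).
Proof.
move=> hs0 [K [sB sSp sF _ [_ eB lB]]].
have w1 := word_gt1 w_ok; have w0 := ltnW w1; have wn := word_gtn w_ok.
(* An empty stack refutes the existence of a cover of size [B], so the next budget is still at most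
   [tc]. *)
have ltB : B < tc.
  rewrite ltnNge; apply/negP => tB; have [C] := eB (ext_le tB tc_ext).
  by rewrite in_nil.
have := tc_le_n => tn.
apply: (@runs_seq _ _ _ _ 4 (20 * n + 20)); last by slia.
simple_run; rewrite /= sB; first by rewrite w1; slia.
move=> _; apply: (@runs_seq _ _ _ _ 2 (20 * n + 10)); last by slia.
simple_run; rewrite //= => _; set s1 := set_var _ _ _.
have n1 : var s1 vN = n by rewrite /s1 /= (K.1 vN isT); case: hs0.
apply: (runs_mono (runs_for (N := n) (B := fun=> 10)
   (I := fun u s' => forall v : 'I_n, v < u -> arr s' aStk v = 0) w1 _ n1 _ _ _ _ (leqnn _))) =>
     //.
- by slia.
- move=> u s2 k2 u2 I2; simple_run; rewrite /= ?u2 // => _ v.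
  by rewrite ltnS leq_eqVlt; case: eqVneq => // _ /= vu; apply: I2.
- by rewrite sum_nat_const card_ord; slia.
move=> s2 _ [A2 k2] k2'; split; last first.
  by rewrite /potential big_seq1 big_nil [leqRHS]big_ltn //; slia.
split; first by apply: keep_trans K k2'.
split; rewrite ?(k2.1 vB isT) ?(k2.1 vSp isT) ?(k2.1 vFound isT) //= ?addn1 //.
  by case=> // _ v /=; rewrite inE A2.
split=> //; first by case.
by move=> E; exists set0; rewrite ?inE.
Qed.

Lemma runs_pop s0 B st C s :
  has_input k adj s0 -> has_classes e s0 -> search_inv s0 (Some (B, rcons st C)) s ->
  runs w (vSp ::= $vSp - 1 ;; vBase ::= $vSp * $vN ;; Scan ;;
     If ($vB < $vCnt) Skip (If $vSc Branch (vFound ::= 1))) s (600 * (n + M) + 500)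
   (fun s' => keep (wvars Step) (warrs Step) s s' ->
    exists2 g, search_inv s0 g s' &
      if g is Some (B', st') then (potential B' st').+1 <= potential B (rcons st C) else True).
Proof.
move=> hs0 cl0 [K [sB sSp sF sS [sC eB lB]]].
have w1 := word_gt1 w_ok; have w0 := ltnW w1; have wn := word_gtn w_ok.
have wn2 := word_gt2 w_ok; have tn := tc_le_n.
have lCn : #|C| <= n by rewrite -[n in _ <= n]card_ord max_card.
rewrite size_rcons in sSp sS sC.
(* Row i holds a set of at least i vertices. This bounds the height of the stack and keeps row
   offsets within n^2. *)
have lst : size st <= #|C|.
  by have := sC (size st) (ltnSn _); rewrite nth_rcons ltnn eqxx.
have lb : size st * n <= n * n by rewrite leq_mul2r; apply/orP; right; apply: leq_trans lst lCn.
have potE : potential B (rcons st C) = potential B st + weight h B C.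
  by rewrite /potential big_rcons /= addnAC -!addnA; congr (_ + _); rewrite addnC.
have hs : has_input k adj s by apply: has_input_keep K _ _ _ _ _.
have ns : var s vN = n by case: hs.
have cl : has_classes e s by move=> a a'; rewrite (K.2 aCls isT); apply: cl0.
apply: (@runs_seq _ _ _ _ 4 (600 * (n + M) + 490)); last by slia.
simple_run; rewrite /= sSp subn1 /=; first by rewrite w1; slia.
move=> _; apply: (@runs_seq _ _ _ _ 4 (600 * (n + M) + 480)); last by slia.
simple_run; rewrite /= ns; first by move: wn2 lb; clear; nia.
move=> _; set s1 := set_var _ _ _.
have st1 : stores (arr s1 aStk) (size st * n) C.
  by have := sS (size st) (ltnSn _); rewrite nth_rcons ltnn eqxx.
have hs1 : has_input k adj s1 by apply: hs.
have cl1 : has_classes e s1 by apply: cl.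
apply: (@runs_seq _ _ _ _ (100 * (n + M) + 30) (500 * (n + M) + 440)); last by slia.
apply: (runs_mono (runs_scan adjP w_ok hs1 cl1 (erefl _) lb st1)) => // s2 k2 [c2 m2 p2] _.
have B2 : var s2 vB = B by rewrite (k2.1 vB isT).
have F2 : var s2 vFound = 0 by rewrite (k2.1 vFound isT).
have sp2 : var s2 vSp = size st by rewrite (k2.1 vSp isT).
have ba2 : var s2 vBase = size st * n by rewrite (k2.1 vBase isT).
have st2 : arr s2 aStk = arr s aStk by rewrite (k2.2 aStk isT).
have nthst i : i < size st -> nth set0 (rcons st C) i = nth set0 st i.
  by move=> li; rewrite nth_rcons li.
have wgt := weight_gt0 B C.
apply: (@runs_if _ _ _ _ _ (500 * (n + M) + 430)) => //=; last by slia.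
- rewrite B2 c2 => ltB; have {}ltB : B < #|C| by move: ltB; case: ltnP.
  apply: runs_simple => //=; first by slia.
  move=> k3; exists (Some (B, st)); last by rewrite potE; slia.
  split; first by apply: keep_trans K k3.
  split=> //; first by move=> i li; rewrite st2 -nthst //; apply: sS; apply: ltnW.
  split=> //; first by move=> i li; rewrite -nthst //; apply: sC; apply: ltnW.
  move=> /eB[C']; rewrite mem_rcons inE => /orP[/eqP ->|]; last by exists C'.
  by case=> D [_ CD lD]; have := leq_trans (subset_leq_card CD) lD; rewrite leqNgt ltB.
rewrite B2 c2 => leB; have {}leB : #|C| <= B by move: leB; case: ltnP.
apply: (@runs_if _ _ _ _ _ (500 * (n + M) + 420)) => //=; last by slia.
- move=> nz; have [p [p2' sp pd]] := p2 nz.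
  have mx u : score e C u <= score e C p by rewrite sp.
  have [dp lo hi] := score_max mx ltac:(by rewrite sp).
  have hs2 : has_input k adj s2 by apply: has_input_keep k2 _ _ _ _ _.
  have cl2 : has_classes e s2 by move=> a a'; rewrite (k2.2 aCls isT); apply: cl1.
  have st2' : stores (arr s2 aStk) (size st * n) C by rewrite st2.
  apply: (runs_mono (runs_branch e_sym adjP w_ok hs2 cl2 ba2 lb st2' dp p2' pd sp2 (leq_trans lst
    lCn))) => //.
    by slia.
  move=> s3 k3 [b3 a3 o3 sp3] k3'.
  pose st' := rcons st (C :|: pivB h C p) ++
    (if 2 < #|pivB h C p| then [:: C :|: pivA h C p] else [::]).
  have size' : size st' = size st + 1 + (2 < #|pivB h C p|).
    by rewrite size_cat size_rcons addn1; case: ifP.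
  have nth1 i : i < size st -> nth set0 st' i = nth set0 st i.
    by move=> li; rewrite nth_cat size_rcons ltnS ltnW // nth_rcons li.
  have nth2 : nth set0 st' (size st) = C :|: pivB h C p.
    by rewrite nth_cat size_rcons ltnSn nth_rcons ltnn eqxx.
  have nth3 : 2 < #|pivB h C p| -> nth set0 st' (size st).+1 = C :|: pivA h C p.
    by move=> lt; rewrite nth_cat size_rcons ltnn subnn lt.
  have cases i : i < size st' -> [\/ i < size st, i = size st | i = (size st).+1 /\ 2 < #|pivB h
    C p|].
    rewrite size'; case: (2 < _) => li; case: (ltngtP i (size st)) => ci;
      [by constructor 1| by constructor 3; split=> //; slia | by constructor 2
      |by constructor 1| by slia| by constructor 2].
  exists (Some (B, st')).
  + split; first by apply: keep_trans K k3'.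
    split; rewrite ?(k3.1 vB isT) ?(k3.1 vFound isT) ?sp3 ?size' //.
    * rewrite -size' => i /cases[li|->|[-> lt]].
      - rewrite nth1 // -nthst // => v; rewrite o3 ?st2; last first.
          by have := ltn_ord v; move: li; clear; nia.
        by apply: sS; apply: ltnW.
      - by rewrite nth2.
      - by rewrite nth3 // mulSn addnC.
    * rewrite -size'; split=> //.
      - move=> i /cases[li|->|[-> lt]].
        + by rewrite nth1 // -nthst //; apply: sC; apply: ltnW.
        + by rewrite nth2 card_pivB; apply: leq_trans lst (leq_addr _ _).
        + by rewrite nth3 // card_pivA //; move: lst; case: ifP => _; clear; slia.
      move=> /eB[C']; rewrite mem_rcons inE => /orP[/eqP ->|C'st eC'].
        case/(branch_ext (nontwin_sym e_sym) (nontwin_irr e_irr) dp) => [eB'|[lt eA]].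
          by exists (C :|: pivB h C p); rewrite // mem_cat mem_rcons inE eqxx.
        by exists (C :|: pivA h C p); rewrite // mem_cat lt inE eqxx orbT.
      by exists C'; rewrite // mem_cat mem_rcons inE C'st orbT.
  rewrite potE; apply: leq_trans (_ : 1 + (weight h B (C :|: pivB h C p) + (2 < #|pivB h C p|) *
    weight h B (C :|: pivA h C p)) + potential B st <= _).
    rewrite /potential big_cat big_rcons /=; case: ifP => _; rewrite ?big_seq1 ?big_nil; slia.
  rewrite addnC leq_add2l addnA.
  exact: (branch_weight (nontwin_sym e_sym) (nontwin_irr e_irr) dp leB lo hi).
move=> z; apply: runs_simple => //=; first by slia.
move=> k3; exists None => //; split; first by apply: keep_trans K k3.
(* If the largest score is 0, no residual edge is left. As the budget never exceeds [tc], the cover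
   found is minimum and [vB] equals [tc]. *)
have cC : vcover h C.
  apply: vcover_rdeg0 => v; have := m2 v; rewrite z leqn0 /score.
  by case: (rdeg h C v).
have tC := tc_min cC; have cardC : #|C| = tc.
  by apply/eqP; rewrite eqn_leq (leq_trans leB lB).
exists C; rewrite /= B2 ba2 st2; split=> //.
  by apply/eqP; rewrite eqn_leq lB -cardC.
Qed.

Lemma runs_step s0 B st s :
  has_input k adj s0 -> has_classes e s0 ->
  search_inv s0 (Some (B, st)) s ->
  runs w Step s step_time (fun s' => keep (wvars Step) (warrs Step) s s' ->
    exists2 g, search_inv s0 g s' &
      if g is Some (B', st') then (potential B' st').+1 <= potential B st else True).
Proof.
move=> hs0 cl0 si; have w1 := word_gt1 w_ok.
have [_ [_ sSp _ _ _]] := si.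
apply: (@runs_if _ _ _ _ _ (600 * (n + M) + 510)) => //=; last by slia.
- rewrite sSp; case/lastP: st si sSp => // st C si sSp _.
  by apply: runs_mono (runs_pop hs0 cl0 si) _ _; first by slia.
rewrite sSp; case: st si sSp => // si sSp _.
apply: runs_mono (runs_root hs0 si) _ _; first by slia.
by move=> s' k' H /H[i p]; exists (Some (B.+1, [:: set0])).
Qed.

Lemma potential_gt0 s0 B st s : search_inv s0 (Some (B, st)) s -> 0 < potential B st.
Proof.
move=> [_ [_ _ _ _ [_ eB lB]]]; case: st eB => [|C st] eB; last first.
  by rewrite /potential big_cons; have := weight_gt0 B C; slia.
have ltB : B < tc.
  rewrite ltnNge; apply/negP => tB; have [C] := eB (ext_le tB tc_ext).
  by rewrite in_nil.
by rewrite /potential big_nil big_ltn.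
Qed.

(** The factor 8 is 2, for the extra unit charged to each later round, times 4, from the geometric
    sum over all budgets. *)
Lemma potential0 : potential 0 [:: set0] <= 8 * general_size (tc + 4).
Proof.
have wi i : weight h i set0 <= general_size (i + 4).
  by apply: weight_le; rewrite cards0 subn0.
apply: (@leq_trans (2 * \sum_(0 <= i < tc.+1) general_size (i + 4))); last first.
  rewrite -[8]/(2 * 4) -mulnA leq_mul2l /=; apply: leq_trans (sum_general_size _).
  have l4 : 4 <= (tc + 4).+1 by slia.
  rewrite -(big_mkord xpredT) (big_cat_nat _ l4) //.
  apply: leq_trans (leq_addl _ _).
  have := @big_addn _ 0 addn 0 (tc + 4).+1 4 xpredT general_size.
  by rewrite add0n => ->; have -> : (tc + 4).+1 - 4 = tc.+1 by slia.
rewrite /potential big_seq1 [in leqRHS]big_ltn // mulnDr leq_add //.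
  by apply: leq_trans (wi 0) _; slia.
rewrite big_distrr /=; apply: leq_sum => i _.
apply: leq_trans (leq_add (weight_gt0 i set0) (leqnn _)) _.
by rewrite addnn -mul2n leq_mul2l wi.
Qed.

Lemma runs_search s :
  has_input k adj s -> has_classes e s -> (forall i, arr s aStk i = 0) ->
  runs w Search s ((step_time + 4) * (8 * general_size (tc + 4)) + 50) found.
Proof.
move=> hs cl s0; have w1 := word_gt1 w_ok; have w0 := ltnW w1.
set T := _ * (8 * _).
apply: (@runs_seq _ _ _ _ 2 (T + 40)); last by slia.
simple_run; rewrite //= => _.
apply: (@runs_seq _ _ _ _ 2 (T + 30)); last by slia.
simple_run; rewrite //= => _.
apply: (@runs_seq _ _ _ _ 2 (T + 20)); last by slia.
simple_run; rewrite //= => _; set s1 := set_var _ _ _.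
have i1 : search_inv s1 (Some (0, [:: set0])) s1.
  split; first exact: keep_refl.
  split=> //=; first by case=> // _ v; rewrite s0 inE.
  split=> //; first by case.
  by move=> E; exists set0; rewrite ?inE.
apply: (@runs_mono _ _ _ (T + 10) _ (fun s' => ev s' ($vFound == 0)%X = 0 /\ exists g, search_inv
  s1 g s')) => //.
- apply: (runs_while (I := search_inv s1) (Phi := search_time) w1 i1) => //.
  + case=> [[B st]|] s2 I2 /=.
      have pot0 := potential_gt0 I2.
      move=> _; exists step_time.
        by apply: leq_trans (_ : (step_time + 4) * 1 <= _); [rewrite muln1 /=; slia|rewrite
          leq_mul2l pot0 orbT].
      apply: runs_mono (runs_step (s0 := s1) hs cl I2) _ _ => // s3 k3 H kk.
      have [g Ig pot] := H kk; exists g => //.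
      case: g Ig pot => [[B' st']|] _ /= pot; last first.
        by apply: leq_trans (_ : (step_time + 4) * 1 <= _); [rewrite muln1 /=; slia|rewrite
          leq_mul2l pot0 orbT].
      apply: leq_trans (_ : (step_time + 4) * (potential B' st').+1 <= _).
        by rewrite mulnS; move: (_ * potential _ _) => z; slia.
      by rewrite leq_mul2l pot orbT.
    by have [_ [X [_ _ _ -> _]]] := I2.
  rewrite /T /=; have := leq_mul (leqnn (step_time + 4)) potential0.
  by move: (_ * _) (_ * (_ * _)) => z1 z2; slia.
  by slia.
move=> s' _ /= [z [[[B st]|] [K I]]]; last exact: I.
by case: I z => _ _ ->.
Qed.

End Search.

(** * Listing the cover and the cliques outside it *)

Notation vH := 20 (only parsing).
Notation vIdx := 21 (only parsing).
Notation aXL := 9 (only parsing).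
Notation aXH := 10 (only parsing).
Notation aHead := 11 (only parsing).
Notation aNext := 12 (only parsing).

(** The tag [aXH] is 1 on the first half of the cover, 2 on the second and stays 0 elsewhere; the
    first half is the one rounded up. *)
Definition ListCover : cmd :=
  vH ::= ($vB + 1) / 2 ;; vIdx ::= 0 ;;
  For vU vN
    (If (Get aStk ($vBase + $vU))
       (Put aXL $vIdx $vU ;; Put aXH $vU (2 - ($vIdx < $vH)) ;; vIdx ::= $vIdx + 1)
       Skip).

(** Pointers are vertices plus one, which leaves 0 as null. Cover vertices are not inserted, and
    their untouched null [aNext] makes each of them a list of length one. *)
Definition Chains : cmd :=
  For vU vN
    (If (Get aXH $vU) Skip
       (Put aNext ($vU + 1) (Get aHead (Get aCls $vU)) ;;
        Put aHead (Get aCls $vU) ($vU + 1))).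

(* [l] lists the vertices [vert p] of the cells of a linked list; 0 is the null pointer. *)
Fixpoint linked (vert nxt : nat -> nat) (p : nat) (l : seq nat) : bool :=
  if l is v :: l' then [&& p != 0, vert p == v & linked vert nxt (nxt p) l'] else p == 0.

(** Frame rule for lists: only the successors of cells carrying vertices of [l] matter. *)
Lemma linked_eq vert nxt nxt' p l :
  (forall q, q != 0 -> vert q \in l -> nxt' q = nxt q) ->
  linked vert nxt p l -> linked vert nxt' p l.
Proof.
elim: l p => //= v l IH p H /and3P[p0 vp lk]; rewrite p0 vp /= H ?inE ?vp //.
by apply: IH lk => q q0 ql; rewrite H // inE ql orbT.
Qed.

Section Chains.
Variables (n k : nat) (e : rel 'I_n) (adj : 'I_n -> seq 'I_n) (w : nat).
Hypothesis adjP : adjacency_lists e adj.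
Hypothesis w_ok : word_size_ok 6 n w.
Local Notation M := (off adj n).

Definition listed (X : {set 'I_n}) h (xs : seq 'I_n) (s : state) :=
  [/\ uniq xs, xs =i X, map val xs = mkseq (arr s aXL) (size xs)
    & forall v : 'I_n, arr s aXH v = if v \in X then 2 - (index v xs < h) else 0].

Lemma runs_list s (X : {set 'I_n}) :
  has_input k adj s -> var s vB = #|X| -> stores (arr s aStk) (var s vBase) X ->
  var s vBase <= n * n -> (forall i, arr s aXH i = 0) ->
  runs w ListCover s (100 * n + 30) (fun s' =>
    var s' vH = uphalf #|X| /\ exists xs, listed X (uphalf #|X|) xs s').
Proof.
move=> hs sB st lb sXH; have w1 := word_gt1 w_ok; have w0 := ltnW w1.
have wn := word_gtn w_ok; have wn2 := word_gt2 w_ok.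
have w2 : 2 < cap w by slia.
have lX : #|X| <= n by rewrite -[n in _ <= n]card_ord max_card.
have bw u : u < n -> var s vBase + u < cap w by move=> un; move: wn2 lb un; clear; nia.
have hE : (#|X| + 1) %/ 2 = uphalf #|X| by rewrite divn2 addn1.
have hle : uphalf #|X| <= #|X| by rewrite uphalf_half; have := odd_double_half #|X|; slia.
apply: (@runs_seq _ _ _ _ 6 (100 * n + 20)); last by slia.
simple_run; rewrite /= sB hE; first by rewrite w1 w2; slia.
move=> _; apply: (@runs_seq _ _ _ _ 2 (100 * n + 10)); last by slia.
simple_run; rewrite //= => _; set s1 := set_var _ _ _.
pose I (u : nat) s' := exists xs : seq 'I_n,
  [/\ uniq xs, forall v : 'I_n, (v \in xs) = (v \in X) && (v < u),
      map val xs = mkseq (arr s' aXL) (size xs), var s' vIdx = size xs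
    & forall v : 'I_n, arr s' aXH v = if v \in xs then 2 - (index v xs < uphalf #|X|) else 0].
apply: (runs_mono (runs_for (N := n) (B := fun=> 60) (I := I) w1 _ _ _ _ _ _ (leqnn _))) => //.
- by slia.
- by case: hs.
- exists [::]; split=> // [v|v]; last by rewrite /= sXH.
  by rewrite in_nil andbF.
- move=> u s2 k2 u2 [xs [un mx xl ix xh]].
  have b2 : var s2 vBase = var s vBase by rewrite (k2.1 vBase isT).
  have st2 : arr s2 aStk (var s vBase + u) = (u \in X) by rewrite (k2.2 aStk isT) /=; apply: st.
  have h2 : var s2 vH = uphalf #|X| by rewrite (k2.1 vH isT).
  have sx : size xs <= n by rewrite -(card_uniqP un) -[n in _ <= n]card_ord max_card.
  have bu := bw u (ltn_ord u).
  have ux : u \notin xs by rewrite mx ltnn andbF.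
  case: (boolP (u \in X)) => uX; last first.
    rewrite (negbTE uX) in st2.
    simple_run; rewrite /= u2 b2 st2 /=; first by rewrite bu.
    move=> _; exists xs; split=> // v; rewrite mx ltnS [v <= u]leq_eqVlt (inj_eq val_inj).
    by case: (eqVneq v u) => // ->; rewrite (negbTE uX).
  rewrite uX in st2; simple_run; rewrite /= u2 b2 st2 /=.
    rewrite bu w2 w1 ix /=; apply/andP; split; last by slia.
    by apply: leq_ltn_trans w2; apply: leq_subr.
  move=> _; exists (rcons xs u); split=> /=.
  + by rewrite rcons_uniq ux.
  + move=> v; rewrite mem_rcons inE mx ltnS [v <= u]leq_eqVlt (inj_eq val_inj).
    by case: (eqVneq v u) => [->|_]; rewrite ?uX.
  + rewrite map_rcons size_rcons mkseqS ix eqxx xl; congr rcons.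
    by apply/eq_in_map => i; rewrite mem_iota => /= li; rewrite ifN // neq_ltn li.
  + by rewrite size_rcons ix addn1.
  + move=> v; rewrite mem_rcons inE (inj_eq val_inj) -cats1 index_cat ix h2.
    case: (eqVneq v u) => [->|vu] /=; first by rewrite (negbTE ux) eqxx addn0.
    by rewrite xh; case: (v \in xs).
- by rewrite sum_nat_const card_ord; slia.
move=> s2 k2 [[xs [un mx xl ix xh]] k2'].
split; first by rewrite (k2.1 vH isT).
have mX : xs =i X by move=> v; rewrite mx ltn_ord andbT.
by exists xs; split=> // v; rewrite xh mX.
Qed.

(** Cover vertices form singleton cells, so that for a half [Z] the vertices of the other half pass
    through the same knapsack as the cliques. *)
Definition cell (X : {set 'I_n}) (v : 'I_n) : {set 'I_n} :=
  if v \in X then [set v] else [set u | (u \notin X) && (closed_nbhd e u == closed_nbhd e v)].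

Lemma cell_sym X u v : (u \in cell X v) = (v \in cell X u).
Proof.
rewrite /cell; case: (boolP (v \in X)) => vX; case: (boolP (u \in X)) => uX;
  rewrite !inE ?vX ?uX ?andbT //=.
- by apply: contraNF uX => /eqP ->.
- by apply/esym; apply: contraNF vX => /eqP ->.
Qed.

(** [hd] contains one representative per cell; the first clause is the test by which [Knapsack]
    recognises it. *)
Definition chained (X hd : {set 'I_n}) (ch : 'I_n -> seq 'I_n) (s : state) :=
  [/\ forall v : 'I_n, (arr s aXH v != 0) || (arr s aHead (arr s aCls v) == v.+1) = (v \in hd),
      forall v, v \in hd -> [/\ linked predn (arr s aNext) v.+1 (map val (ch v)),
         uniq (ch v) & ch v =i cell X v],
      forall v, exists2 h, h \in hd & v \in cell X h
    & forall h h', h \in hd -> h' \in hd -> h' \in cell X h -> h' = h].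

Lemma runs_chains s (X : {set 'I_n}) :
  has_input k adj s -> has_classes e s -> (forall v : 'I_n, (arr s aXH v != 0) = (v \in X)) ->
  (forall i, arr s aHead i = 0) -> (forall i, arr s aNext i = 0) ->
  runs w Chains s (50 * n + 10) (fun s' => exists hd ch, chained X hd ch s').
Proof.
move=> hs cl sX sH sN; have w1 := word_gt1 w_ok; have w0 := ltnW w1; have wn := word_gtn w_ok.
pose c := arr s aCls.
pose I (u : nat) s' := (forall v : 'I_n, v \in X -> arr s' aNext v.+1 = 0) /\
  exists ch : nat -> seq 'I_n, forall L,
  [/\ linked predn (arr s' aNext) (arr s' aHead L) (map val (ch L)), uniq (ch L)
    & forall v : 'I_n, (v \in ch L) = [&& v < u, v \notin X & c v == L]].
apply: (runs_mono (runs_for (N := n) (B := fun=> 30) (I := I) w1 _ _ _ _ _ _ (leqnn _))) => //.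
- by slia.
- by case: hs.
- split; first by move=> v _ /=.
  exists (fun=> [::]) => L; split=> //; first by rewrite /= sH.
- move=> u s2 k2 u2 [nX [ch chP]].
  have X2 : (arr s2 aXH u != 0) = (u \in X) by rewrite (k2.2 aXH isT) sX.
  have c2 : arr s2 aCls = c by rewrite (k2.2 aCls isT).
  have uw : u.+1 < cap w by have := ltn_ord u; slia.
  case: (boolP (u \in X)) => uX.
    simple_run; rewrite /= u2 X2 uX //= => _; split=> //; exists ch => L.
    have [lk un mm] := chP L; split=> // v; rewrite mm ltnS [v <= u]leq_eqVlt (inj_eq val_inj).
    by case: (eqVneq v u) => [->|]; rewrite ?uX ?ltnn.
  simple_run; rewrite /= u2 X2 (negbTE uX) ?c2 ?addn1 /=; first by rewrite w1 uw.
  move=> _; split=> /=.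
    move=> v vX; rewrite eqSS (inj_eq val_inj); case: eqVneq => [E|_]; last exact: nX.
    by rewrite -E vX in uX.
  exists (fun L => if L == c u then u :: ch L else ch L) => L /=.
  have [lk un mm] := chP L.
  (* The written cell belongs to [u], which is in no list so far. *)
  have lk' : linked predn (fun j => if j == u.+1 then arr s2 aHead (c u) else arr s2 aNext j)
      (arr s2 aHead L) (map val (ch L)).
    apply: linked_eq lk => q q0 ql; rewrite ifN //; apply: contraTneq ql => ->.
    by rewrite /= (mem_map val_inj) mm ltnn.
  case: eqP => [LE|NE].
    split=> /=; first by rewrite !eqxx; move: lk'; rewrite LE.
      by rewrite un mm ltnn.
    move=> v; rewrite inE mm ltnS [v <= u]leq_eqVlt (inj_eq val_inj).
    by case: (eqVneq v u) => [->|]; rewrite ?uX ?LE ?eqxx.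
  split=> // v; rewrite mm ltnS [v <= u]leq_eqVlt (inj_eq val_inj).
  case: (eqVneq v u) => [->|] //=; rewrite ltnn /= uX /=; apply/esym/eqP => E.
  by case: NE; rewrite E.
- by rewrite sum_nat_const card_ord; slia.
move=> s2 k2 [[nX [ch chP]] _].
have X2 v : (arr s2 aXH v != 0) = (arr s aXH v != 0) by rewrite (k2.2 aXH isT).
have c2 : arr s2 aCls = c by rewrite (k2.2 aCls isT).
pose hd := [set v : 'I_n | (arr s2 aXH v != 0) || (arr s2 aHead (c v) == v.+1)].
have hdE (v : 'I_n) : (v \in hd) = (v \in X) || (arr s2 aHead (c v) == v.+1).
  by rewrite inE X2 sX.
have cE (u v : 'I_n) : (c u == c v) = (closed_nbhd e u == closed_nbhd e v) by rewrite /c cl.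
exists hd, (fun v => if v \in X then [:: v] else ch (c v)); split.
- by move=> v; rewrite c2 inE.
- move=> v; rewrite hdE /cell; case: (boolP (v \in X)) => vX /=.
    by move=> _; split=> //=; [rewrite eqxx nX|move=> u; rewrite !inE].
  have [lk un mm] := chP (c v).
  move=> /eqP hv; rewrite -hv; split=> // u; rewrite mm ltn_ord inE /=.
  by rewrite cE.
- move=> v; case: (boolP (v \in X)) => vX.
    by exists v; rewrite ?hdE ?vX // /cell vX inE.
  have [] := chP (c v); case E: (ch (c v)) => [|h l] /=.
    by move=> _ _ /(_ v); rewrite in_nil ltn_ord vX eqxx.
  move=> /and3P[h0 /eqP hh _] _ mm; have := mm h; rewrite inE eqxx ltn_ord /=.
  move=> /esym/andP[hX /eqP ch_]; exists h.
    rewrite hdE ch_; apply/orP; right; rewrite -[val h](hh) prednK ?lt0n //.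
  by rewrite cell_sym /cell (negbTE vX) inE hX -cE ch_ eqxx.
move=> a b; rewrite !hdE /cell; case: (boolP (a \in X)) => aX.
  by move=> _ _; rewrite inE => /eqP.
move=> /= /eqP ha + /[!inE] /andP[bX]; rewrite (negbTE bX) /= -cE => /eqP hb /eqP cab.
by move: hb; rewrite cab ha => -[] /val_inj.
Qed.

End Chains.

(** * Splitting and counting edges *)

Section Pairs.
Variables (T : finType) (r : rel T).

(** Twice the number of edges; the doubled count is additive over vertices and avoids sets of
    sets. *)
Definition pairs (S : {set T}) := \sum_(u in S) \sum_(v in S) r u v.

Hypothesis r_sym : symmetric r.
Hypothesis r_irr : irreflexive r.

Lemma card_nbrs v (S : {set T}) : \sum_(u in S) r v u = #|[set u in S | r v u]|.
Proof.
by rewrite -sum1_card big_mkcond [RHS]big_mkcond; apply: eq_bigr => u _; rewrite inE; case: (u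
  \in S) => //=; case: (r v u).
Qed.

Lemma pairsU1 v (S : {set T}) : v \notin S ->
  pairs (v |: S) = pairs S + 2 * #|[set u in S | r v u]|.
Proof.
move=> vS; rewrite /pairs big_setU1 //= big_setU1 //= r_irr add0n.
under [X in _ + X]eq_bigr do rewrite big_setU1 //=.
rewrite big_split /= card_nbrs; under eq_bigr do rewrite r_sym.
by rewrite card_nbrs; lia.
Qed.

Lemma pairs_le (S : {set T}) : pairs S <= #|S| * #|S|.
Proof.
rewrite -sum_nat_const; apply: leq_sum => u _.
by rewrite -sum1_card; apply: leq_sum => v _; apply: leq_b1.
Qed.

(** The map from (u, v) to {u, v} has fibres of size two over the edges. *)
Lemma pairs_edges (S : {set T}) : pairs S = 2 * nb_edges_in r S.
Proof.
pose P (p : T * T) := [&& p.1 \in S, p.2 \in S & r p.1 p.2].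
have -> : pairs S = \sum_(p | P p) 1.
  rewrite /pairs pair_big_dep /= big_mkcond [RHS]big_mkcond; apply: eq_bigr => -[u v] _.
  by rewrite /P /=; case: (u \in S); case: (v \in S); case: (r u v).
pose Q (A : {set T}) := (A \in edges r) && (A \subset S).
rewrite (partition_big (fun p => [set p.1; p.2]) Q) /=; last first.
  move=> [u v] /and3P[/= uS vS ruv]; rewrite /Q; apply/andP; split.
    by rewrite inE; apply/existsP; exists u; apply/existsP; exists v; rewrite ruv /=.
  by apply/subsetP => x; rewrite !inE => /orP[]/eqP->.
rewrite (eq_bigr (fun=> 2)); last first.
  move=> A /andP[]; rewrite inE => /existsP[a /existsP[b /andP[rab /eqP ->]]] AS.
  have ab : a != b by apply: contraTneq rab => ->; rewrite r_irr.
  have aS : a \in S by apply: (subsetP AS); rewrite !inE eqxx.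
  have bS : b \in S by apply: (subsetP AS); rewrite !inE eqxx orbT.
  rewrite sum1_card; have -> : 2 = #|[set (a, b); (b, a)]|.
    by rewrite cards2 xpair_eqE negb_and ab.
  apply: eq_card => -[u v]; rewrite !inE /P /= !xpair_eqE.
  apply/andP/orP => [[/and3P[_ _ ruv] /eqP E]|].
    have uA : u \in [set a; b] by rewrite -E !inE eqxx.
    have vA : v \in [set a; b] by rewrite -E !inE eqxx orbT.
    have uv : u != v by apply: contraTneq ruv => ->; rewrite r_irr.
    move: uA vA uv; rewrite !inE => /orP[]/eqP-> /orP[]/eqP->; rewrite ?eqxx //.
      by left.
    by right.
  case=> /andP[/eqP-> /eqP->]; first by rewrite aS bS rab eqxx.
  by rewrite aS bS r_sym rab setUC eqxx.
rewrite sum_nat_const mulnC; congr (_ * _); rewrite /nb_edges_in.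
by apply: eq_card => A; rewrite inE.
Qed.

End Pairs.

(** * Edges that meet a half of the cover or lie inside a clique *)

Section Classes.
Variables (n : nat) (e : rel 'I_n).
Hypothesis e_sym : symmetric e.
Hypothesis e_irr : irreflexive e.
Variable X : {set 'I_n}.

Definition edge_at (Z : {set 'I_n}) : rel 'I_n :=
  fun u v => e u v && [|| u \in Z, v \in Z | v \in cell e X u].

Lemma edge_at_sym Z : symmetric (edge_at Z).
Proof. by move=> u v; rewrite /edge_at e_sym cell_sym orbCA. Qed.

Lemma edge_at_irr Z : irreflexive (edge_at Z).
Proof. by move=> u; rewrite /edge_at e_irr. Qed.

Lemma pairs_cover Z1 Z2 (S : {set 'I_n}) : twin_cover e X -> X \subset Z1 :|: Z2 ->
  pairs e S <= pairs (edge_at Z1) S + pairs (edge_at Z2) S.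
Proof.
move=> X_cover XZ; rewrite /pairs -big_split /=; apply: leq_sum => u _.
rewrite -big_split /=; apply: leq_sum => v _; rewrite /edge_at.
case uv: (e u v) => //=; have XE x : x \in X -> (x \in Z1) || (x \in Z2).
  by move=> xX; have := subsetP XZ x xX; rewrite inE.
have := forallP X_cover u => /forallP/(_ v); rewrite uv /= => /or3P[/XE||].
- by case/orP=> ->; rewrite ?orbT /=; lia.
- by move=> /XE /orP[]->; rewrite ?orbT /=; lia.
move=> tw; case: (boolP (u \in X)) => [/XE|uX].
  by case/orP=> ->; rewrite ?orbT /=; lia.
case: (boolP (v \in X)) => [/XE|vX].
  by case/orP=> ->; rewrite ?orbT /=; lia.
by rewrite /cell (negbTE uX) inE vX eq_sym tw !orbT.
Qed.

Lemma cell_adj h u v : u \in cell e X h -> v \in cell e X h -> u != v -> e u v.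
Proof.
rewrite /cell; case: ifP => _; rewrite !inE.
  by move=> /eqP-> /eqP->; rewrite eqxx.
move=> /andP[_ /eqP uh] /andP[_ /eqP vh] uv.
have : v \in closed_nbhd e u by rewrite uh -vh inE eqxx.
by rewrite inE eq_sym (negbTE uv).
Qed.

Lemma cell_id v : v \in cell e X v.
Proof. by rewrite /cell; case: ifP => vX; rewrite !inE ?vX eqxx. Qed.

Lemma cell_eq h u : u \in cell e X h -> cell e X u = cell e X h.
Proof.
rewrite {1 3}/cell; case: (boolP (h \in X)) => hX.
  by rewrite inE => /eqP ->; rewrite /cell hX.
by rewrite inE => /andP[uX /eqP uh]; rewrite /cell (negbTE uX) uh.
Qed.

Definition deg_in (Y : {set 'I_n}) v := #|[set u in Y | e v u]|.

(** A vertex outside the cell cannot tell twins apart. A clique therefore enters the knapsack only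
    through the number of its chosen vertices. *)
Lemma deg_cell (Y : {set 'I_n}) h u v : u \in cell e X h -> v \in cell e X h ->
  [disjoint Y & cell e X h] -> deg_in Y u = deg_in Y v.
Proof.
move=> uh vh d; apply: eq_card => x; rewrite !inE; case xY: (x \in Y) => //=.
have xh := disjointFr d xY.
have NE : closed_nbhd e u = closed_nbhd e v.
  move: uh vh; rewrite /cell; case: ifP => _; rewrite !inE.
    by move=> /eqP-> /eqP->.
  by move=> /andP[_ /eqP->] /andP[_ /eqP->].
have := congr1 (fun A : {set 'I_n} => x \in A) NE; rewrite !inE.
have -> : (x == u) = false by apply: contraFF xh => /eqP->.
by have -> : (x == v) = false by apply: contraFF xh => /eqP->.
Qed.

(** Doubled number of edges brought by j vertices of a clique: d each into [Y], and j(j - 1)/2 among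
    themselves. *)
Definition gain d j := 2 * (j * d) + j * j.-1.

Lemma gainS d j : gain d j.+1 = gain d j + 2 * (d + j).
Proof. by rewrite /gain; case: j => [|j] /=; nia. Qed.

(** The cell is removed one vertex at a time. Such a vertex lies outside [Z], so its [edge_at]
    neighbours are in [Z] or in its own cell. *)
Lemma pairs_cell (Z : {set 'I_n}) h (S : {set 'I_n}) : [disjoint Z & cell e X h] ->
  pairs (edge_at Z) S <= pairs (edge_at Z) (S :\: cell e X h) +
    gain (deg_in (S :&: Z) h) #|S :&: cell e X h|.
Proof.
move=> dZ; set c := cell e X h.
have [j] := ubnPeq #|S :&: c|; elim: j S => [|j IH] S /eqP cS.
  move: cS => /eqP; rewrite cards_eq0 setI_eq0 => dS.
  by rewrite (setDidPl _) // leq_addr.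
have : 0 < #|S :&: c| by rewrite cS.
case/card_gt0P => v; rewrite inE => /andP[vS vc].
have vZ : v \notin Z by rewrite (disjointFl dZ vc).
pose S' := S :\ v.
have SE : S = v |: S' by rewrite setD1K.
have vS' : v \notin S' by rewrite !inE eqxx.
have c' : #|S' :&: c| = j.
  by apply/eqP; rewrite -eqSS -cS (cardsD1 v (S :&: c)) inE vS vc setIDAC.
have D' : S :\: c = S' :\: c.
  apply/setP => x; rewrite !inE; case: (eqVneq x v) => [->|]; rewrite ?vc //.
have Z' : S :&: Z = S' :&: Z.
  by apply/setP => x; rewrite !inE; case: (eqVneq x v) => [->|]; rewrite ?(negbTE vZ) ?andbF.
have -> : pairs (edge_at Z) S = pairs (edge_at Z) S' + 2 * #|[set u in S' | edge_at Z v u]|.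
  by rewrite {1}SE pairsU1 //; [apply: edge_at_sym|apply: edge_at_irr].
rewrite D' Z' gainS addnA leq_add //; first by apply: IH; rewrite c'.
rewrite leq_mul2l /=.
rewrite -(deg_cell (Y := S' :&: Z) vc (cell_id h)); last first.
  by apply: disjointWl dZ; apply: subsetIr.
rewrite -c'; apply: leq_trans (_ : #|[set u in S' :&: Z | e v u] :|: (S' :&: c)| <= _).
  apply: subset_leq_card; apply/subsetP => u; rewrite !inE /edge_at (negbTE vZ) /=.
  move=> /and3P[uS evu]; rewrite uS evu /= andbT => /orP[->//|].
  by rewrite (cell_eq vc) => ->; rewrite orbT.
by rewrite cardsU leq_subr.
Qed.

(** Counterpart of [pairs_cell] in the full graph. It is only an inequality, since [v] may have
    further neighbours in [S]. *)
Lemma pairs_add h v (S Y P : {set 'I_n}) : v \in cell e X h -> v \notin S ->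
  Y \subset S -> P \subset S -> P \subset cell e X h -> [disjoint Y & cell e X h] ->
  pairs e S + 2 * (deg_in Y v + #|P|) <= pairs e (v |: S).
Proof.
move=> vh vS YS PS Ph dY; rewrite pairsU1 // leq_add2l leq_mul2l /=.
have dYP : [disjoint [set u in Y | e v u] & P].
  rewrite disjoint_subset; apply/subsetP => u; rewrite !inE => /andP[uY _].
  by apply: contraTN uY => /(subsetP Ph) uh; rewrite (disjointFl dY uh).
have -> : deg_in Y v + #|P| = #|[set u in Y | e v u] :|: P|.
  by move: dYP; rewrite -setI_eq0 => /eqP dd; rewrite cardsU dd cards0 subn0.
apply: subset_leq_card; apply/subsetP => u; rewrite !inE => /orP[/andP[uY ->]|uP].
  by rewrite (subsetP YS).
rewrite (subsetP PS) //=; apply: (cell_adj vh (subsetP Ph _ uP)).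
by apply: contraNneq vS => ->; apply: (subsetP PS).
Qed.

End Classes.

(** * Dynamic programming over one clique *)

Notation vK1 := 22 (only parsing).
Notation vX := 23 (only parsing).
Notation vJ := 24 (only parsing).
Notation vA := 25 (only parsing).
Notation vQ := 26 (only parsing).
Notation vR := 27 (only parsing).
Notation aInY := 13 (only parsing).
Notation aDY := 14 (only parsing).
Notation aD := 15 (only parsing).
Notation aP := 16 (only parsing).
Notation aT := 17 (only parsing).
Notation aPT := 18 (only parsing).
Notation aPar := 19 (only parsing).

(* Table [aD] holds the best values over the cliques treated so far, [aT] those that use
   exactly the first [vJ] vertices of the current clique; [q] decreases so that [aT] can be
   updated in place.  Lists share their tails: the cell of the vertex [x - 1] in position
   [q] has address [x * (k + 1) + q], which is fresh because each vertex is treated once. *)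
Definition RelaxBody : cmd :=
  vQ ::= $vK - $vR ;;
  If (Get aT ($vQ - 1))
    (Put aT $vQ (Get aT ($vQ - 1) + $vA) ;;
     Put aPar ($vX * $vK1 + $vQ) (Get aPT ($vQ - 1)) ;;
     Put aPT $vQ ($vX * $vK1 + $vQ) ;;
     If (Get aD $vQ < Get aT $vQ)
       (Put aD $vQ (Get aT $vQ) ;; Put aP $vQ (Get aPT $vQ)) Skip)
    (Put aT $vQ 0).

Definition Relax : cmd :=
  vA ::= 2 * (Get aDY ($vX - 1) + $vJ) ;;
  For vR vK RelaxBody ;;
  Put aT 0 0 ;;
  vX ::= Get aNext $vX ;;
  vJ ::= $vJ + 1.

Definition AddCell : cmd :=
  For vR vK1 (Put aT $vR (Get aD $vR) ;; Put aPT $vR (Get aP $vR)) ;;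
  vX ::= $vU + 1 ;;
  vJ ::= 0 ;;
  While ((0 < $vX) * ($vJ < $vK)) Relax.

Definition vert k1 p := (p %/ k1).-1.

Section AddCell.
Variables (n k : nat) (e : rel 'I_n) (w : nat).
Hypothesis e_sym : symmetric e.
Hypothesis e_irr : irreflexive e.
Hypothesis w_ok : word_size_ok 6 n w.
Hypothesis k_gt0 : 0 < k.
Hypothesis k_le_n : k <= n.

(* Every defined entry [q] of a table points to a list of [q] vertices, between [lo] and
   [hi], that realizes its value; values are shifted by one and 0 means undefined. *)
Definition sound (par : nat -> nat) (lo hi : {set 'I_n}) (val ptr : nat -> nat) :=
  forall q, q <= k -> val q != 0 -> exists l : seq 'I_n,
   [/\ linked (vert k.+1) par (ptr q) (map \val l), uniq l, size l = q,
       lo \subset [set x in l] /\ [set x in l] \subset hi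
     & val q <= (pairs e [set x in l]).+1].

Lemma sound_le par (lo hi : {set 'I_n}) val ptr q : sound par lo hi val ptr -> q <= k -> val q <=
  (n * n).+1.
Proof.
move=> so lq; have [-> //|nz] := eqVneq (val q) 0.
have [l [_ _ _ _ vl]] := so q lq nz; apply: leq_trans vl _; rewrite ltnS.
by apply: leq_trans (pairs_le _ _) _; rewrite leq_mul // -[n in _ <= n]card_ord max_card.
Qed.

(** The table after one more vertex of value [a] is forced in, which leaves size 0 undefined. *)
Definition relaxed (T : nat -> nat) a q :=
  if q is q'.+1 then (if T q' != 0 then T q' + a else 0) else 0.

Lemma runs_relax_loop s (x a : nat) :
  var s vK = k -> var s vK1 = k.+1 -> var s vX = x -> var s vA = a -> x <= n -> a <= 4 * n ->
  (forall q, q <= k -> arr s aT q <= (n * n).+1) ->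
  runs w (For vR vK RelaxBody) s (100 * k + 10) (fun s' =>
    [/\ forall q, 0 < q <= k -> arr s' aT q = relaxed (arr s aT) a q,
        forall q, q <= k -> relaxed (arr s aT) a q != 0 ->
          arr s' aPT q = x * k.+1 + q /\ arr s' aPar (x * k.+1 + q) = arr s aPT q.-1,
        forall p, p %/ k.+1 != x -> arr s' aPar p = arr s aPar p,
        forall q, q <= k -> arr s' aD q = maxn (arr s aD q) (relaxed (arr s aT) a q)
      & forall q, q <= k -> arr s' aP q =
          if arr s aD q < relaxed (arr s aT) a q then x * k.+1 + q else arr s aP q]).
Proof.
move=> sk sk1 sx sa xn an Tle; have w1 := word_gt1 w_ok; have w0 := ltnW w1.
have wn := word_gtn w_ok; have wn2 := word_gt2 w_ok.
pose T0 := arr s aT; pose PT0 := arr s aPT; pose P0 := arr s aP; pose D0 := arr s aD.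
pose Tn := relaxed T0 a.
(* After i rounds the sizes above k - i are new. Entry q reads entry q - 1, which is still old. *)
pose I i s' :=
  [/\ forall q, q <= k - i -> arr s' aT q = T0 q /\ arr s' aPT q = PT0 q,
      forall q, k - i < q <= k -> arr s' aT q = Tn q,
      forall q, k - i < q <= k -> Tn q != 0 ->
          arr s' aPT q = x * k.+1 + q /\ arr s' aPar (x * k.+1 + q) = PT0 q.-1,
      forall p, p %/ k.+1 != x -> arr s' aPar p = arr s aPar p
    & [/\ forall q, q <= k - i -> arr s' aD q = D0 q /\ arr s' aP q = P0 q,
          forall q, k - i < q <= k -> arr s' aD q = maxn (D0 q) (Tn q)
        & forall q, k - i < q <= k -> arr s' aP q =
            if D0 q < Tn q then x * k.+1 + q else P0 q]].
apply: (runs_mono (runs_for (N := k) (B := fun=> 80) (I := I) w1 _ _ _ _ _ _ (leqnn _))) => //.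
- by slia.
- have F q : (k - 0 < q <= k) = false by rewrite subn0; case: ltngtP.
  by split=> // [q|q|]; [rewrite F|rewrite F|split=> // q; rewrite F].
- move=> i s1 k1 i1 [I1 I2 I3 I4 [I5 I6 I7]].
  have li := ltn_ord i.
  have K1 : var s1 vK = k by rewrite (k1.1 vK isT).
  have KK1 : var s1 vK1 = k.+1 by rewrite (k1.1 vK1 isT).
  have X1 : var s1 vX = x by rewrite (k1.1 vX isT).
  have A1 : var s1 vA = a by rewrite (k1.1 vA isT).
  set q := k - i; have q0 : 0 < q by rewrite subn_gt0.
  have qS : q = (k - i.+1).+1 by rewrite /q; slia.
  have q1 : q - 1 = k - i.+1 by rewrite qS subn1.
  have qk : q <= k by apply: leq_subr.
  have [TE PTE] : arr s1 aT (k - i.+1) = T0 (k - i.+1) /\ arr s1 aPT (k - i.+1) = PT0 (k - i.+1).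
    by apply: I1; slia.
  have [DE PE] := I5 q (leqnn _).
  have TnE : Tn q = if T0 (k - i.+1) != 0 then T0 (k - i.+1) + a else 0 by rewrite qS.
  have qw : q < cap w by slia.
  have q1w : k - i.+1 < cap w by slia.
  have xw : x * k.+1 < cap w by move: wn2 xn k_le_n; clear; nia.
  have xqw : x * k.+1 + q < cap w by move: wn2 xn k_le_n qk; clear; nia.
  have Tle' := Tle (k - i.+1) (leq_subr _ _).
  have Taw : T0 (k - i.+1) + a < cap w by move: wn2 an Tle'; rewrite /T0; clear; nia.
  have split1 q' : k - i.+1 < q' <= k -> q' = q \/ k - i < q' <= k.
    by rewrite -/q; case: (eqVneq q' q) => [|ne]; [left | right; slia].
  have qlt q' : q' <= k - i.+1 -> q' == q = false /\ q' <= k - i by move=> h; split; slia.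
  have qgt q' : k - i < q' <= k -> q' == q = false by rewrite -/q => h; slia.
  have xq q' : x * k.+1 + q' == x * k.+1 + q = (q' == q) by rewrite eqn_add2l.
  have vx : (x * k.+1 + q) %/ k.+1 = x by rewrite divnMDl // divn_small ?addn0.
  have xp p : p %/ k.+1 != x -> p == x * k.+1 + q = false.
    by move=> ne; apply: contraNF ne => /eqP ->; rewrite vx eqxx.
  have [z|nz] := eqVneq (T0 (k - i.+1)) 0.
    have Tn0 : Tn q = 0 by rewrite TnE z eqxx.
    simple_run; rewrite /= K1 i1 -/q q1 TE z /=; first by rewrite qw q1w w1 w0.
    move=> _; split=> /=.
    + by move=> q' /qlt[-> /I1].
    + by move=> q' /split1[->|h]; [rewrite eqxx Tn0|rewrite qgt // I2].
    + by move=> q' /split1[->|h]; [rewrite Tn0|apply: I3].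
    + exact: I4.
    split.
    + by move=> q' /qlt[_ /I5].
    + by move=> q' /split1[->|h]; [rewrite Tn0 maxn0|apply: I6].
    + by move=> q' /split1[->|h]; [rewrite Tn0|apply: I7].
  have TnE' : Tn q = T0 (k - i.+1) + a by rewrite TnE nz.
  have [lt|ge] := ltnP (D0 q) (Tn q).
    simple_run; rewrite /= K1 i1 -/q q1 TE nz /= A1 X1 KK1 !eqxx DE -TnE' lt /=.
      by rewrite qw q1w w1 TnE' Taw xw xqw.
    move=> _; split=> /=.
    + by move=> q' /qlt[-> /I1].
    + by move=> q' /split1[->|h]; [rewrite eqxx|rewrite qgt // I2].
    + move=> q' /split1[-> _|h nzq]; first by rewrite !eqxx PTE {3}qS.
      by rewrite xq qgt //; apply: I3.
    + by move=> p px; rewrite xp //; apply: I4.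
    split.
    + by move=> q' /qlt[-> /I5].
    + move=> q' /split1[->|h]; last by rewrite qgt //; apply: I6.
      by rewrite eqxx; apply/esym/maxn_idPr/ltnW.
    + move=> q' /split1[->|h]; last by rewrite qgt //; apply: I7.
      by rewrite eqxx lt.
  simple_run; rewrite /= K1 i1 -/q q1 TE nz /= A1 X1 KK1 !eqxx DE -TnE' [_ < Tn q]ltnNge ge /=.
    by rewrite qw q1w w1 TnE' Taw xw xqw.
  move=> _; split=> /=.
  + by move=> q' /qlt[-> /I1].
  + by move=> q' /split1[->|h]; [rewrite eqxx|rewrite qgt // I2].
  + move=> q' /split1[-> _|h nzq]; first by rewrite !eqxx PTE {3}qS.
    by rewrite xq qgt //; apply: I3.
  + by move=> p px; rewrite xp //; apply: I4.
  split.
  + by move=> q' /qlt[_ /I5].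
  + move=> q' /split1[->|h]; last by apply: I6.
    by rewrite DE; apply/esym/maxn_idPl.
  + move=> q' /split1[->|h]; last by apply: I7.
    by rewrite ltnNge ge.
- by rewrite sum_nat_const card_ord; slia.
move=> s1 _ [[I1 I2 I3 I4 [I5 I6 I7]] _]; rewrite subnn in I1 I2 I3 I5 I6 I7.
split=> //.
- case=> [|q] lq; first by rewrite eqxx.
  by apply: I3.
- case=> [|q] lq; last by apply: I6.
  by have [-> _] := I5 0 isT; rewrite maxn0.
case=> [|q] lq; last by apply: I7.
by have [_ ->] := I5 0 isT.
Qed.


(** * Adding one clique to the knapsack *)

Section OneCell.
Variables (X Z Y V : {set 'I_n}) (h : 'I_n) (ch : seq 'I_n).
Local Notation c := (cell e X h).
Hypothesis ch_uniq : uniq ch.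
Hypothesis chE : ch =i c.
Hypothesis Zc : [disjoint Z & c].
Hypothesis VZ : V :&: Z = Y.
Hypothesis Vc : [disjoint V & c].

Let YV : Y \subset V. Proof. by rewrite -VZ subsetIl. Qed.
Let Yc : [disjoint Y & c]. Proof. exact: disjointWl YV Vc. Qed.

Local Notation pre j := [set x in take j ch].
Local Notation ez := (edge_at e X Z).
Local Notation d := (deg_in e Y h).

(** The stored lists use prefixes of [ch], whereas optimality of [aD] covers every set with at most
    j vertices in the cell; [deg_cell] bridges the two. Lists of [aT] must contain the whole prefix,
    so that the next vertex gains j edges from it. Strict inequalities reflect the shift by one. *)
Definition cell_inv (j : nat) (s : state) :=
  [/\ j <= size ch,
      sound (arr s aPar) Y (V :|: pre j) (arr s aD) (arr s aP),
      sound (arr s aPar) (Y :|: pre j) (V :|: pre j) (arr s aT) (arr s aPT),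
      forall S : {set 'I_n}, Y \subset S -> S \subset V :|: c -> #|S :&: c| <= j -> #|S| <= k ->
        pairs ez S < arr s aD #|S|
    & forall S : {set 'I_n}, Y \subset S -> S \subset V -> #|S| + j <= k ->
        pairs ez S + gain d j < arr s aT (#|S| + j)].

(** Lists persist under updates: the new cells carry [v], which occurs in no list inside [hi]. *)
Lemma sound_par par par' (lo hi : {set 'I_n}) val ptr (v : 'I_n) :
  (forall p, p %/ k.+1 != v.+1 -> par' p = par p) -> v \notin hi ->
  sound par lo hi val ptr -> sound par' lo hi val ptr.
Proof.
move=> pp vhi so q lq nz; have [l [lk un sl [lo' hi'] vl]] := so q lq nz.
exists l; split=> //; apply: linked_eq lk => p p0 pl; apply: pp.
apply: contraNneq vhi => E; apply: (subsetP hi'); rewrite inE.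
by move: pl; rewrite /vert E /= (mem_map val_inj).
Qed.

Lemma sound_hi par (lo hi hi' : {set 'I_n}) val ptr : hi \subset hi' ->
  sound par lo hi val ptr -> sound par lo hi' val ptr.
Proof.
move=> hh so q lq nz; have [l [lk un sl [lo' hi'_] vl]] := so q lq nz.
by exists l; split=> //; split=> //; apply: subset_trans hh.
Qed.

Lemma cell_inv_step j v r s s' :
  drop j ch = v :: r -> j < k -> cell_inv j s ->
  let Tn := relaxed (arr s aT) (2 * (deg_in e Y v + j)) in
  arr s' aT 0 = 0 ->
  (forall q, 0 < q <= k -> arr s' aT q = Tn q) ->
  (forall q, q <= k -> Tn q != 0 ->
     arr s' aPT q = v.+1 * k.+1 + q /\ arr s' aPar (v.+1 * k.+1 + q) = arr s aPT q.-1) ->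
  (forall p, p %/ k.+1 != v.+1 -> arr s' aPar p = arr s aPar p) ->
  (forall q, q <= k -> arr s' aD q = maxn (arr s aD q) (Tn q)) ->
  (forall q, q <= k -> arr s' aP q =
     if arr s aD q < Tn q then v.+1 * k.+1 + q else arr s aP q) ->
  cell_inv j.+1 s'.
Proof.
move=> dr jk [js sD sT oD oT] Tn T0 TE PTE parE DE PE.
have lj : j < size ch by move: (size_drop j ch); rewrite dr /=; case: ltnP => //; slia.
have vE : nth v ch j = v by rewrite -[j]addn0 -nth_drop dr.
have takeS : take j.+1 ch = rcons (take j ch) v by rewrite (take_nth v lj) vE.
have vc : v \in c by rewrite -chE -vE mem_nth.
have vpre : v \notin take j ch.
  by have := take_uniq j.+1 ch_uniq; rewrite takeS rcons_uniq => /andP[].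
have preS : pre j.+1 = v |: pre j.
  by apply/setP => x; rewrite !inE takeS mem_rcons inE.
have vhi : v \notin V :|: pre j.
  by rewrite !inE negb_or vpre andbT (disjointFl Vc vc).
have hiS : V :|: pre j.+1 = v |: (V :|: pre j) by rewrite preS setUCA.
have loS : Y :|: pre j.+1 = v |: (Y :|: pre j) by rewrite preS setUCA.
have prec : pre j \subset c.
  by apply/subsetP => x; rewrite inE => /mem_take; rewrite chE.
have cpre : #|pre j| = j.
  by rewrite cardsE (card_uniqP (take_uniq _ ch_uniq)) size_take lj.
have dv : deg_in e Y v = d by apply: deg_cell vc (cell_id _ _ _) Yc.
have sT' : sound (arr s' aPar) (Y :|: pre j) (V :|: pre j) (arr s aT) (arr s aPT).
  exact: sound_par parE vhi sT.
(* A new entry extends a list containing [Y] and the first j vertices of the clique, so [v] brings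
   at least deg_in + j edges. *)
have new q : q <= k -> Tn q != 0 -> exists l : seq 'I_n,
   [/\ linked (vert k.+1) (arr s' aPar) (v.+1 * k.+1 + q) (map \val l), uniq l, size l = q,
       Y :|: pre j.+1 \subset [set x in l] /\ [set x in l] \subset V :|: pre j.+1
     & Tn q <= (pairs e [set x in l]).+1].
  case: q => [|q] lq nz; first by rewrite eqxx in nz.
  have tz : arr s aT q != 0 by apply: contraNneq nz => z; rewrite /Tn /= z.
  have [l [lk un sl [lol lhi] vl]] := sT' q (ltnW lq) tz.
  have vl' : v \notin [set x in l] by apply: contra vhi; apply: (subsetP lhi).
  have [_ par1] := PTE q.+1 lq nz.
  have setE : [set x in v :: l] = v |: [set x in l] by apply/setP => x; rewrite !inE.
  exists (v :: l); split.
  - rewrite /= par1 /= lk andbT addnS /= /vert -addnS divnMDl // divn_small ?ltnS //.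
    by rewrite addn0.
  - by rewrite /= un andbT; move: vl'; rewrite inE.
  - by rewrite /= sl.
  - by rewrite setE hiS loS !setUS.
  rewrite setE /Tn /= tz; apply: leq_trans (_ : (pairs e [set x in l] + 2 * (deg_in e Y v + #|pre
    j|)).+1 <= _).
    by rewrite cpre; slia.
  rewrite ltnS; rewrite inE in vl'.
  apply: (pairs_add e_sym e_irr vc _ _ _ prec Yc); rewrite ?inE //.
    by apply: subset_trans lol; apply: subsetUl.
  by apply: subset_trans lol; apply: subsetUr.
split.
- exact: lj.
- move=> q lq; rewrite DE // PE //; case: ltnP => [lt nz|ge nz].
    have [|l [lk un sl [lol lhi] vl]] := new q lq; first by slia.
    exists l; split=> //; first by split=> //; apply: subset_trans lol; apply: subsetUl.
  have sD' := sound_hi (subsetUr [set v] _) (sound_par parE vhi sD).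
  by rewrite hiS; apply: sD'.
- move=> q lq nz; case: (posnP q) => [q0|q0]; first by rewrite q0 T0 in nz.
  move: nz; rewrite TE ?q0 // => nz; have [-> _] := PTE q lq nz.
  exact: new.
- move=> S YS Sc cS lS; rewrite DE // leq_max.
  have [le|gt] := leqP #|S :&: c| j; first by rewrite oD.
  have cE : #|S :&: c| = j.+1 by apply/eqP; rewrite eqn_leq cS gt.
  have SZ : S :&: Z = Y.
    apply/setP => x; rewrite -VZ !inE; case xZ: (x \in Z); rewrite ?andbF // !andbT.
    apply/idP/idP => [xS|xV]; last by apply: (subsetP YS); rewrite -VZ inE xV.
    by have := subsetP Sc x xS; rewrite inE (disjointFr Zc xZ) orbF.
  (* A set with exactly j + 1 vertices in the cell is compared with its part outside the cell: that
     part plus [gain d j] already bounds an entry of the old [aT] from below. *)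
  have up := pairs_cell e_sym e_irr S Zc; rewrite SZ cE gainS in up.
  have cS' : #|S| = (#|S :\: c| + j).+1 by rewrite -(cardsID c S) cE addnC addnS.
  have S'V : S :\: c \subset V.
    apply/subsetP => x; rewrite inE => /andP[xc xS].
    by have := subsetP Sc x xS; rewrite inE (negbTE xc) orbF.
  have YS' : Y \subset S :\: c.
    by apply/subsetP => x xY; rewrite inE (subsetP YS) // (disjointFr Yc xY).
  have lS' : #|S :\: c| + j <= k by apply: ltnW; rewrite -cS'.
  have o := oT _ YS' S'V lS'.
  rewrite cS' /Tn /= -lt0n (leq_ltn_trans (leq0n _) o) dv; apply/orP; right.
  by apply: leq_ltn_trans up _; rewrite addnA ltn_add2r.
move=> S YS SV lS; have lS' : #|S| + j <= k by rewrite ltnW // -addnS.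
have o := oT S YS SV lS'.
rewrite addnS TE; last by move: lS; rewrite addnS.
rewrite /Tn /= -lt0n (leq_ltn_trans (leq0n _) o) dv gainS.
by rewrite addnA ltn_add2r.
Qed.

Lemma runs_relax j v r s :
  drop j ch = v :: r -> j < k -> cell_inv j s ->
  var s vK = k -> var s vK1 = k.+1 -> var s vX = v.+1 -> var s vJ = j ->
  (forall u : 'I_n, arr s aDY u = deg_in e Y u) ->
  runs w Relax s (100 * k + 60) (fun s' =>
    [/\ cell_inv j.+1 s', var s' vX = arr s aNext v.+1 & var s' vJ = j.+1]).
Proof.
move=> dr jk ci sk sk1 sx sj sd; have w1 := word_gt1 w_ok; have w0 := ltnW w1.
have wn := word_gtn w_ok; have wn2 := word_gt2 w_ok.
have w2 : 2 < cap w by slia.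
have ln := ltn_ord v.
have dle : deg_in e Y v <= n by rewrite -[n in _ <= n]card_ord max_card.
have aw : 2 * (deg_in e Y v + j) < cap w.
  by move: wn2 dle jk k_le_n; clear; nia.
have aw' : deg_in e Y v + j < cap w by slia.
apply: (@runs_seq _ _ _ _ 12 (100 * k + 45)); last by slia.
simple_run; rewrite /= sx subn1 /= sd sj; first by rewrite w1 w2 aw aw' /= andbT; slia.
move=> _; set s1 := set_var _ _ _.
have [js sD sT oD oT] := ci.
apply: (@runs_seq _ _ _ _ (100 * k + 10) 25); last by slia.
apply: (runs_mono (runs_relax_loop (s := s1) (x := v.+1) (a := 2 * (deg_in e Y v + j)) _ _ _ _ _
  _ _)) => //.
- by slia.
- by move=> q lq; apply: sound_le sT lq.
move=> s2 k2 [TE PTE parE DE PE] _.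
have x2 : var s2 vX = v.+1 by rewrite (k2.1 vX isT).
have j2 : var s2 vJ = j by rewrite (k2.1 vJ isT).
have N2 : arr s2 aNext = arr s aNext by rewrite (k2.2 aNext isT).
simple_run; rewrite /= ?x2 ?j2; first by rewrite w0 w1 /=; slia.
split; rewrite /= ?N2 ?addn1 //.
apply: (cell_inv_step dr jk ci) => //=.
by move=> q lq; rewrite ifN ?TE //; case/andP: lq; slia.
Qed.

Lemma runs_add_cell s :
  linked predn (arr s aNext) h.+1 (map \val ch) ->
  var s vU = h -> var s vK = k -> var s vK1 = k.+1 ->
  (forall u : 'I_n, arr s aDY u = deg_in e Y u) ->
  sound (arr s aPar) Y V (arr s aD) (arr s aP) ->
  (forall S : {set 'I_n}, Y \subset S -> S \subset V -> #|S| <= k ->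
     pairs ez S < arr s aD #|S|) ->
  runs w AddCell s (300 * (k * k) + 200) (fun s' =>
    sound (arr s' aPar) Y (V :|: c) (arr s' aD) (arr s' aP) /\
    forall S : {set 'I_n}, Y \subset S -> S \subset V :|: c -> #|S| <= k ->
      pairs ez S < arr s' aD #|S|).
Proof.
move=> lk su sk sk1 sd so op; have w1 := word_gt1 w_ok; have w0 := ltnW w1.
have wn := word_gtn w_ok; have hn := ltn_ord h.
have kk : k <= k * k by rewrite leq_pmulr.
apply: (@runs_seq _ _ _ _ (40 * k + 60) (300 * (k * k) + 130 - 40 * k)); last by slia.
apply: (runs_mono (runs_for (N := k.+1) (B := fun=> 20)
   (I := fun i s' => forall q, q < i -> arr s' aT q = arr s aD q /\ arr s' aPT q = arr s aP q)
   w1 _ sk1 _ _ _ _ (leqnn _))) => //.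
- by slia.
- move=> i s1 k1 i1 I1; simple_run; rewrite /= ?i1 // => _ q.
  rewrite ltnS leq_eqVlt (k1.2 aD isT) (k1.2 aP isT).
  by case: (eqVneq q i) => [->|] //= _ /I1.
- by rewrite sum_nat_const card_ord; slia.
move=> s1 k1 [cp _] _.
apply: (@runs_seq _ _ _ _ 4 (300 * (k * k) + 120 - 40 * k)); last by slia.
have u1 : var s1 vU = h by rewrite (k1.1 vU isT).
simple_run; rewrite /= u1; first by rewrite w1; slia.
move=> _; apply: (@runs_seq _ _ _ _ 2 (300 * (k * k) + 115 - 40 * k)); last by slia.
simple_run; rewrite //= addn1 => _; set s2 := set_var _ _ _.
pose I (j : nat) s' := [/\ keep (wvars Relax) (warrs Relax) s2 s', cell_inv j s',
   linked predn (arr s aNext) (var s' vX) (map \val (drop j ch)) & var s' vJ = j].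
pose Phi j := (k - j) * (100 * k + 70).
have ci0 : cell_inv 0 s2.
  have pre0 (U : {set 'I_n}) : U :|: [set x in take 0 ch] = U.
    by apply/setP => x; rewrite take0 !inE orbF.
  split; rewrite ?pre0 //=.
  - by rewrite (k1.2 aPar isT) (k1.2 aD isT) (k1.2 aP isT).
  - move=> q lq; have [-> ->] := cp q lq; rewrite (k1.2 aPar isT); exact: so.
  - rewrite (k1.2 aD isT) => S YS Sc; rewrite leqn0 cards_eq0 => /eqP S0; apply: op => //.
    apply/subsetP => x xS; have := subsetP Sc x xS; rewrite inE => /orP[//|xc].
    by have := in_set0 x; rewrite -S0 inE xS xc.
  - by move=> S YS SV; rewrite !addn0 => lS; have [-> _] := cp #|S| lS; apply: op.
have I0 : I 0 s2 by split=> //=; rewrite drop0.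
apply: (@runs_mono _ _ _ (Phi 0 + 10) _ (fun s' => ev s' ((0 < $vX) * ($vJ < $vK))%X = 0 /\
  exists j, I j s')) => //.
- apply: (runs_while (I := I) (Phi := Phi) w1 I0) => //.
  + move=> j s3 _ /=; rewrite w0 mulnb /=.
    by case: (_ && _).
  + move=> j s3 [k3 ci3 lk3 j3] /=; rewrite j3 (k3.1 vK isT) /= (k1.1 vK isT) sk mulnb eqb0 negbK.
    move=> /andP[x0 jk].
    have PhiE : Phi j = (100 * k + 70) + Phi j.+1.
      by rewrite /Phi -mulSn; congr (_ * _); slia.
    exists (100 * k + 60); first by rewrite PhiE /=; slia.
    case dr: (drop j ch) lk3 => [|v r] /=; first by case: (var s3 vX) x0.
    move=> /and3P[_ /eqP vx lk'].
    have vX3 : var s3 vX = v.+1 by rewrite -[val v]vx prednK.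
    have sk3 : var s3 vK = k by rewrite (k3.1 vK isT) /= (k1.1 vK isT).
    have sk13 : var s3 vK1 = k.+1 by rewrite (k3.1 vK1 isT) /= (k1.1 vK1 isT).
    apply: (runs_mono (runs_relax dr jk ci3 sk3 sk13 vX3 j3 _)) => //.
      by move=> u; rewrite (k3.2 aDY isT) /= (k1.2 aDY isT).
    move=> s4 k4 [ci4 x4 j4] _; exists j.+1; first by rewrite PhiE /=; slia.
    split=> //; first by apply: keep_trans k3 k4.
    rewrite x4 (k3.2 aNext isT) /= (k1.2 aNext isT) -vX3.
    by have -> : drop j.+1 ch = r by rewrite -add1n -drop_drop dr /= drop0.
  by rewrite /=; slia.
- rewrite /Phi subn0 mulnDr mulnCA; slia.
move=> s3 _ [/= z [j [k3 [js sD sT oD oT] lk3 j3]]].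
have sk3 : var s3 vK = k by rewrite (k3.1 vK isT) /= (k1.1 vK isT).
have prec : [set x in take j ch] \subset c.
  by apply/subsetP => x; rewrite inE => /mem_take; rewrite chE.
split; first by apply: sound_hi sD; apply: setUS.
move=> S YS Sc lS; apply: oD => //.
(* The loop ends after k vertices, and no candidate uses more, or when the clique is exhausted. *)
have [kj|jk] := leqP k j.
  by apply: leq_trans kj; apply: leq_trans lS; apply: subset_leq_card; apply: subsetIl.
move: z; rewrite j3 sk3 jk muln1 => /eqP; rewrite eqb0 -eqn0Ngt => x0.
case dr: (drop j ch) lk3 => [|v r] /=; last by rewrite x0.
have sz : size ch <= j by rewrite -subn_eq0 -size_drop dr.
move=> _; apply: leq_trans sz; rewrite -(card_uniqP ch_uniq).
apply: leq_trans (subset_leq_card (subsetIr _ _)) _.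
by apply/eq_leq/esym/eq_card.
Qed.

End OneCell.
End AddCell.

(** * Trying one subset of half of the cover *)

Notation vLo := 28 (only parsing).
Notation vHi := 29 (only parsing).
Notation vDone := 30 (only parsing).
Notation vEy := 31 (only parsing).
Notation vBest := 32 (only parsing).
Notation vP := 33 (only parsing).

Definition Degrees : cmd :=
  vCnt ::= 0 ;; vEy ::= 0 ;;
  For vU vN
    (SumAdj (Get aInY $vV) ;;
     Put aDY $vU $vF ;;
     vCnt ::= $vCnt + Get aInY $vU ;;
     vEy ::= $vEy + Get aInY $vU * $vF).

Definition InitTables : cmd :=
  For vR vK1 (Put aD $vR 0) ;;
  Put aD $vCnt ($vEy + 1) ;;
  vQ ::= 0 ;; vP ::= 0 ;;
  For vU vN
    (If (Get aInY $vU)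
       (vQ ::= $vQ + 1 ;;
        Put aPar (($vU + 1) * $vK1 + $vQ) $vP ;;
        vP ::= ($vU + 1) * $vK1 + $vQ) Skip) ;;
  Put aP $vCnt $vP.

Definition Knapsack (half : nat) : cmd :=
  For vU vN
    (If ((0 < Get aXH $vU + (Get aHead (Get aCls $vU) == $vU + 1)) *
         ((Get aXH $vU == half) == 0)) AddCell Skip).

Definition Record : cmd :=
  If ($vBest < Get aD $vK)
    (vBest ::= Get aD $vK ;;
     For vU vN (Put aOut $vU 0) ;;
     vP ::= Get aP $vK ;;
     For vR vK (Put aOut ($vP / $vK1 - 1) 1 ;; vP ::= Get aPar $vP)) Skip.

Definition Try (half : nat) : cmd :=
  Degrees ;; If ($vK < $vCnt) Skip (InitTables ;; Knapsack half ;; Record).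

Section Try.
Variables (n k : nat) (e : rel 'I_n) (adj : 'I_n -> seq 'I_n) (w : nat).
Hypothesis e_sym : symmetric e.
Hypothesis e_irr : irreflexive e.
Hypothesis adjP : adjacency_lists e adj.
Hypothesis w_ok : word_size_ok 6 n w.
Hypothesis k_gt0 : 0 < k.
Hypothesis k_le_n : k <= n.
Local Notation M := (off adj n).

Lemma runs_degrees s (Y : {set 'I_n}) :
  has_input k adj s -> stores (arr s aInY) 0 Y ->
  runs w Degrees s (100 * (n + M) + 30) (fun s' =>
    [/\ forall u : 'I_n, arr s' aDY u = deg_in e Y u, var s' vCnt = #|Y|
      & var s' vEy = pairs e Y]).
Proof.
move=> hs sY; have w1 := word_gt1 w_ok; have w0 := ltnW w1.
have wn := word_gtn w_ok; have wn2 := word_gt2 w_ok.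
apply: (@runs_seq _ _ _ _ 2 (100 * (n + M) + 26)); last by slia.
simple_run; rewrite //= => _.
apply: (@runs_seq _ _ _ _ 2 (100 * (n + M) + 23)); last by slia.
simple_run; rewrite //= => _; set s0 := set_var _ _ _.
pose I u s' := [/\ forall v : 'I_n, v < u -> arr s' aDY v = deg_in e Y v,
   var s' vCnt = \sum_(v < n | v < u) (v \in Y)
   & var s' vEy = \sum_(v < n | v < u) (v \in Y) * deg_in e Y v].
have sumS (F : 'I_n -> nat) (u : 'I_n) :
    \sum_(v < n | v < u.+1) F v = \sum_(v < n | v < u) F v + F u.
  rewrite (bigD1 u) //= addnC; congr (_ + _); apply: eq_bigl => v.
  by rewrite ltnS ltn_neqAle andbC.
have dle v : deg_in e Y v <= n by rewrite -[n in _ <= n]card_ord max_card.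
have cntle u : \sum_(v < n | v < u) (v \in Y) <= n.
  apply: (@leq_trans (\sum_(v < n) 1)); last by rewrite sum1_card card_ord.
  by rewrite big_mkcond; apply: leq_sum => v _; case: ifP => // _; apply: leq_b1.
have eyle u : \sum_(v < n | v < u) (v \in Y) * deg_in e Y v <= n * n.
  apply: (@leq_trans (\sum_(v < n) n)); last by rewrite sum_nat_const card_ord.
  by rewrite big_mkcond; apply: leq_sum => v _; case: ifP => // _; case: (v \in Y); rewrite
    ?mul1n.
apply: (runs_mono (runs_for (N := n) (I := I)
   (B := fun i => 45 * size (adj i) + 60) w1 _ _ _ _ _ _ (leqnn _))) => //.
- by slia.
- by case: hs.
- by split=> //=; rewrite big1.
- move=> u s1 k1 u1 [D1 C1 E1].
  have hs1 : has_input k adj s1 by apply: has_input_keep k1 _ _ _ _ _.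
  have Y1 : stores (arr s1 aInY) 0 Y by move=> v; rewrite (k1.2 aInY isT); apply: sY.
  apply: (@runs_seq _ _ _ _ (45 * size (adj u) + 30) 29); last by slia.
  apply: (runs_mono (runs_sum (T := 45 * size (adj u) + 30) (g := fun v => v \in Y) adjP w_ok hs1
    u1 _ _)) => //.
    move=> s2 k2 v sv /=; rewrite sv (k2.2 aInY isT) (Y1 v); split=> //.
    exact: leq_b1.
    by apply: leq_add => //; apply: leq_mul.
  move=> s2 k2 F2 _.
  have u2 : var s2 vU = u by rewrite (k2.1 vU isT).
  have FE : var s2 vF = deg_in e Y u.
    rewrite F2 /deg_in -(card_nbrs e) big_mkcond [RHS]big_mkcond; apply: eq_bigr => v _.
    by case: (e u v); case: (v \in Y).
  have Y2 : arr s2 aInY u = (u \in Y) by rewrite (k2.2 aInY isT); apply: Y1.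
  have C2 : var s2 vCnt = \sum_(v < n | v < u) (v \in Y) by rewrite (k2.1 vCnt isT).
  have E2 : var s2 vEy = \sum_(v < n | v < u) (v \in Y) * deg_in e Y v by rewrite (k2.1 vEy isT).
  have cS := cntle u.+1; have eS := eyle u.+1; rewrite !sumS in cS eS.
  have ml : (u \in Y) * deg_in e Y u <= n by case: (u \in Y); rewrite ?mul1n.
  simple_run; rewrite /= u2 Y2 C2 E2 FE.
    by apply/andP; split; [slia|apply/andP; split; move: wn2 ml eS; clear; nia].
  move=> _; split; rewrite /= ?sumS //.
  move=> v; rewrite ltnS leq_eqVlt (k2.2 aDY isT).
  by case: (v =P u :> nat) => [/val_inj->|] //= _ /D1.
- under eq_bigr do rewrite -addnA; rewrite sum_deg; slia.
move=> s' _ [[D1 C1 E1] _]; split=> [u||]; first exact: D1.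
  rewrite C1 -sum1_card [RHS]big_mkcond /=; apply: eq_big => v; first by rewrite ltn_ord.
  by case: (v \in Y).
rewrite E1 /pairs [RHS]big_mkcond /=; apply: eq_big => v; first by rewrite ltn_ord.
by rewrite card_nbrs /deg_in; case: (v \in Y); rewrite ?mul1n.
Qed.

Local Notation sound := (sound k e).

Lemma runs_init s (Y : {set 'I_n}) :
  has_input k adj s -> stores (arr s aInY) 0 Y -> var s vCnt = #|Y| -> #|Y| <= k ->
  var s vEy = pairs e Y -> var s vK1 = k.+1 ->
  runs w InitTables s (100 * n + 100) (fun s' =>
    sound (arr s' aPar) Y Y (arr s' aD) (arr s' aP) /\ pairs e Y < arr s' aD #|Y|).
Proof.
move=> hs sY sC cY sE sk1; have w1 := word_gt1 w_ok; have w0 := ltnW w1.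
have wn := word_gtn w_ok; have wn2 := word_gt2 w_ok.
have pw : pairs e Y + 1 < cap w.
  have Yn : #|Y| <= n by apply: leq_trans cY k_le_n.
  have := leq_trans (pairs_le e Y) (leq_mul Yn Yn).
  by move: wn2; clear; nia.
apply: (@runs_seq _ _ _ _ (20 * k + 40) (80 * n + 55)); last by slia.
apply: (runs_mono (runs_for (N := k.+1) (B := fun=> 10)
   (I := fun i s' => forall q, q < i -> arr s' aD q = 0)
   w1 _ sk1 _ _ _ _ (leqnn _))) => //.
- by slia.
- move=> i s1 k1 i1 I1; simple_run; rewrite /= ?i1 // => _ q.
  by rewrite ltnS leq_eqVlt; case: (eqVneq q i) => [->|] //= _ /I1.
- by rewrite sum_nat_const card_ord; slia.
move=> s1 k1 [D1 _] _.
have C1 : var s1 vCnt = #|Y| by rewrite (k1.1 vCnt isT).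
have E1 : var s1 vEy = pairs e Y by rewrite (k1.1 vEy isT).
apply: (@runs_seq _ _ _ _ 6 (80 * n + 48)); last by slia.
simple_run; rewrite /= ?C1 E1; first by rewrite w1.
move=> _; apply: (@runs_seq _ _ _ _ 2 (80 * n + 45)); last by slia.
simple_run; rewrite //= => _; apply: (@runs_seq _ _ _ _ 2 (80 * n + 42)); last by slia.
simple_run; rewrite //= => _; set s2 := set_var _ _ _.
pose I (u : nat) s' := exists l : seq 'I_n,
  [/\ linked (vert k.+1) (arr s' aPar) (var s' vP) (map \val l), uniq l,
      var s' vQ = size l & forall v : 'I_n, (v \in l) = (v \in Y) && (v < u)].
apply: (@runs_seq _ _ _ _ (70 * n + 20) 10); last by slia.
apply: (runs_mono (runs_for (N := n) (B := fun=> 60) (I := I) w1 _ _ _ _ _ _ (leqnn _))) => //.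
- by slia.
- by rewrite /= (k1.1 vN isT); case: hs.
- by exists [::]; split=> // v; rewrite andbF.
- move=> u s3 k3 u3 [l [lk un Q3 ml]].
  have ln := ltn_ord u.
  have Y3 : arr s3 aInY u = (u \in Y) by rewrite (k3.2 aInY isT) /= (k1.2 aInY isT); apply: sY.
  have K3 : var s3 vK1 = k.+1 by rewrite (k3.1 vK1 isT) /= (k1.1 vK1 isT).
  case: (boolP (u \in Y)) => uY; last first.
    simple_run; rewrite /= u3 Y3 (negbTE uY) //= => _; exists l; split=> // v.
    rewrite ml ltnS [v <= u]leq_eqVlt (inj_eq val_inj).
    by case: (eqVneq v u) => // ->; rewrite (negbTE uY).
  have ul : u \notin l by rewrite ml ltnn andbF.
  have lY : (size l).+1 <= #|Y|.
    have -> : (size l).+1 = #|u :: l| by rewrite (card_uniqP _) //= ul.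
    apply: subset_leq_card; apply/subsetP => v; rewrite inE => /orP[/eqP->//|].
    by rewrite ml => /andP[].
  have xw : u.+1 * k.+1 < cap w by move: wn2 ln k_le_n; clear; nia.
  have xqw : u.+1 * k.+1 + (size l).+1 < cap w by move: wn2 ln k_le_n lY cY; clear; nia.
  have vx q : q <= k -> (u.+1 * k.+1 + q) %/ k.+1 = u.+1.
    by move=> lq; rewrite divnMDl // divn_small ?addn0.
  have lk1 : (size l).+1 <= k by apply: leq_trans lY cY.
  simple_run; rewrite /= u3 Y3 uY /= Q3 K3 !addn1.
    by rewrite w1 xw xqw /=; slia.
  move=> _; exists (u :: l); split=> /=.
  + rewrite {1}/vert vx // !eqxx /=.
    apply: linked_eq lk => q q0 ql; rewrite ifN //; apply: contraTneq ql => ->.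
    by rewrite /vert vx //= (mem_map val_inj).
  + by rewrite ul.
  + by [].
  move=> v; rewrite inE ml ltnS [v <= u]leq_eqVlt (inj_eq val_inj).
  by case: (eqVneq v u) => [->|]; rewrite ?uY.
- by rewrite sum_nat_const card_ord; slia.
move=> s3 k3 [[l [lk un Q3 ml]] k3'] _.
have C3 : var s3 vCnt = #|Y| by rewrite (k3.1 vCnt isT).
have mY v : (v \in l) = (v \in Y) by rewrite ml ltn_ord andbT.
have lE : [set x in l] = Y by apply/setP => v; rewrite inE mY.
have D3 : arr s3 aD = (fun q => if q == #|Y| then pairs e Y + 1 else arr s1 aD q).
  by rewrite (k3.2 aD isT).
simple_run; rewrite //= C3 D3 eqxx addn1; split=> // q lq.
case: (eqVneq q #|Y|) => [->|ne]; last by rewrite D1.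
move=> _; exists l; rewrite lE; split=> //.
by rewrite -(card_uniqP un); apply/esym/eq_card => v; rewrite mY.
Qed.

Lemma runs_knapsack s half (X Z Y hd : {set 'I_n}) ch :
  half < cap w ->
  has_input k adj s -> chained e X hd ch s ->
  (forall v : 'I_n, (arr s aXH v == half) = (v \in Z)) -> (forall v : 'I_n, arr s aXH v <= 2) ->
  Z \subset X -> Y \subset Z -> var s vK1 = k.+1 ->
  (forall u : 'I_n, arr s aDY u = deg_in e Y u) ->
  sound (arr s aPar) Y Y (arr s aD) (arr s aP) ->
  pairs (edge_at e X Z) Y < arr s aD #|Y| ->
  runs w (Knapsack half) s (n * (300 * (k * k) + 250) + 10) (fun s' =>
    sound (arr s' aPar) Y setT (arr s' aD) (arr s' aP) /\
    forall S : {set 'I_n}, S :&: Z = Y -> #|S| <= k ->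
      pairs (edge_at e X Z) S < arr s' aD #|S|).
Proof.
move=> halfw hs [hdE chE cov disj] sZ s2 ZX YZ sk1 sD so op.
have w1 := word_gt1 w_ok; have w0 := ltnW w1.
have wn := word_gtn w_ok; have wn2 := word_gt2 w_ok.
have sk : var s vK = k by case: hs.
pose c := cell e X.
(* Vertices allowed so far: [Y] and the complete cells, outside [Z], of the representatives below
   i. *)
pose V (i : nat) := Y :|: \bigcup_(h | [&& h \in hd, h \notin Z & h < i]) c h.
have cZ (h : 'I_n) : h \notin Z -> [disjoint Z & c h].
  move=> hZ; rewrite /c /cell disjoint_subset; apply/subsetP => x xZ; rewrite inE.
  case: ifP => hX; rewrite inE; first by apply: contraNneq hZ => <-.
  by rewrite (subsetP ZX _ xZ).
have VZ i : V i :&: Z = Y.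
  apply/setP => x; rewrite !inE; case xZ: (x \in Z); last first.
    by rewrite andbF; apply/esym/negbTE; apply: contraFN xZ; apply: (subsetP YZ).
  rewrite andbT orb_idr // => /bigcupP[h /and3P[_ hZ _]].
  by rewrite (disjointFr (cZ h hZ) xZ).
have YV i : Y \subset V i by apply: subsetUl.
have VS (u : 'I_n) : V u.+1 = V u :|: (if (u \in hd) && (u \notin Z) then c u else set0).
  rewrite /V -setUA; congr (_ :|: _); apply/setP => x; rewrite in_setU.
  apply/bigcupP/orP => [[h /and3P[hh hZ]]|].
    rewrite ltnS leq_eqVlt => /orP[/eqP/val_inj E|hu] xh; last first.
      by left; apply/bigcupP; exists h; rewrite ?hh ?hZ.
    by right; rewrite -E hh hZ.
  case=> [/bigcupP[h /and3P[hh hZ hu]] xh|]; first by exists h; rewrite // hh hZ ltnW.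
  by case: ifP => [/andP[hh hZ] xu|_]; [exists u; rewrite // hh hZ ltnSn|rewrite inE].
have Vc (u : 'I_n) : u \in hd -> u \notin Z -> [disjoint V u & c u].
  move=> uh uZ; rewrite disjoint_subset; apply/subsetP => x; rewrite !inE => /orP[/(subsetP YZ)
    xZ|].
    by rewrite (disjointFr (cZ u uZ) xZ).
  case/bigcupP => h /and3P[hh hZ hu] xh; apply/negP => xu.
  have hu' : h \in c u by rewrite /c -(cell_eq xu) (cell_eq xh); apply: cell_id.
  by move: hu; rewrite (disj u h uh hh hu') ltnn.
pose I i s' := sound (arr s' aPar) Y (V i) (arr s' aD) (arr s' aP) /\
  forall S : {set 'I_n}, Y \subset S -> S \subset V i -> #|S| <= k ->
     pairs (edge_at e X Z) S < arr s' aD #|S|.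
apply: (runs_mono (runs_for (N := n) (B := fun=> 300 * (k * k) + 230) (I := I) w1 _ _ _ _ _ _
  (leqnn _))) => //.
- by slia.
- by case: hs.
- have V0 : V 0 = Y.
    apply/setP => x; rewrite !inE orb_idr // => /bigcupP[h].
    by rewrite ltn0 !andbF.
  split; rewrite /= V0 // => S YS SY lS.
  by have -> : S = Y by apply/eqP; rewrite eqEsubset YS SY.
- move=> u s1 k1 u1 [so1 op1].
  have H1 : (0 < arr s1 aXH u + (arr s1 aHead (arr s1 aCls u) == u + 1)) = (u \in hd).
    by rewrite (k1.2 aXH isT) (k1.2 aHead isT) (k1.2 aCls isT) addn1 -hdE lt0n addn_eq0 negb_and
      eqb0 negbK.
  have Z1 : (arr s1 aXH u == half) = (u \in Z) by rewrite (k1.2 aXH isT).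
  have x1 : arr s1 aXH u <= 2 by rewrite (k1.2 aXH isT).
  have fw : arr s1 aXH u + (arr s1 aHead (arr s1 aCls u) == u + 1) < cap w.
    by apply: leq_ltn_trans (leq_add x1 (leq_b1 _)) _; slia.
  have uw : u + 1 < cap w by have := ltn_ord u; slia.
  apply: (@runs_if _ _ _ _ _ (300 * (k * k) + 200)) => //.
  + by rewrite /= u1 fw uw w0 w1 halfw mulnb /=; case: (_ && _).
  + rewrite /= u1 H1 Z1 eqb0 mulnb eqb0 negbK => /andP[uh uZ].
    have [lk un me] := chE u uh.
    have K1 : var s1 vK = k by rewrite (k1.1 vK isT).
    have KK1 : var s1 vK1 = k.+1 by rewrite (k1.1 vK1 isT).
    have lk1 : linked predn (arr s1 aNext) u.+1 (map \val (ch u)) by rewrite (k1.2 aNext isT).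
    have D1 (v : 'I_n) : arr s1 aDY v = deg_in e Y v by rewrite (k1.2 aDY isT).
    apply: (runs_mono (runs_add_cell e_sym e_irr w_ok k_gt0 k_le_n un me (cZ u uZ) (VZ u) (Vc u
      uh uZ) lk1 u1 K1 KK1 D1 so1 op1)) => //.
    move=> s3 k3 [so3 op3] _; split; rewrite VS uh uZ //=.
  + rewrite /= u1 H1 Z1 eqb0 mulnb => /eqP; rewrite eqb0 => nu.
    apply: runs_simple => //; first by rewrite /=; slia.
    by move=> _; split; rewrite VS (negbTE nu) setU0.
  by rewrite /=; slia.
- by rewrite sum_nat_const card_ord mulnDr; slia.
move=> s1 _ [[so1 op1] _]; split; first by apply: sound_hi so1; apply: subsetT.
move=> S SZ lS; apply: op1 => //; first by rewrite -SZ subsetIl.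
apply/subsetP => x xS; case xZ: (x \in Z).
  by apply: (subsetP (YV n)); rewrite -SZ inE xS.
(* A representative in [Z] is a cover vertex, so its cell is a singleton contained in [Z]. *)
have [h hh xh] := cov x; have hZ : h \notin Z.
  apply: contraFN xZ => hZ; move: xh; rewrite /cell (subsetP ZX _ hZ) inE => /eqP ->.
  exact: hZ.
by rewrite inE; apply/orP; right; apply/bigcupP; exists h; rewrite // hh hZ ltn_ord.
Qed.

(** Both halves share this record, so the better of the two results survives without a final
    comparison. *)
Definition best_ok (s : state) :=
  var s vBest != 0 -> #|output n s| = k /\ var s vBest <= (pairs e (output n s)).+1.

Lemma runs_record s (Y : {set 'I_n}) :
  has_input k adj s -> var s vK1 = k.+1 ->
  sound (arr s aPar) Y setT (arr s aD) (arr s aP) -> best_ok s ->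
  runs w Record s (100 * n + 100) (fun s' =>
    [/\ best_ok s', var s vBest <= var s' vBest & arr s aD k <= var s' vBest]).
Proof.
move=> hs sk1 so bo; have w1 := word_gt1 w_ok; have w0 := ltnW w1.
have wn := word_gtn w_ok; have wn2 := word_gt2 w_ok.
have sk : var s vK = k by case: hs.
apply: (@runs_if _ _ _ _ _ (100 * n + 90)) => //=; last by slia.
  rewrite sk => lt; have {}lt : var s vBest < arr s aD k by move: lt; case: (_ < _).
  have nz : arr s aD k != 0 by rewrite -lt0n (leq_ltn_trans (leq0n _) lt).
  have [l [lk un sl [_ _] vl]] := so k (leqnn _) nz.
  apply: (@runs_seq _ _ _ _ 3 (100 * n + 85)); last by slia.
  simple_run; rewrite //= sk => _; set s1 := set_var _ _ _.
  apply: (@runs_seq _ _ _ _ (20 * n + 10) (80 * n + 70)); last by slia.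
  apply: (runs_mono (runs_for (N := n) (B := fun=> 10)
    (I := fun i s' => forall q, q < i -> arr s' aOut q = 0)
    w1 _ _ _ _ _ _ (leqnn _))) => //.
  - by slia.
  - by case: hs.
  - move=> i s2 k2 i2 I2; simple_run; rewrite /= ?i2 // => _ q.
    by rewrite ltnS leq_eqVlt; case: (eqVneq q i) => [->|] //= _ /I2.
  - by rewrite sum_nat_const card_ord; slia.
  move=> s2 k2 [O2 _] _.
  have K2 : var s2 vK = k by rewrite (k2.1 vK isT).
  have P2 : arr s2 aP = arr s aP by rewrite (k2.2 aP isT).
  apply: (@runs_seq _ _ _ _ 3 (80 * n + 60)); last by slia.
  simple_run; rewrite //= K2 P2 => _; set s3 := set_var _ _ _.
  pose I i s' := linked (vert k.+1) (arr s aPar) (var s' vP) (map \val (drop i l)) /\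
    forall v : 'I_n, (arr s' aOut v != 0) = (v \in take i l).
  apply: (runs_mono (runs_for (N := k) (B := fun=> 30) (I := I) w1 _ _ _ _ _ _ (leqnn _))) => //.
  - by slia.
  - by split=> [|v]; rewrite /= ?drop0 // take0 in_nil O2.
  - move=> i s4 k4 i4 [lk4 O4].
    have li : i < size l by rewrite sl.
    have K4 : var s4 vK1 = k.+1 by rewrite (k4.1 vK1 isT) /= (k2.1 vK1 isT).
    have R4 : arr s4 aPar = arr s aPar by rewrite (k4.2 aPar isT) /= (k2.2 aPar isT).
    case dr: (drop i l) lk4 => [|v r] /=.
      by have := size_drop i l; rewrite dr /= => /esym/eqP; rewrite subn_eq0 leqNgt li.
    move=> /and3P[p0 /eqP pv lk'].
    have drS : drop i.+1 l = r by rewrite -add1n -drop_drop dr /= drop0.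
    have takeS : take i.+1 l = rcons (take i l) v.
      by rewrite (take_nth v li); congr rcons; rewrite -[i : nat]addn0 -nth_drop dr.
    have pv' : var s4 vP %/ k.+1 - 1 = v by rewrite subn1.
    have vw := ltn_ord v.
    have dw : var s4 vP %/ k.+1 < cap w.
      have : var s4 vP %/ k.+1 <= v.+1 by rewrite -pv' subn1; case: (_ %/ _).
      by move: vw wn; clear; slia.
    simple_run; rewrite /= K4 pv' ?dw ?w1 /=; first by slia.
    move=> _; split=> /=; first by rewrite R4 drS.
    move=> u; rewrite takeS mem_rcons inE (inj_eq val_inj).
    by case: (eqVneq u v) => //= _; apply: O4.
  - by rewrite sum_nat_const card_ord; slia.
  move=> s4 k4 [[_ O4] _].
  have outE : output n s4 = [set x in l].
    by apply/setP => v; rewrite !inE O4 -sl take_size.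
  have B4 : var s4 vBest = arr s aD k by rewrite (k4.1 vBest isT) /= (k2.1 vBest isT).
  split; rewrite ?B4 //; last exact: ltnW.
  move=> _; rewrite outE B4; split=> //.
  by rewrite cardsE (card_uniqP un).
rewrite sk => /eqP; rewrite eqb0 -leqNgt => ge.
by apply: runs_simple => //=; slia.
Qed.

Lemma runs_try s half (X Z Y hd : {set 'I_n}) ch :
  half < cap w ->
  has_input k adj s -> chained e X hd ch s ->
  (forall v : 'I_n, (arr s aXH v == half) = (v \in Z)) -> (forall v : 'I_n, arr s aXH v <= 2) ->
  Z \subset X -> Y \subset Z -> var s vK1 = k.+1 ->
  stores (arr s aInY) 0 Y -> best_ok s ->
  runs w (Try half) s (1000 * (n * (k * k) + M) + 1000) (fun s' =>
    [/\ best_ok s', var s vBest <= var s' vBest &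
      forall S : {set 'I_n}, S :&: Z = Y -> #|S| = k ->
        pairs (edge_at e X Z) S < var s' vBest]).
Proof.
move=> halfw hs chd sZ s2 ZX YZ sk1 sY bo.
have w1 := word_gt1 w_ok; have kk : k <= k * k by rewrite leq_pmulr.
have nkk : n <= n * (k * k) by rewrite leq_pmulr // muln_gt0 k_gt0.
set K := n * (k * k) in nkk *.
have KE : n * (300 * (k * k) + 250) = 300 * K + 250 * n by rewrite /K; nia.
have [hdE chE cov disj] := chd.
apply: (@runs_seq _ _ _ _ (100 * (n + M) + 30) (900 * K + 900 * M + 900)); last by slia.
apply: (runs_mono (runs_degrees hs sY)) => // s3 k3 [D3 C3 E3] _.
have hs3 : has_input k adj s3 by apply: has_input_keep k3 _ _ _ _ hs.
have K3 : var s3 vK1 = k.+1 by rewrite (k3.1 vK1 isT).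
have B3 : var s3 vBest = var s vBest by rewrite (k3.1 vBest isT).
have O3 : output n s3 = output n s by rewrite /output (k3.2 aOut isT).
have bo3 : best_ok s3 by rewrite /best_ok B3 O3.
have sk3 : var s3 vK = k by case: hs3.
have YS (S : {set 'I_n}) : S :&: Z = Y -> #|Y| <= #|S| by move=> <-; apply: subset_leq_card;
  apply: subsetIl.
apply: (@runs_if _ _ _ _ _ (900 * K + 890)) => //=; last by slia.
  rewrite sk3 C3 => lt; have {}lt : k < #|Y| by move: lt; case: (_ < _).
  apply: runs_simple => //=; first by slia.
  split; rewrite ?B3 // => S SZ lS.
  by have := YS S SZ; rewrite lS leqNgt lt.
rewrite sk3 C3 => /eqP; rewrite eqb0 -leqNgt => le.
have sY3 : stores (arr s3 aInY) 0 Y by move=> v; rewrite (k3.2 aInY isT); apply: sY.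
apply: (@runs_seq _ _ _ _ (100 * n + 100) (800 * K + 700)); last by slia.
apply: (runs_mono (runs_init hs3 sY3 C3 le E3 K3)) => // s4 k4 [so4 op4] _.
have hs4 : has_input k adj s4 by apply: has_input_keep k4 _ _ _ _ hs3.
have ch4 : chained e X hd ch s4.
  by split; rewrite ?(k4.2 aXH isT) ?(k4.2 aHead isT) ?(k4.2 aCls isT) ?(k4.2 aNext isT)
    ?(k3.2 aXH isT) ?(k3.2 aHead isT) ?(k3.2 aCls isT) ?(k3.2 aNext isT).
have sZ4 (v : 'I_n) : (arr s4 aXH v == half) = (v \in Z).
  by rewrite (k4.2 aXH isT) (k3.2 aXH isT).
have s24 (v : 'I_n) : arr s4 aXH v <= 2 by rewrite (k4.2 aXH isT) (k3.2 aXH isT).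
have K4 : var s4 vK1 = k.+1 by rewrite (k4.1 vK1 isT).
have D4 (u : 'I_n) : arr s4 aDY u = deg_in e Y u by rewrite (k4.2 aDY isT).
have op4' : pairs (edge_at e X Z) Y < arr s4 aD #|Y|.
  apply: leq_ltn_trans op4; rewrite /pairs; apply: leq_sum => u _; apply: leq_sum => v _.
  by rewrite /edge_at; case: (e u v); rewrite ?leq_b1.
apply: (@runs_seq _ _ _ _ (300 * K + 250 * n + 10) (100 * n + 100)); last by slia.
rewrite -KE; apply: (runs_mono (runs_knapsack halfw hs4 ch4 sZ4 s24 ZX YZ K4 D4 so4 op4')) => //
  s5 k5 [so5 op5] _.
have hs5 : has_input k adj s5 by apply: has_input_keep k5 _ _ _ _ hs4.
have K5 : var s5 vK1 = k.+1 by rewrite (k5.1 vK1 isT).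
have B5 : var s5 vBest = var s vBest by rewrite (k5.1 vBest isT) (k4.1 vBest isT).
have bo5 : best_ok s5 by rewrite /best_ok B5 /output (k5.2 aOut isT) (k4.2 aOut isT) (k3.2 aOut
  isT).
apply: (runs_mono (runs_record hs5 K5 so5 bo5)) => // s6 k6 [bo6 le6 D6].
split=> //; first by rewrite -B5.
by move=> S SZ lS; apply: leq_trans D6; rewrite -lS; apply: op5; rewrite ?lS.
Qed.

End Try.

(** * Enumerating the subsets of half of the cover *)

(* The indicator of [Y] along the list of [Z] serves as a binary counter: the number of
   subsets may exceed the largest word. *)
Definition Increment : cmd :=
  vIdx ::= $vLo ;;
  While (($vIdx < $vHi) * Get aInY (Get aXL $vIdx))
    (Put aInY (Get aXL $vIdx) 0 ;; vIdx ::= $vIdx + 1) ;;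
  If ($vIdx < $vHi) (Put aInY (Get aXL $vIdx) 1) (vDone ::= 1).

Definition Enumerate (half : nat) : cmd :=
  vDone ::= 0 ;; While ($vDone == 0) (Try half ;; Increment).

(** Value of the counter, least significant bit first. It lives in the proof only and is never
    stored in a word. *)
Fixpoint code (T : finType) (zs : seq T) (Y : {set T}) : nat :=
  if zs is z :: zs' then (z \in Y) + 2 * code zs' Y else 0.

Lemma code_lt (T : finType) (zs : seq T) Y : code zs Y < 2 ^ size zs.
Proof.
elim: zs => //= z zs IH; rewrite expnS; move: IH; case: (z \in Y); slia.
Qed.

Lemma code_eq (T : finType) (zs : seq T) (Y Y' : {set T}) :
  code zs Y = code zs Y' -> forall z, z \in zs -> (z \in Y) = (z \in Y').
Proof.
elim: zs => //= z zs IH E x; rewrite inE => /orP[/eqP->|]; last first.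
  by apply: IH; move: E; case: (z \in Y); case: (z \in Y'); slia.
by move: E; case: (z \in Y); case: (z \in Y') => //=; slia.
Qed.

Lemma code_ext (T : finType) (zs : seq T) (Y Y' : {set T}) :
  (forall z, z \in zs -> (z \in Y) = (z \in Y')) -> code zs Y = code zs Y'.
Proof.
elim: zs => //= z zs IH H; rewrite H ?inE ?eqxx // IH // => x xz.
by apply: H; rewrite inE xz orbT.
Qed.

Lemma code_full (T : finType) (zs : seq T) (Y : {set T}) :
  {subset zs <= Y} -> (code zs Y).+1 = 2 ^ size zs.
Proof.
elim: zs => //= z zs IH H; rewrite H ?inE ?eqxx // expnS -IH; last first.
  by move=> x xz; apply: H; rewrite inE xz orbT.
by slia.
Qed.

(** The carry: the initial run [a] of ones is cleared and the first zero [z] is set. *)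
Lemma code_succ (T : finType) (a b : seq T) z (Y : {set T}) :
  uniq (a ++ z :: b) -> {subset a <= Y} -> z \notin Y ->
  code (a ++ z :: b) (z |: (Y :\: [set x in a])) = (code (a ++ z :: b) Y).+1.
Proof.
elim: a Y => [|y a IH] Y /=.
  move=> /andP[zb _] _ zY; rewrite !inE eqxx (negbTE zY) /=.
  rewrite (code_ext (Y' := Y)) // => x xb; rewrite !inE.
  by rewrite (_ : x == z = false) //; apply: contraNF zb => /eqP <-.
move=> /andP[yab un] sub zY; have yY : y \in Y by apply: sub; rewrite inE eqxx.
have sub' : {subset a <= Y} by move=> x xa; apply: sub; rewrite inE xa orbT.
rewrite yY (_ : y \in _ = false); last first.
  rewrite !inE eqxx /= orbF; apply: contraNF yab => /eqP->.
  by rewrite mem_cat inE eqxx orbT.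
rewrite (code_ext (Y' := z |: (Y :\: [set x in a]))) ?IH //; first by slia.
move=> x xab; rewrite !inE (_ : x == y = false) //.
by apply: contraNF yab => /eqP <-.
Qed.

Section Enumerate.
Variables (n k : nat) (e : rel 'I_n) (adj : 'I_n -> seq 'I_n) (w : nat).
Hypothesis e_sym : symmetric e.
Hypothesis e_irr : irreflexive e.
Hypothesis adjP : adjacency_lists e adj.
Hypothesis w_ok : word_size_ok 6 n w.
Hypothesis k_gt0 : 0 < k.
Hypothesis k_le_n : k <= n.
Local Notation M := (off adj n).

(** On overflow the counter is back at zero, the state from which the enumeration of the other half
    starts. *)
Lemma runs_increment s lo (zs : seq 'I_n) (Y : {set 'I_n}) :
  uniq zs -> lo + size zs <= n -> var s vLo = lo -> var s vHi = lo + size zs ->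
  (forall a z b, zs = a ++ z :: b -> arr s aXL (lo + size a) = z) ->
  Y \subset [set x in zs] -> stores (arr s aInY) 0 Y -> var s vDone = 0 ->
  runs w Increment s (30 * n + 40) (fun s' =>
    (var s' vDone = 1 /\ stores (arr s' aInY) 0 (set0 : {set 'I_n}) /\ (code zs Y).+1 = 2 ^ size
      zs) \/
    exists Y' : {set 'I_n}, [/\ var s' vDone = 0, stores (arr s' aInY) 0 Y',
      Y' \subset [set x in zs] & code zs Y' = (code zs Y).+1]).
Proof.
move=> un ln slo shi xl Yz sY sd; have w1 := word_gt1 w_ok; have w0 := ltnW w1.
have wn := word_gtn w_ok.
apply: (@runs_seq _ _ _ _ 2 (30 * n + 30)); last by slia.
simple_run; rewrite //= slo => _; set s1 := set_var _ _ _.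
pose body := Put aInY (Get aXL $vIdx) 0 ;; vIdx ::= $vIdx + 1.
pose I (a : seq 'I_n) s' := [/\ keep (wvars body) (warrs body) s1 s',
   exists b, zs = a ++ b, {subset a <= Y}, var s' vIdx = lo + size a &
   stores (arr s' aInY) 0 (Y :\: [set x in a])].
pose Phi (a : seq 'I_n) := (size zs - size a) * 25.
have hi1 s' : keep (wvars body) (warrs body) s1 s' -> var s' vHi = lo + size zs.
  by move=> k'; rewrite (k'.1 vHi isT).
have xl1 s' a z b : keep (wvars body) (warrs body) s1 s' -> zs = a ++ z :: b ->
    arr s' aXL (lo + size a) = z.
  by move=> k' /xl; rewrite (k'.2 aXL isT).
have I0 : I [::] s1.
  split=> //; first by exists zs.
    by rewrite /= addn0.
  by move=> v; rewrite /= sY !inE.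
have inY a z b s' : I a s' -> zs = a ++ z :: b -> arr s' aInY (arr s' aXL (var s' vIdx)) = (z \in
  Y).
  move=> [k' _ _ -> st] zE; rewrite (xl1 _ _ _ _ k' zE) (st z) !inE.
  by move: un; rewrite zE cat_uniq /= negb_or => /and3P[_ /andP[-> _] _].
apply: (@runs_seq _ _ _ _ (Phi [::] + 15) 12); last by rewrite /Phi subn0; slia.
apply: (@runs_mono _ _ _ (Phi [::] + 10) _ (fun s' => ev s' (($vIdx < $vHi) * Get aInY (Get aXL
  $vIdx))%X = 0 /\ exists a, I a s')) => //.
- apply: (runs_while (I := I) (Phi := Phi) w1 I0) => //.
  + move=> a s2 I2 /=; have [k2 [b zE] _ i2 _] := I2.
    rewrite i2 (hi1 _ k2); case: b zE => [|z b] zE.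
      by rewrite zE cats0 ltnn mul0n w0.
    by rewrite -i2 (inY _ _ _ _ I2 zE) mulnb; case: (_ && _).
  + move=> a s2 I2 /=; have [k2 [b zE] sub i2 st2] := I2.
    rewrite i2 (hi1 _ k2); case: b zE => [|z b] zE.
      by rewrite zE cats0 ltnn mul0n.
    rewrite -i2 (inY _ _ _ _ I2 zE) mulnb eqb0 negbK => /andP[_ zY].
    have sz : size zs = size a + (size b).+1 by rewrite zE size_cat.
    have PhiE : Phi a = 25 + Phi (rcons a z).
      by rewrite /Phi size_rcons sz; slia.
    exists 15; first by rewrite PhiE /=; slia.
    simple_run; rewrite /= ?i2; first by rewrite w0 w1; slia.
    move=> k3; exists (rcons a z); first by rewrite PhiE /=; slia.
    split=> /=.
    * exact: keep_trans k2 k3.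
    * by exists b; rewrite cat_rcons.
    * by move=> x; rewrite mem_rcons inE => /orP[/eqP->//|/sub].
    * by rewrite size_rcons addn1 addnS.
    move=> v; rewrite (xl1 _ _ _ _ k2 zE) /= !inE mem_rcons inE (inj_eq val_inj).
    case: (eqVneq v z) => //= _; have := st2 v; rewrite !inE => <-. by [].
  by rewrite /=; slia.
- by slia.
move=> s2 _ [/= z0 [a I2]] _; have [k2 [b zE] sub i2 st2] := I2.
move: z0; rewrite i2 (hi1 _ k2).
case: b zE => [|z b] zE.
  rewrite zE cats0 in xl1 *; move=> _; simple_run; rewrite /= i2 (hi1 _ k2) zE cats0 ltnn //=.
  left; split=> //; split; last by apply: code_full.
  move=> v; rewrite st2 !inE; have := subsetP Yz v; rewrite inE zE cats0.
  by case: (v \in Y) => [/(_ isT)->|_]; rewrite ?andbF.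
have lt : lo + size a < lo + size zs by rewrite zE size_cat /=; slia.
rewrite -i2 (inY _ _ _ _ I2 zE) i2 lt mul1n => /eqP; rewrite eqb0 => zY.
simple_run; rewrite /= i2 (hi1 _ k2) lt //= ?w1 // (xl1 _ _ _ _ k2 zE).
right; exists (z |: (Y :\: [set x in a])); split=> /=.
- by rewrite (k2.1 vDone isT).
- move=> v /=; rewrite (inj_eq val_inj) in_setU in_set1; case: eqVneq => //= _; exact: st2.
- apply/subsetP => x; rewrite !inE => /orP[/eqP->|/andP[_ xY]].
    by rewrite zE mem_cat inE eqxx orbT.
  by have := subsetP Yz x xY; rewrite inE.
by rewrite zE code_succ // -zE.
Qed.

Lemma runs_enumerate s half lo (zs : seq 'I_n) (X hd : {set 'I_n}) ch
    (Z := [set x in zs]) :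
  half < cap w ->
  has_input k adj s -> chained e X hd ch s ->
  (forall v : 'I_n, (arr s aXH v == half) = (v \in Z)) -> (forall v : 'I_n, arr s aXH v <= 2) ->
  Z \subset X -> var s vK1 = k.+1 ->
  uniq zs -> lo + size zs <= n -> var s vLo = lo -> var s vHi = lo + size zs ->
  (forall a z b, zs = a ++ z :: b -> arr s aXL (lo + size a) = z) ->
  stores (arr s aInY) 0 (set0 : {set 'I_n}) -> best_ok k e s ->
  runs w (Enumerate half) s (2 ^ size zs * (1000 * (n * (k * k) + M) + 30 * n + 1100) + 20) (fun
    s' =>
    [/\ best_ok k e s', var s vBest <= var s' vBest, stores (arr s' aInY) 0 (set0 : {set 'I_n}) &
      forall S : {set 'I_n}, #|S| = k -> pairs (edge_at e X Z) S < var s' vBest]).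
Proof.
move=> halfw hs chd sZ s2 ZX sk1 un ln slo shi xl sY bo.
have w1 := word_gt1 w_ok; have w0 := ltnW w1.
set T1 := 1000 * (n * (k * k) + M) + 1000.
set T2 := 30 * n + 40.
have TE : 1000 * (n * (k * k) + M) + 30 * n + 1100 = T1 + T2 + 60 by rewrite /T1 /T2; slia.
rewrite TE; set T := T1 + T2 + 60.
apply: (@runs_seq _ _ _ _ 2 (2 ^ size zs * T + 15)); last by slia.
simple_run; rewrite //= => _; set s1 := set_var _ _ _.
pose body := Seq (Try half) Increment.
(* Candidates are classified by the code of their intersection with [Z]; those with a code below the
   current one are settled. *)
pose I (g : option {set 'I_n}) s' :=
  [/\ keep (wvars body) (warrs body) s1 s', best_ok k e s', var s vBest <= var s' vBest &
   if g is Some Y then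
     [/\ Y \subset Z, stores (arr s' aInY) 0 Y, var s' vDone = 0
       & forall S : {set 'I_n}, #|S| = k -> code zs S < code zs Y -> pairs (edge_at e X Z) S <
         var s' vBest]
   else [/\ var s' vDone = 1, stores (arr s' aInY) 0 (set0 : {set 'I_n})
       & forall S : {set 'I_n}, #|S| = k -> pairs (edge_at e X Z) S < var s' vBest]].
pose Phi g := if g is Some Y then (2 ^ size zs - code zs Y) * T else 0.
have code0 : code zs set0 = 0 by elim: (zs) => //= z l ->; rewrite inE.
have I0 : I (Some set0) s1.
  split=> //; split=> //; first by apply: sub0set.
  by move=> S _; rewrite code0 ltn0.
apply: (@runs_mono _ _ _ (Phi (Some set0) + 10) _ (fun s' => ev s' ($vDone == 0)%X = 0 /\ exists
  g, I g s')) => //.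
- apply: (runs_while (I := I) (Phi := Phi) w1 I0) => //.
  case=> [Y|] s3 [k3 bo3 le3 I3]; last by case: I3 => /= ->.
  have [YZ sY3 d3 all3] := I3 => _.
  have PhiE : Phi (Some Y) = T + (2 ^ size zs - (code zs Y).+1) * T.
    rewrite /Phi -mulSn; congr (_ * _); by rewrite subnSK ?code_lt.
  exists (T1 + T2 + 10).
    by rewrite PhiE /T /=; apply: leq_trans (leq_addr _ _); slia.
  have hs3 : has_input k adj s3 by apply: has_input_keep k3 _ _ _ _ _.
  have ch3 : chained e X hd ch s3.
    by split; rewrite ?(k3.2 aXH isT) ?(k3.2 aHead isT) ?(k3.2 aCls isT) ?(k3.2 aNext isT);
      case: chd.
  have sZ3 (v : 'I_n) : (arr s3 aXH v == half) = (v \in Z) by rewrite (k3.2 aXH isT) /= sZ.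
  have s23 (v : 'I_n) : arr s3 aXH v <= 2 by rewrite (k3.2 aXH isT); apply: s2.
  have K3 : var s3 vK1 = k.+1 by rewrite (k3.1 vK1 isT).
  apply: (@runs_seq _ _ _ _ T1 T2); last by slia.
  apply: (runs_mono (runs_try e_sym e_irr adjP w_ok k_gt0 k_le_n halfw hs3 ch3 sZ3 s23 ZX YZ K3
    sY3 bo3)) => //.
  move=> s4 k4 [bo4 le4 all4] _.
  have lo4 : var s4 vLo = lo by rewrite (k4.1 vLo isT) (k3.1 vLo isT).
  have hi4 : var s4 vHi = lo + size zs by rewrite (k4.1 vHi isT) (k3.1 vHi isT).
  have d4 : var s4 vDone = 0 by rewrite (k4.1 vDone isT).
  have sY4 : stores (arr s4 aInY) 0 Y by move=> v; rewrite (k4.2 aInY isT).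
  have xl4 a z b : zs = a ++ z :: b -> arr s4 aXL (lo + size a) = z.
    by move=> /xl; rewrite (k4.2 aXL isT) (k3.2 aXL isT).
  have upto (S : {set 'I_n}) : #|S| = k -> code zs S <= code zs Y ->
      pairs (edge_at e X Z) S < var s4 vBest.
    move=> lS; rewrite leq_eqVlt => /orP[/eqP E|lt]; last first.
      by apply: leq_trans le4; apply: all3.
    apply: all4 => //; apply/setP => x; rewrite inE [x \in Z]inE.
    case xz: (x \in zs); first by rewrite andbT (code_eq E xz).
    by rewrite andbF; apply/esym/negbTE; apply: contraFN xz => /(subsetP YZ); rewrite inE.
  apply: (runs_mono (runs_increment un ln lo4 hi4 xl4 YZ sY4 d4)) => // s5 k5 H5 k34.
  have B5 : var s5 vBest = var s4 vBest by rewrite (k5.1 vBest isT).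
  have bo5 : best_ok k e s5 by rewrite /best_ok B5 /output (k5.2 aOut isT).
  have le5 : var s vBest <= var s5 vBest by rewrite B5; apply: leq_trans le4.
  have k35 : keep (wvars body) (warrs body) s1 s5 by apply: keep_trans k3 k34.
  case: H5 => [[d5 [s0 full]]|[Y' [d5 st5 YZ' cE]]].
    exists None.
      by rewrite PhiE /T /= addn0; apply: leq_trans (leq_addr _ _); slia.
    split=> //; split=> // S lS; rewrite B5; apply: upto => //.
    by have := code_lt zs S; rewrite -full ltnS.
  exists (Some Y'); first by rewrite PhiE /Phi cE /=; move: (_ * T) => z; slia.
  split=> //; split=> // S lS; rewrite cE ltnS B5; exact: upto.
  by rewrite leq_add2l.
- by rewrite /Phi code0 subn0 leq_add2l.
move=> s3 _ [/= z [[Y|] [k3 bo3 le3]]]; first by case=> _ _ d3; rewrite d3 in z.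
by case=> _ st3 all3.
Qed.

End Enumerate.

(** * The algorithm *)

(** The test of [vK] matters for the running time: for k = 0 on an edgeless graph the claimed bound
    is constant while n is arbitrary. For k > 0 the term k^3 n pays for passes over all vertices. *)
Definition Main : cmd :=
  If $vK
    (Refine ;; Search ;; ListCover ;; Chains ;;
     vK1 ::= $vK + 1 ;;
     vLo ::= 0 ;; vHi ::= $vH ;; Enumerate 1 ;;
     vLo ::= $vH ;; vHi ::= $vB ;; Enumerate 2)
    Skip.

Section Main.
Variables (n k : nat) (e : rel 'I_n) (adj : 'I_n -> seq 'I_n) (w : nat).
Hypothesis e_sym : symmetric e.
Hypothesis e_irr : irreflexive e.
Hypothesis adjP : adjacency_lists e adj.
Hypothesis w_ok : word_size_ok 6 n w.
Hypothesis k_le_n : k <= n.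
Local Notation M := (off adj n).
Local Notation tc := (twin_cover_number e).
Local Notation m := #|edges e|.

Lemma off_edges : M = 2 * m.
Proof.
have -> : m = nb_edges_in e setT.
  by apply: eq_card => A; rewrite inE subsetT andbT.
rewrite -(pairs_edges e_sym e_irr) /pairs /off; apply: eq_big => u; first by rewrite ltn_ord inE.
move=> _; have [un mu] := adjP u; rewrite card_nbrs -(card_uniqP un).
by apply: eq_card => v; rewrite !inE mu.
Qed.

Lemma listed_nth X h (xs : seq 'I_n) s a z b :
  listed X h xs s -> xs = a ++ z :: b -> arr s aXL (size a) = z.
Proof.
case=> _ _ E _ xsE; have la : size a < size xs by rewrite xsE size_cat /=; slia.
by rewrite -(nth_mkseq 0 (arr s aXL) la) -E (nth_map z) // xsE nth_cat ltnn subnn.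
Qed.

(** As [A] is positive, additive constants are absorbed into multiples of [A], and the numbers of
    search nodes and of subsets are multiples of [P]. *)
Lemma time_bound : 0 < k ->
  100 * (n + M) + 100 + ((600 * (n + M) + 600 + 4) * (8 * general_size (tc + 4)) + 50) +
  (100 * n + 30) + (50 * n + 10) +
  2 * (2 ^ uphalf tc * (1000 * (n * (k * k) + M) + 30 * n + 1100) + 20) + 100
  <= 3000 * 3000 * (2 ^ tc./2 * (k ^ 3 * n + m)).
Proof.
move=> k0; set P := 2 ^ tc./2; set A := k ^ 3 * n + m.
have n0 : 0 < n by apply: leq_trans k0 k_le_n.
have P0 : 0 < P by rewrite expn_gt0.
have kkA : n * (k * k) <= A.
  rewrite /A !expnS expn0 muln1; apply: leq_trans (leq_addr _ _).
  by rewrite [_ * n]mulnC leq_mul2l leq_pmull ?orbT.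
have nA : n <= A by apply: leq_trans kkA; rewrite leq_pmulr // muln_gt0 k0.
have MA : M <= 2 * A by rewrite off_edges /A; slia.
(* The odd case is the worse one: 96 * 2 ^ 2 = 384. *)
have gP : general_size (tc + 4) <= 384 * P.
  rewrite /general_size oddD addbF halfD andbF add0n /= expnD /P.
  by case: (odd tc); move: (2 ^ _) => z; slia.
have uP : 2 ^ uphalf tc <= 2 * P.
  rewrite uphalf_half; case: (odd tc); rewrite ?add0n ?add1n ?expnS // /P.
  by rewrite leq_pmull.
have A0 : 0 < A by apply: leq_trans nA.
have PA : A <= P * A by rewrite leq_pmull.
(* Here 2404 = 600 + 2 * 600 + 604 and 3072 = 8 * 384; below, 4130 = 1000 + 2 * 1000 + 30 + 1100. *)
have t1 : (600 * (n + M) + 600 + 4) * (8 * general_size (tc + 4)) <= 2404 * 3072 * (P * A).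
  apply: (@leq_trans ((2404 * A) * (3072 * P))); last by rewrite mulnACA [A * P]mulnC leqnn.
  by apply: leq_mul; slia.
have t2 : 2 ^ uphalf tc * (1000 * (n * (k * k) + M) + 30 * n + 1100) <= 2 * 4130 * (P * A).
  apply: (@leq_trans ((2 * P) * (4130 * A))); last by rewrite mulnACA leqnn.
  by apply: leq_mul; slia.
move: t1 t2; move: (_ * (8 * _)) (_ * (1000 * _ + _ + _)) => z1 z2 l1 l2.
move: l1 l2 PA MA nA A0; rewrite -/A; move: (P * A) => B; slia.
Qed.

Lemma densest_le c : (forall S' : {set 'I_n}, #|S'| = k -> nb_edges_in e S' <= c) ->
  densest_opt e k <= c.
Proof. by move=> H; apply/bigmax_leqP => S' /eqP; apply: H. Qed.

Lemma ex_set : exists S : {set 'I_n}, #|S| = k.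
Proof.
exists [set x in take k (enum 'I_n)].
rewrite cardsE (card_uniqP (take_uniq _ (enum_uniq _))) size_take size_enum_ord.
by case: ltngtP k_le_n.
Qed.

Definition solved (s : state) :=
  #|output n s| = k /\ densest_opt e k <= 2 * nb_edges_in e (output n s).

Lemma runs_main : 0 < k ->
  runs w Main (input k adj) (3000 * 3000 * (2 ^ tc./2 * (k ^ 3 * n + m))) solved.
Proof.
move=> k0; set s0 := input k adj; have tb := time_bound k0.
have w1 := word_gt1 w_ok; have w0 := ltnW w1; have wn := word_gtn w_ok.
have w2 : 2 < cap w by slia.
set TR := 100 * (n + M) + 100 in tb.
set TS := _ * _ + 50 in tb.
set TE := 2 ^ uphalf tc * _ in tb.
have a0 A i : 1 < A -> arr s0 A i = 0 by case: A => [|[|A]] //= _; rewrite !nth_nil.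
have v0 x : 1 < x -> var s0 x = 0 by case: x => [|[|x]] //= _; rewrite ?nth_nil.
have hs0 : has_input k adj s0 by apply: has_input0.
apply: (@runs_if _ _ _ _ _ (TR + TS + (100 * n + 30) + (50 * n + 10) + 2 * (TE + 20) + 70)) =>
  //; last first.
  by apply: leq_trans tb; rewrite /=; slia.
- by move=> /= z; rewrite z in k0.
move=> _.
  apply: (@runs_seq _ _ _ _ TR (TS + (100 * n + 30) + (50 * n + 10) + 2 * (TE + 20) + 68)); last
    by slia.
  have r := runs_refine e_sym e_irr adjP w_ok hs0 (fun i => a0 aCls i isT) (fun i => a0 aStamp i
    isT).
  apply: (runs_mono r) => // s1 k1 cl1 _.
  have hs1 : has_input k adj s1 by apply: has_input_keep k1 _ _ _ _ hs0.
  apply: (@runs_seq _ _ _ _ TS ((100 * n + 30) + (50 * n + 10) + 2 * (TE + 20) + 66)); last by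
    slia.
  have z1 i : arr s1 aStk i = 0 by rewrite (k1.2 aStk isT) a0.
  apply: (runs_mono (runs_search e_sym e_irr adjP w_ok hs1 cl1 z1)) => // s2 k2 [X [cX tX t2 _
    [st2 lb2]]] _.
  have hs2 : has_input k adj s2 by apply: has_input_keep k2 _ _ _ _ hs1.
  apply: (@runs_seq _ _ _ _ (100 * n + 30) ((50 * n + 10) + 2 * (TE + 20) + 64)); last by slia.
  have XH2 i : arr s2 aXH i = 0 by rewrite (k2.2 aXH isT) (k1.2 aXH isT) a0.
  have B2 : var s2 vB = #|X| by rewrite tX.
  apply: (runs_mono (runs_list w_ok hs2 B2 st2 lb2 XH2)) => // s3 k3 [h3 [xs ls3]] _.
  have hs3 : has_input k adj s3 by apply: has_input_keep k3 _ _ _ _ hs2.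
  have [un mX xsE xh3] := ls3.
  have sxs : size xs = tc by rewrite -tX -(card_uniqP un); apply: eq_card.
  rewrite tX in h3 xh3 ls3.
  apply: (@runs_seq _ _ _ _ (50 * n + 10) (2 * (TE + 20) + 62)); last by slia.
  have cl3 : has_classes e s3 by move=> a b; rewrite (k3.2 aCls isT) (k2.2 aCls isT); apply: cl1.
  have XH3 (v : 'I_n) : (arr s3 aXH v != 0) = (v \in X).
    by rewrite xh3; case: (v \in X) => //; case: (_ < _).
  have H3 i : arr s3 aHead i = 0 by rewrite (k3.2 aHead isT) (k2.2 aHead isT) (k1.2 aHead isT) a0.
  have N3 i : arr s3 aNext i = 0 by rewrite (k3.2 aNext isT) (k2.2 aNext isT) (k1.2 aNext isT) a0.
  apply: (runs_mono (runs_chains w_ok hs3 cl3 XH3 H3 N3)) => // s4 k4 [hd [ch chd4]] _.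
  have hs4 : has_input k adj s4 by apply: has_input_keep k4 _ _ _ _ hs3.
  have sk4 : var s4 vK = k by case: hs4.
  have h4 : var s4 vH = uphalf tc by rewrite (k4.1 vH isT).
  have t4 : var s4 vB = tc by rewrite (k4.1 vB isT) (k3.1 vB isT).
  have ls4 : listed X (uphalf tc) xs s4.
    by split=> //; rewrite ?(k4.2 aXL isT) ?(k4.2 aXH isT).
  have xh4 (v : 'I_n) : arr s4 aXH v = if v \in X then 2 - (index v xs < uphalf tc) else 0.
    by case: ls4.
  have tn : tc <= n by rewrite -[n in _ <= n]card_ord max_card.
  have hle : uphalf tc <= tc by rewrite uphalf_half; have := odd_double_half tc; slia.
  have hle2 : tc - uphalf tc <= uphalf tc by rewrite uphalf_half; have := odd_double_half tc;
    slia.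
  pose zs1 := take (uphalf tc) xs; pose zs2 := drop (uphalf tc) xs.
  have sz1 : size zs1 = uphalf tc by rewrite size_take sxs; case: ltngtP hle.
  have sz2 : size zs2 = tc - uphalf tc by rewrite size_drop sxs.
  have catE : xs = zs1 ++ zs2 by rewrite cat_take_drop.
  have [un1 dis un2] : [/\ uniq zs1, ~~ has (mem zs1) zs2 & uniq zs2].
    by apply/and3P; rewrite -cat_uniq -catE.
  have in1 v : (v \in zs1) = (v \in X) && (index v xs < uphalf tc).
    case: (boolP (v \in X)) => vX; first by rewrite in_take ?mX.
    by apply: contraNF vX => /mem_take; rewrite mX.
  have in2 v : (v \in zs2) = (v \in X) && ~~ (index v xs < uphalf tc).
    case: (boolP (v \in X)) => vX /=; last by apply: contraNF vX => /mem_drop; rewrite mX.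
    have vE := in1 v; rewrite vX /= in vE; rewrite -vE.
    have : (v \in zs1) || (v \in zs2) by rewrite -mem_cat -catE mX.
    case: (boolP (v \in zs1)) => //= v1 _.
    by apply/negbTE; apply: contra dis => v2; apply/hasP; exists v.
  have hX : twin_cover e X by rewrite twin_coverE.
  apply: (@runs_seq _ _ _ _ 4 (2 * (TE + 20) + 57)); last by slia.
  simple_run; rewrite /= sk4 ?w1 ?addn1 /=; first by slia.
  move=> _; apply: (@runs_seq _ _ _ _ 2 (2 * (TE + 20) + 54)); last by slia.
  simple_run; rewrite //= => _; apply: (@runs_seq _ _ _ _ 2 (2 * (TE + 20) + 51)); last by slia.
  simple_run; rewrite //= h4 => _; set s5 := set_var _ _ _.
  have hs5 : has_input k adj s5 by apply: hs4.
  have ch5 : chained e X hd ch s5 by apply: chd4.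
  have half1 (v : 'I_n) : (arr s5 aXH v == 1) = (v \in [set x in zs1]).
    by rewrite inE in1 /= xh4; case: (v \in X) => //; case: (_ < _).
  have half2 (v : 'I_n) : (arr s5 aXH v == 2) = (v \in [set x in zs2]).
    by rewrite inE in2 /= xh4; case: (v \in X) => //; case: (_ < _).
  have le5 (v : 'I_n) : arr s5 aXH v <= 2.
    by rewrite /= xh4; case: (v \in X) => //; case: (_ < _).
  have Z1X : [set x in zs1] \subset X by apply/subsetP => v; rewrite inE in1 => /andP[].
  have Z2X : [set x in zs2] \subset X by apply/subsetP => v; rewrite inE in2 => /andP[].
  have ln1 : 0 + size zs1 <= n by rewrite sz1 add0n; apply: leq_trans hle tn.
  have ln2 : uphalf tc + size zs2 <= n by rewrite sz2 subnKC.
  have xl1 a z b : zs1 = a ++ z :: b -> arr s5 aXL (0 + size a) = z.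
    by move=> zE; apply: (listed_nth (b := b ++ zs2) ls4); rewrite catE zE -catA.
  have xl2 a z b : zs2 = a ++ z :: b -> arr s5 aXL (uphalf tc + size a) = z.
    by move=> zE; rewrite -sz1 -size_cat; apply: (listed_nth (b := b) ls4); rewrite catE zE catA.
  have Y5 : stores (arr s5 aInY) 0 (set0 : {set 'I_n}).
    by move=> v; rewrite /= (k4.2 aInY isT) (k3.2 aInY isT) (k2.2 aInY isT) (k1.2 aInY isT) a0
      ?inE.
  have b5 : var s5 vBest = 0.
    by rewrite /= (k4.1 vBest isT) (k3.1 vBest isT) (k2.1 vBest isT) (k1.1 vBest isT) v0.
  have bo5 : best_ok k e s5 by rewrite /best_ok b5.
  have hi5 : var s5 vHi = 0 + size zs1 by rewrite sz1.
  have r1 := runs_enumerate e_sym e_irr adjP w_ok k0 k_le_n w1 hs5 ch5 half1 le5 Z1X (erefl _)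
    un1 ln1 (erefl _) hi5 xl1 Y5 bo5.
  apply: (@runs_seq _ _ _ _ (TE + 20) (TE + 20 + 30)); last by slia.
  apply: (runs_mono r1); first by rewrite sz1.
  move=> s6 k6 [bo6 _ Y6 all6] _.
  have hs6 : has_input k adj s6 by apply: has_input_keep k6 _ _ _ _ hs5.
  have h6 : var s6 vH = uphalf tc by rewrite (k6.1 vH isT).
  have t6 : var s6 vB = tc by rewrite (k6.1 vB isT).
  apply: (@runs_seq _ _ _ _ 2 (TE + 20 + 27)); last by slia.
  simple_run; rewrite //= h6 => _; apply: (@runs_seq _ _ _ _ 2 (TE + 20 + 24)); last by slia.
  simple_run; rewrite //= t6 => _; set s7 := set_var _ _ _.
  have hs7 : has_input k adj s7 by apply: hs6.
  have ch7 : chained e X hd ch s7.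
    by split; rewrite /= ?(k6.2 aXH isT) ?(k6.2 aHead isT) ?(k6.2 aCls isT) ?(k6.2 aNext isT);
      case: ch5.
  have half7 (v : 'I_n) : (arr s7 aXH v == 2) = (v \in [set x in zs2]).
    by rewrite /= (k6.2 aXH isT).
  have le7 (v : 'I_n) : arr s7 aXH v <= 2 by rewrite /= (k6.2 aXH isT).
  have K7 : var s7 vK1 = k.+1 by rewrite /= (k6.1 vK1 isT).
  have xl7 a z b : zs2 = a ++ z :: b -> arr s7 aXL (uphalf tc + size a) = z.
    by move=> /xl2; rewrite /= (k6.2 aXL isT).
  have hi7 : var s7 vHi = uphalf tc + size zs2 by rewrite sz2 subnKC.
  have bo7 : best_ok k e s7 by apply: bo6.
  have r2 := runs_enumerate e_sym e_irr adjP w_ok k0 k_le_n w2 hs7 ch7 half7 le7 Z2X K7 un2 ln2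
    (erefl _) hi7 xl7 Y6 bo7.
  apply: (runs_mono r2).
    apply: (@leq_trans (TE + 20)); last by slia.
    by rewrite leq_add2r leq_mul2r leq_pexp2l ?sz2 ?orbT.
  move=> s8 k8 [bo8 le8 _ all8].
  (* Any k-set forces the record to be nonzero, so the output is a genuine answer. *)
  have [S0 cS0] := ex_set.
  have [out8 best8] : #|output n s8| = k /\ var s8 vBest <= (pairs e (output n s8)).+1.
    by apply: bo8; rewrite -lt0n; apply: leq_ltn_trans (all8 S0 cS0).
  split=> //; apply: densest_le => S cS.
  have XZ : X \subset [set x in zs1] :|: [set x in zs2].
    by apply/subsetP => v vX; rewrite !inE in1 in2 vX /=; case: (_ < _).
  (* For each half the count of [S] is below [vBest], hence at most the count of the output. Halving
     the ordered pairs gives the factor 2. *)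
  have := pairs_cover S hX XZ.
  have l1 := leq_trans (all6 S cS) le8; have l2 := all8 S cS.
  rewrite (pairs_edges e_sym e_irr) (pairs_edges e_sym e_irr) in best8 *.
  by move: l1 l2 best8; slia.
Qed.

Lemma runs_zero : k = 0 -> exec w Main (input k adj) 3 (input k adj) /\ solved (input k adj).
Proof.
move=> k0; split.
  rewrite -[3]/(cost $vK + 1).+1; apply: exec_if => /=; rewrite k0 /=.
  exact: exec_skip.
have S0 (S : {set 'I_n}) : #|S| = k -> S = set0 by rewrite k0 => /eqP; rewrite cards_eq0 => /eqP.
have out0 : output n (input k adj) = set0.
  by apply/setP => v; rewrite !inE /= nth_nil.
split; first by rewrite out0 cards0 k0.
by apply: densest_le => S /S0 ->; rewrite out0 leq_pmull.
Qed.

End Main.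

(** * Transfer to real exponents *)

Import Order.TTheory GRing.Theory Num.Theory.

Local Open Scope ring_scope.

Lemma expn_half_powR (R : realType) (t : nat) :
  ((2 ^ t./2)%N)%:R <= 2 `^ (t%:R / 2) :> R.
Proof.
rewrite natrX -powR_mulrn //; apply: ler_powR; first by rewrite ler1n.
rewrite ler_pdivlMr // -natrM ler_nat.
by rewrite muln2 -[leqRHS]odd_double_half leq_addl.
Qed.

Theorem theorem4 (R : realType) :
  exists (p : cmd) (c : nat) (C : R),
    forall (n : nat) (e : rel 'I_n) (k : nat) (adj : 'I_n -> seq 'I_n) (w : nat),
      symmetric e -> irreflexive e -> (k <= n)%N ->
      adjacency_lists e adj -> word_size_ok c n w ->
      let tc := twin_cover_number e in
      let m := #|edges e| in
      exists (t : nat) (s : state),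
        [/\ exec w p (input k adj) t s,
            t%:R <= C * (1 + 2 `^ (tc%:R / 2) * ((k ^ 3 + tc) * n + m)%N%:R),
            #|output n s| = k
          & (densest_opt e k <= 2 * nb_edges_in e (output n s))%N].
Proof.
exists Main, 6%N, (3000 * 3000)%N%:R => n e k adj w e_sym e_irr kn adjP w_ok tc m.
(* For k = 0 the three steps are paid by the constant summand of the bound. *)
have [k0|k0] := posnP k.
  have [ex [out opt]] := runs_zero e adj w k0.
  exists 3%N, (input k adj); split=> //.
  rewrite -[leLHS]mulr1; apply: ler_pM => //; first by rewrite ler_nat.
  by rewrite lerDl mulr_ge0 ?powR_ge0.
have [t [s [ex lt [out opt]]]] := runs_main e_sym e_irr adjP w_ok kn k0.
exists t, s; split=> //; apply: le_trans (_ : ((3000 * 3000) * (2 ^ tc./2 * (k ^ 3 * n +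
  m)))%N%:R <= _).
  by rewrite ler_nat.
rewrite natrM; apply: ler_wpM2l => //.
apply: le_trans (_ : 2 `^ (tc%:R / 2) * ((k ^ 3 + tc) * n + m)%N%:R <= _); last by rewrite lerDr.
rewrite natrM; apply: ler_pM => //; first exact: expn_half_powR.
by rewrite ler_nat leq_add2r leq_mul2r leq_addr orbT.
Qed.
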